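(* Let $(K,G)$ be a hyper-Kähler manifold with Riemannian curvature tensor $\hat R$. If $M$ is a qc-hypersurface of $K$ with (unit) normal vector field $N$, then $\hat R_{vw}N=0$ for all $p\in M$ and all $v,w\in T_pK$. In particular, the Riemannian curvature tensor $\hat R$ is degenerate at each point $p$ of the hypersurface $M$.
   Context: QC manifolds. A quaternionic contact (qc) manifold is a $(4n+3)$-dimensional manifold $M$, $n\ge1$, with a codimension three distribution $H$ (the horizontal space), a positive definite symmetric tensor $g$ on $H$ and a rank three bundle $\mathbb{Q}$ of endomorphisms of $H$ such that locally there are a 1-form $\eta=(\eta_1,\eta_2,\eta_3)$ with values in $\mathbb{R}^3$ with $H=\bigcap_{s}\ker\eta_s$, and almost complex structures $I_1,I_2,I_3$ on $H$ generating $\mathbb{Q}$, with $I_1I_2=-I_2I_1=I_3$, $I_1I_2I_3=-\mathrm{id}_H$, $g(I_s\cdot,I_s\cdot)=g(\cdot,\cdot)$ and $2g(I_sX,Y)=d\eta_s(X,Y)$ for all $X,Y\in H$, $s=1,2,3$. If $n=1$ one requires in addition the (local) existence of Reeb vector fields $\xi_1,\xi_2,\xi_3$ with $\eta_s(\xi_t)=\delta_{st}$, $(\xi_s\lrcorner d\eta_s)|_H=0$, $(\xi_s\lrcorner d\eta_t)|_H=-(\xi_t\lrcorner d\eta_s)|_H$. QC-hypersurfaces. Let $K$ be hyper-Kähler of dimension $4n+4$ with parallel complex structures $J_1,J_2,J_3$ satisfying the quaternion relations. An embedded hypersurface $M\subset K$ is a qc-hypersurface if $M$ carries a qc structure whose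 horizontal space $H$ is a $J_s$-invariant ($s=1,2,3$) subbundle of $TM$ of codimension four in $TK|_M$ (so $H$ is the maximal $J_s$-invariant subspace of $TM$), and the restrictions of $J_1,J_2,J_3$ to $H$ are elements of the quaternionic structure $\mathbb{Q}$ of $M$. (Equivalently, the second fundamental form of $M$ restricted to $H$ is definite and $J_s$-invariant.) Here $\hat R_{vw}=[D_v,D_w]-D_{[v,w]}$, with $D$ the Levi-Civita connection of $G$; ''degenerate at $p$'' means that $\hat R_{vw}u=0$ for all $v,w\in T_pK$ for some nonzero $u\in T_pK$. *)

(* Defs.v *)
From HB Require Import structures.
From mathcomp Require Export all_boot all_order all_algebra.
From mathcomp Require Export all_classical all_reals all_analysis.
Export numFieldNormedType.Exports.
Import Order.TTheory GRing.Theory Num.Theory.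

Set Implicit Arguments.
Unset Strict Implicit.
Unset Printing Implicit Defensive.

Local Open Scope classical_set_scope.
Local Open Scope ring_scope.

Fixpoint Ck_on (R : realType) (V W : normedModType R) (k : nat)
    (O : set V) (f : V -> W) : Prop :=
  match k with
  | 0 => forall x, O x -> {for x, continuous f}
  | k'.+1 => (forall x, O x -> differentiable f x) /\
             (forall v : V, Ck_on k' O ('D_v f))
  end.

Definition smooth_on (R : realType) (V W : normedModType R)
    (O : set V) (f : V -> W) : Prop := forall k, Ck_on k O f.

Definition smooth_near (R : realType) (V W : normedModType R)
    (x : V) (f : V -> W) : Prop :=
  exists O : set V, [/\ open O, O x & smooth_on O f].

(* The smooth structure is given by an atlas with one distinguished chart
   [chart p] around each point p; any manifold has such an atlas (pick a chart
   around each point), and it determines the maximal atlas.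
   [param p] is the inverse of [chart p]. *)
Record manifold (R : realType) (d : nat) (T : topologicalType) := Manifold {
  chart : T -> T -> 'rV[R]_d ;
  param : T -> 'rV[R]_d -> T ;
  dom : T -> set T ;
  manifold_hausdorff : hausdorff_space T ;
  manifold_second_countable : @second_countable T ;
  dom_open : forall p, open (dom p) ;
  dom_self : forall p, dom p p ;
  image_open : forall p, open (chart p @` dom p) ;
  chartK : forall p q, dom p q -> param p (chart p q) = q ;
  chart_continuous : forall p q, dom p q -> {for q, continuous (chart p)} ;
  param_continuous : forall p x, (chart p @` dom p) x ->
    {for x, continuous (param p)} ;
  transition_smooth : forall p q,
    smooth_on (chart p @` (dom p `&` dom q)) (chart q \o param p) }.

(* Convention: the tangent space T_pT is 'rV[R]_d, a vector v standing for the
   tangent vector at p with components v in the distinguished chart at p.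
   A vector field is thus a map T -> 'rV[R]_d whose value at q is expressed in
   the chart at q, and all changes of chart go through [tchange]. *)
Section Manifold.
Variables (R : realType) (d : nat) (T : topologicalType).
Variable (A : manifold R d T).
Local Notation vec := 'rV[R]_d.

(* Components in the chart at q of the tangent vector at r whose components in
   the chart at p are v. *)
Definition tchange (p q r : T) (v : vec) : vec :=
  'd (chart A q \o param A p) (chart A p r) v.

Definition field_rep (p : T) (X : T -> vec) (x : vec) : vec :=
  let q := param A p x in tchange q p q (X q).

Definition smooth_fun_at (p : T) (f : T -> R) : Prop :=
  smooth_near (chart A p p) (f \o param A p).

Definition smooth_field_at (p : T) (X : T -> vec) : Prop :=
  smooth_near (chart A p p) (field_rep p X).

Definition smooth_field (X : T -> vec) : Prop := forall p, smooth_field_at p X.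

Definition vderiv (p : T) (v : vec) (f : T -> R) : R :=
  'D_v (f \o param A p) (chart A p p).

Definition bracket (X Y : T -> vec) (p : T) : vec :=
  'D_(X p) (field_rep p Y) (chart A p p)
  - 'D_(Y p) (field_rep p X) (chart A p p).

(* Extension of v in T_pT to a smooth field near p, with constant components in
   the chart at p.  It is used to evaluate tensorial expressions (exterior
   derivative, curvature) on tangent vectors; the value does not depend on the
   extension. *)
Definition extend (p : T) (v : vec) (q : T) : vec := tchange p q q v.

(* d eta (X, Y) = X eta(Y) - Y eta(X) - eta([X, Y]), without factor 1/2. *)
Definition dform (eta : T -> vec -> R) (p : T) (v w : vec) : R :=
  let X := extend p v in let Y := extend p w in
  vderiv p v (fun q => eta q (Y q)) - vderiv p w (fun q => eta q (X q))
  - eta p (bracket X Y p).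

Record riemannian_metric (G : T -> vec -> vec -> R) : Prop := {
  metric_linear : forall p w, scalar (G p ^~ w) ;
  metric_sym : forall p v w, G p v w = G p w v ;
  metric_pos : forall p v, v != 0 -> 0 < G p v v ;
  metric_smooth : forall p X Y, smooth_field_at p X -> smooth_field_at p Y ->
    smooth_fun_at p (fun q => G q (X q) (Y q)) }.

(* [D p v Y] is the covariant derivative D_v Y at p of a field Y smooth near p;
   the values on other fields are irrelevant. *)
Record levi_civita (G : T -> vec -> vec -> R)
    (D : T -> vec -> (T -> vec) -> vec) : Prop := {
  conn_linear : forall p Y, smooth_field_at p Y -> linear (fun v => D p v Y) ;
  conn_add : forall p v Y Z, smooth_field_at p Y -> smooth_field_at p Z ->
    D p v (fun q => Y q + Z q) = D p v Y + D p v Z ;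
  conn_leibniz : forall p v f Y, smooth_fun_at p f -> smooth_field_at p Y ->
    D p v (fun q => f q *: Y q) = vderiv p v f *: Y p + f p *: D p v Y ;
  conn_smooth : forall p X Y, smooth_field_at p X -> smooth_field_at p Y ->
    smooth_field_at p (fun q => D q (X q) Y) ;
  conn_torsion_free : forall p X Y, smooth_field_at p X ->
    smooth_field_at p Y -> D p (X p) Y - D p (Y p) X = bracket X Y p ;
  conn_metric : forall p v X Y, smooth_field_at p X -> smooth_field_at p Y ->
    vderiv p v (fun q => G q (X q) (Y q))
    = G p (D p v X) (Y p) + G p (X p) (D p v Y) }.

Definition curvature_field (D : T -> vec -> (T -> vec) -> vec)
    (X Y Z : T -> vec) (p : T) : vec :=
  D p (X p) (fun q => D q (Y q) Z) - D p (Y p) (fun q => D q (X q) Z)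
  - D p (bracket X Y p) Z.

Definition curvature (D : T -> vec -> (T -> vec) -> vec)
    (p : T) (v w u : vec) : vec :=
  curvature_field D (extend p v) (extend p w) (extend p u) p.

Definition degenerate_at (D : T -> vec -> (T -> vec) -> vec) (p : T) : Prop :=
  exists2 u : vec, u != 0 & forall v w, curvature D p v w u = 0.

End Manifold.

(* Endomorphisms I_1, I_2, I_3 (indexed by 0, 1, 2 : 'I_3) of a subspace S. *)
Definition quaternion_relations (R : realType) (d : nat) (S : {vspace 'rV[R]_d})
    (I : 'I_3 -> 'rV[R]_d -> 'rV[R]_d) : Prop :=
  forall X, X \in S ->
    [/\ forall s, I s (I s X) = - X,
        I 0 (I 1 X) = I 2 X,
        I 1 (I 0 X) = - I 2 X
      & I 0 (I 1 (I 2 X)) = - X].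

(* Integrability of the J s follows from their being parallel. *)
Record hyperkahler (R : realType) (d : nat) (T : topologicalType)
    (A : manifold R d T) (G : T -> 'rV[R]_d -> 'rV[R]_d -> R)
    (D : T -> 'rV[R]_d -> (T -> 'rV[R]_d) -> 'rV[R]_d)
    (J : 'I_3 -> T -> {linear 'rV[R]_d -> 'rV[R]_d}) : Prop := {
  hk_metric : riemannian_metric A G ;
  hk_levi_civita : levi_civita A G D ;
  hk_smooth : forall s p X, smooth_field_at A p X ->
    smooth_field_at A p (fun q => J s q (X q)) ;
  hk_quaternion : forall p, quaternion_relations fullv (fun s => J s p) ;
  hk_hermitian : forall s p v w, G p (J s p v) (J s p w) = G p v w ;
  hk_parallel : forall s p v X, smooth_field_at A p X ->
    D p v (fun q => J s q (X q)) = J s p (D p v X) }.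

Section QC.
Variables (R : realType) (n : nat) (M : topologicalType).
Local Notation vec := 'rV[R]_(4 * n + 3).
Variable (A : manifold R (4 * n + 3) M).
Variables (H : M -> {vspace vec}) (g : M -> vec -> vec -> R).
(* Q p is a set of endomorphisms of H p, represented by maps vec -> vec whose
   values outside H p are irrelevant. *)
Variable (Q : M -> set (vec -> vec)).

Definition horizontal_at (p : M) (X : M -> vec) : Prop :=
  smooth_field_at A p X /\ \forall q \near p, X q \in H q.

Record qc_frame (U : set M) (eta : 'I_3 -> M -> {scalar vec})
    (I : 'I_3 -> M -> {linear vec -> vec}) : Prop := {
  frame_eta_smooth : forall s p X, U p -> smooth_field_at A p X ->
    smooth_fun_at A p (fun q => eta s q (X q)) ;
  frame_I_smooth : forall s p X, U p -> horizontal_at p X ->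
    smooth_field_at A p (fun q => I s q (X q)) ;
  frame_ker : forall p X, U p -> X \in H p <-> (forall s, eta s p X = 0) ;
  frame_I_stable : forall s p X, U p -> X \in H p -> I s p X \in H p ;
  frame_quaternion : forall p, U p ->
    quaternion_relations (H p) (fun s => I s p) ;
  frame_generate : forall p Phi, U p -> Q p Phi <->
    exists a : 'I_3 -> R, forall X, X \in H p ->
      Phi X = \sum_(s < 3) a s *: I s p X ;
  frame_hermitian : forall s p X Y, U p -> X \in H p -> Y \in H p ->
    g p (I s p X) (I s p Y) = g p X Y ;
  frame_deta : forall s p X Y, U p -> X \in H p -> Y \in H p ->
    2 * g p (I s p X) Y = dform A (eta s) p X Y }.

Record reeb_fields (U : set M) (eta : 'I_3 -> M -> {scalar vec})
    (xi : 'I_3 -> M -> vec) : Prop := {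
  reeb_smooth : forall s p, U p -> smooth_field_at A p (xi s) ;
  reeb_dual : forall s t p, U p -> eta s p (xi t p) = (s == t)%:R ;
  reeb_self : forall s p X, U p -> X \in H p ->
    dform A (eta s) p (xi s p) X = 0 ;
  reeb_skew : forall s t p X, U p -> X \in H p ->
    dform A (eta t) p (xi s p) X = - dform A (eta s) p (xi t p) X }.

(* The smoothness of H and Q as bundles follows from the local frames. *)
Record qc_structure : Prop := {
  qc_codim : forall p, \dim (H p) = (4 * n)%N ;
  qc_linear : forall p a X Y Z, X \in H p -> Y \in H p -> Z \in H p ->
    g p (a *: X + Y) Z = a * g p X Z + g p Y Z ;
  qc_sym : forall p X Y, X \in H p -> Y \in H p -> g p X Y = g p Y X ;
  qc_pos : forall p X, X \in H p -> X != 0 -> 0 < g p X X ;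
  qc_smooth : forall p X Y, horizontal_at p X -> horizontal_at p Y ->
    smooth_fun_at A p (fun q => g q (X q) (Y q)) ;
  qc_local : forall p, exists U eta I,
    [/\ open U, U p, qc_frame U eta I
      & n = 1%N -> exists xi, reeb_fields U eta xi] }.

End QC.

Section Maps.
Variables (R : realType) (m d : nat) (M K : topologicalType).
Variables (A : manifold R m M) (B : manifold R d K) (iota : M -> K).

Definition map_rep (p : M) : 'rV[R]_m -> 'rV[R]_d :=
  chart B (iota p) \o iota \o param A p.

Definition tangent_map (p : M) (v : 'rV[R]_m) : 'rV[R]_d :=
  'd (map_rep p) (chart A p p) v.

Record smooth_embedding : Prop := {
  emb_continuous : continuous iota ;
  emb_smooth : forall p, smooth_near (chart A p p) (map_rep p) ;
  emb_immersion : forall p, injective (tangent_map p) ;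
  emb_injective : injective iota ;
  emb_open : forall U : set M, open U ->
    exists2 V : set K, open V & U = iota @^-1` V }.

Definition smooth_along (N : M -> 'rV[R]_d) : Prop :=
  forall p, smooth_near (chart A p p)
    (fun x => let q := param A p x in
              tchange B (iota q) (iota p) (iota q) (N q)).

Record unit_normal_field (G : K -> 'rV[R]_d -> 'rV[R]_d -> R)
    (N : M -> 'rV[R]_d) : Prop := {
  normal_smooth : smooth_along N ;
  normal_unit : forall p, G (iota p) (N p) (N p) = 1 ;
  normal_orthogonal : forall p v, G (iota p) (N p) (tangent_map p v) = 0 }.

End Maps.

(* M is identified with its image in K by the embedding iota, and H p with its
   image under the tangent map of iota.  The codimension of H p in T_pK is
   four by qc_codim. *)
Definition qc_hypersurface (R : realType) (n : nat) (M K : topologicalType)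
    (A : manifold R (4 * n + 3) M) (B : manifold R (4 * n + 4) K)
    (J : 'I_3 -> K -> {linear 'rV[R]_(4 * n + 4) -> 'rV[R]_(4 * n + 4)})
    (iota : M -> K) : Prop :=
  smooth_embedding A B iota /\
  exists H g Q, [/\ @qc_structure R n M A H g Q,
    forall s p X, X \in H p -> exists2 Y, Y \in H p &
      tangent_map A B iota p Y = J s (iota p) (tangent_map A B iota p X)
  & forall s p, exists2 Phi, Q p Phi & forall X, X \in H p ->
      tangent_map A B iota p (Phi X)
      = J s (iota p) (tangent_map A B iota p X)].

(* Main.v *)
From HB Require Import structures.
Require Import Defs.
From mathcomp Require Import ring lra.
Import Order.TTheory GRing.Theory Num.Theory.

Set Implicit Arguments.
Unset Strict Implicit.
Unset Printing Implicit Defensive.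

Local Open Scope classical_set_scope.
Local Open Scope ring_scope.

(** Near a point of the hypersurface everything is read in one chart of M and one
    chart of K. Let N be a unit normal, D the connection of K along M, and let the
    horizontal vectors be those orthogonal to N and to the three J_s N.

    The contact forms of the qc structure have the same kernel as the three forms
    G(J_s N, .), so they are combinations of them. Since the J_s are parallel, the
    differentials of the latter on the horizontal space are skew forms built from
    the second fundamental form, and the compatibility of the qc metric with these
    differentials forces the second fundamental form to be definite and invariant
    under the J_s on the horizontal space ([second_form_invariant], [qc_shape]).

    The shape operator is then extended to a symmetric operator L of the whole
    ambient tangent space, with D_v N = L v + tau(v) N and with L (J_1 N) =
    J_1 (L N). Differentiating this equation once more gives a Codazzi equation:
    the curvature R(v, w) N is the skew part of a derivative P of L, up to a multiple
    of N ([codazzi]). Differentiating the commutation of L with the parallel J_s gives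
    the behaviour of P under the J_s. As the curvature of a hyper-Kaehler manifold is
    J_s-invariant in both pairs of arguments, comparing the Codazzi equation for a
    pair of vectors with the one for its image under J_t is very restrictive. It
    shows first that L commutes with the J_s on all horizontal vectors
    ([shape_commutes_horizontal]), then that it commutes with them everywhere
    ([shape_commutes]); here it matters that the second fundamental form has no
    horizontal null vector. Then P is skew under the J_s without correction terms, and
    the same comparison gives R(v, w) N = 0 component by component
    ([curvature_normal_zero], [hypersurface_curvature]).

    The argument uses N only near the point, so the curvature is degenerate there
    as soon as a unit normal exists locally, which is a matter of subtracting an
    orthogonal projection ([unit_normal_germ]). *)

(** * Maps of class C^k *)

Section Calculus.
Variable R : realType.

Lemma is_diff_scale (V W : normedModType R) (f df : V -> R) (Y dY : V -> W) x :
  is_diff x f df -> is_diff x Y dY ->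
  is_diff x (fun z => f z *: Y z) (fun v => f x *: dY v + df v *: Y x).
Proof.
move=> fx Yx.
pose B := (fun (a : R) (w : W) => a *: w).
have BP : bilinear_for
    (GRing.Scale.Law.clone _ _ *:%R _) (GRing.Scale.Law.clone _ _ *:%R _) B.
  split=> [u'|u] a y z /=; rewrite /B.
  - by rewrite scalerDl scalerA.
  - by rewrite scalerDr !scalerA mulrC.
pose BM := bilinear_isBilinear.Build R R W W _ _ B BP.
pose BB : {bilinear R -> W -> W} := HB.pack B BM.
have cB : continuous (fun p : R * W => BB p.1 p.2) by exact: scale_continuous.
have -> : (fun z => f z *: Y z) = (fun p : R * W => BB p.1 p.2) \o (fun y => (f y, Y y)) by [].
have dB : is_diff (f x, Y x) (fun p : R * W => BB p.1 p.2)
   (fun q => BB (f x) q.2 + BB q.1 (Y x)).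
  by apply: DiffDef; [exact: differentiable_bilin|rewrite diff_bilin].
exact: is_diff_eq.
Qed.

Lemma derive_scale (V W : normedModType R) (f : V -> R) (Y : V -> W) x v :
  differentiable f x -> differentiable Y x ->
  'D_v (fun z => f z *: Y z) x = 'D_v f x *: Y x + f x *: 'D_v Y x.
Proof.
move=> df dY; have h := is_diff_scale (differentiableP df) (differentiableP dY).
have dh : differentiable (fun z => f z *: Y z) x by case: h.
by rewrite !deriveE // diff_val addrC.
Qed.

Lemma differentiable_scale (V W : normedModType R) (f : V -> R) (Y : V -> W) x :
  differentiable f x -> differentiable Y x ->
  differentiable (fun z => f z *: Y z) x.
Proof.
by move=> df dY; case: (is_diff_scale (differentiableP df) (differentiableP dY)).
Qed.

Lemma near0_shift (V : normedModType R) (P : V -> Prop) (x : V) :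
  (\forall y \near x, P y) -> \forall z \near (0 : V), P (z + x).
Proof. by rewrite (near_shift 0) /= subr0 //. Qed.

Lemma near0_differentiable (V W : normedModType R) (h : V -> W) (x : V) :
  (\near x, h x = 0) -> differentiable h x.
Proof.
move=> hx.
have h0 : h x = 0 by exact: nbhs_singleton hx.
pose L : {linear V -> W} := \0.
have cL : continuous L by move=> y; exact: cvg_cst.
have hE : h \o shift x = cst (h x) + L +o_ 0 id.
  apply/eqaddoP => e e0; near=> z.
  have -> : (h \o shift x - (cst (h x) + L)) z = h (z + x).
    by rewrite -[LHS]/(h (z + x) - (h x + 0)) h0 addr0 subr0.
  have -> : h (z + x) = 0.
    by near: z; apply: (near0_shift hx).
  by rewrite normr0 mulr_ge0 // ltW.
by apply/diff_locallyP; rewrite (diff_unique cL hE).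
Unshelve. all: by end_near. Qed.

(** A function that vanishes near a point is differentiable there, and so is the
    difference of [f] and [g]. *)
Lemma near_eq_differentiable (V W : normedModType R) (f g : V -> W) (x : V) :
  (\near x, f x = g x) -> differentiable f x -> differentiable g x.
Proof.
move=> fg df; have -> : g = f + (g - f) by apply/funext => y; rewrite /= addrC subrK.
apply: differentiableD => //; apply: near0_differentiable.
by near=> y; have := near fg y => /(_ _) Ey; rewrite -[LHS]/(g y - f y) Ey ?subrr //; near: y.
Unshelve. all: by end_near. Qed.

Lemma derive_comp (U V W : normedModType R) (f : U -> V) (g : V -> W) x v :
  differentiable f x -> differentiable g (f x) ->
  'D_v (g \o f) x = 'd g (f x) ('D_v f x).
Proof.
move=> df dg; rewrite !deriveE //; last exact: differentiable_comp.
by rewrite diff_comp.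
Qed.

Lemma row_basis_sum n (y : 'rV[R]_n) : y = \sum_i y 0 i *: delta_mx 0 i.
Proof. exact: row_sum_delta. Qed.

Lemma derive_rowE n (W : normedModType R) (f : 'rV[R]_n -> W) x v :
  differentiable f x -> 'D_v f x = \sum_i v 0 i *: 'D_(delta_mx 0 i) f x.
Proof.
move=> df; rewrite deriveE // {1}(row_basis_sum v) linear_sum.
by apply: eq_bigr => i _; rewrite linearZ /= deriveE.
Qed.

Lemma derive_coord n (V : normedModType R) (Y : V -> 'rV[R]_n) x v i :
  differentiable Y x -> 'D_v (fun z => Y z 0 i) x = ('D_v Y x) 0 i.
Proof.
by move=> dY; rewrite derive_mx ?mxE //; exact: diff_derivable.
Qed.

Lemma differentiable_coord_row n (V : normedModType R) (Y : V -> 'rV[R]_n) x i :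
  differentiable Y x -> differentiable (fun z => Y z 0 i) x.
Proof.
by move=> dY; apply: (@differentiable_comp _ _ _ _ Y (fun N : 'rV[R]_n => N 0 i)) => //;
  exact: differentiable_coord.
Qed.

Lemma CkS (V W : normedModType R) k (O : set V) (f : V -> W) : Ck_on k.+1 O f -> Ck_on k O f.
Proof.
elim: k f => [|k IH] f /=; first by move=> [d _] x /d /differentiable_continuous.
by move=> [d h]; split=> // v; apply: IH; exact: h.
Qed.

Section Ck.
Variables (V W : normedModType R).
Implicit Types (O : set V) (k : nat).

Lemma Ck_ext k O (f g : V -> W) : open O -> (forall x, O x -> f x = g x) ->
  Ck_on k O f -> Ck_on k O g.
Proof.
move=> oO; elim: k f g => [|k IH] f g fg /=.
  move=> cf x Ox; have fgx : \near x, f x = g x.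
    by have := open_nbhs_nbhs (conj oO Ox); apply: filterS => y /fg.
  have gx : g x = f x by rewrite fg.
  rewrite /prop_for /continuous_at gx; apply: cvg_trans (cf x Ox).
  by apply: near_eq_cvg.
move=> [df cf]; have fgx x : O x -> \near x, f x = g x.
  by move=> Ox; have := open_nbhs_nbhs (conj oO Ox); apply: filterS => y /fg.
split=> [x Ox|v]; first exact: near_eq_differentiable (fgx x Ox) (df x Ox).
apply: IH (cf v) => x Ox; exact: near_eq_derive (fgx x Ox).
Qed.

Lemma Ck_sub k O O' (f : V -> W) : O' `<=` O -> Ck_on k O f -> Ck_on k O' f.
Proof.
move=> s; elim: k f => [|k IH] f /=; first by move=> h x /s /h.
by move=> [d h]; split=> [x /s /d|v] //; exact: IH.
Qed.

Lemma Ck_cst k O (c : W) : Ck_on k O (cst c).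
Proof.
elim: k c => [|k IH] c /=; first by move=> x _; exact: cvg_cst.
split=> [x _|v]; first exact: differentiable_cst.
suff -> : 'D_v (cst c : V -> W) = cst 0 by [].
by apply/funext => x; rewrite derive_cst.
Qed.

Lemma Ck_add k O (f g : V -> W) : open O ->
  Ck_on k O f -> Ck_on k O g -> Ck_on k O (fun x => f x + g x).
Proof.
move=> oO; elim: k f g => [|k IH] f g /=.
  by move=> cf cg x Ox; apply: continuousD; [exact: cf|exact: cg].
move=> [df cf] [dg cg]; split=> [x Ox|v].
  by apply: differentiableD; [exact: df|exact: dg].
apply: (@Ck_ext _ _ (fun x => 'D_v f x + 'D_v g x)) => //; last exact: IH.
by move=> x Ox; rewrite -deriveD //; apply: diff_derivable; [exact: df|exact: dg].
Qed.

Lemma Ck_sum k O (I : Type) (r : seq I) (P : pred I) (f : I -> V -> W) : open O ->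
  (forall i, Ck_on k O (f i)) ->
  Ck_on k O (fun x => \sum_(i <- r | P i) f i x).
Proof.
move=> oO cf; elim: r => [|i r IH].
  by apply: Ck_ext (Ck_cst k O 0) => // x _; rewrite big_nil.
case Pi : (P i); last first.
  by apply: Ck_ext IH => // x _; rewrite big_cons Pi.
by apply: Ck_ext (Ck_add oO (cf i) IH) => // x _; rewrite big_cons Pi.
Qed.

Lemma Ck_scale k O (f : V -> R) (Y : V -> W) : open O ->
  Ck_on k O f -> Ck_on k O Y -> Ck_on k O (fun x => f x *: Y x).
Proof.
move=> oO; elim: k f Y => [|k IH] f Y.
  by move=> cf cY x Ox; apply: cvgZ; [exact: cf|exact: cY].
move=> H1 H2; have [df cf] := H1; have [dY cY] := H2; split=> [x Ox|v].
  by apply: differentiable_scale; [exact: df|exact: dY].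
apply: (@Ck_ext _ _ (fun x => 'D_v f x *: Y x + f x *: 'D_v Y x)) => //.
  by move=> x Ox; rewrite derive_scale //; [exact: df|exact: dY].
apply: Ck_add => //; [exact: IH (cf v) (CkS H2)|exact: IH (CkS H1) (cY v)].
Qed.

End Ck.

Lemma Ck_coord k n (V : normedModType R) (O : set V) (Y : V -> 'rV[R]_n) i :
  open O -> Ck_on k O Y -> Ck_on k O (fun z => Y z 0 i).
Proof.
move=> oO; elim: k Y => [|k IH] Y /=.
  move=> cY x Ox; apply: (@continuous_comp _ _ _ Y (fun N : 'rV[R]_n => N 0 i) x).
    exact: cY.
  exact: coord_continuous.
move=> [d c]; split=> [x /d|v]; first exact: differentiable_coord_row.
apply: (@Ck_ext _ _ _ _ (fun z => ('D_v Y z) 0 i)) => //; last exact: IH.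
by move=> x /d Ox; rewrite derive_coord.
Qed.

(** By induction on the order: a derivative of the composite is a sum of composites
    of partial derivatives of [f], with coefficients the coordinates of a
    derivative of [g]. *)
Lemma Ck_comp k n (V W : normedModType R) (O : set 'rV[R]_n) (P : set V)
    (f : 'rV[R]_n -> W) (g : V -> 'rV[R]_n) : open P ->
  (forall x, P x -> O (g x)) ->
  Ck_on k O f -> Ck_on k P g -> Ck_on k P (fun x => f (g x)).
Proof.
move=> oP s; elim: k f g s => [|k IH] f g s.
  by move=> cf cg x Px; apply: (@continuous_comp _ _ _ g f x); [exact: cg|exact/cf/s].
move=> H1 H2; have [df cf] := H1; have [dg cg] := H2; split=> [x Px|v].
  by apply: (@differentiable_comp _ _ _ _ g f); [exact: dg|exact/df/s].
apply: (@Ck_ext _ _ _ _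
  (fun x => \sum_i ('D_v g x) 0 i *: 'D_(delta_mx 0 i) f (g x))) => //.
  move=> x Px; rewrite (@derive_comp _ _ _ g f); [|exact: dg|exact/df/s].
  by rewrite -deriveE; [rewrite [RHS]derive_rowE //; exact/df/s|exact/df/s].
apply: Ck_sum => // i; apply: Ck_scale => //.
  by apply: Ck_coord => //; exact: cg.
exact: (IH ('D_(delta_mx 0 i) f) g s (cf _) (CkS H2)).
Qed.

Lemma Ck_inv k (V : normedModType R) (O : set V) (f : V -> R) : open O ->
  (forall x, O x -> f x != 0) -> Ck_on k O f -> Ck_on k O (fun x => (f x)^-1).
Proof.
move=> oO f0; elim: k => [|k IH].
  by move=> cf x Ox; apply: cvgV; [exact: f0|exact: cf].
move=> H1; have [df cf] := H1; split=> [x Ox|v].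
  by apply: differentiableV; [exact: df|exact: f0].
apply: (@Ck_ext _ _ _ _ (fun x => (-1) *: ((f x)^-1 *: ((f x)^-1 *: 'D_v f x)))) => //.
  move=> x Ox; rewrite deriveV ?f0 //; last by apply: diff_derivable; exact: df.
  by rewrite scaleN1r scalerA scaleNr -exprVn expr2.
have Ik := IH (CkS H1).
exact: (Ck_scale oO (@Ck_cst V R k O (-1)) (Ck_scale oO Ik (Ck_scale oO Ik (cf v)))).
Qed.

End Calculus.

(** * Square roots and symmetry of second derivatives *)

Section SecondDerivatives.
Variable R : realType.

Lemma Ck_sqrt k (V : normedModType R) (O : set V) (f : V -> R) : open O ->
  (forall x, O x -> 0 < f x) -> Ck_on k O f -> Ck_on k O (fun x => Num.sqrt (f x)).
Proof.
move=> oO f0; have sqd x : O x -> is_derive (f x) 1 Num.sqrt (2 * Num.sqrt (f x))^-1.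
  by move=> Ox; apply: is_derive1_sqrt; exact: f0.
elim: k => [|k IH].
  by move=> cf x Ox; apply: (@continuous_comp _ _ _ f Num.sqrt x);
    [exact: cf|exact: sqrt_continuous].
move=> H1; have [df cf] := H1.
have dsq x : O x -> differentiable Num.sqrt (f x).
  by move=> Ox; apply/derivable1_diffP; case: (sqd _ Ox).
split=> [x Ox|v].
  by apply: (@differentiable_comp _ _ _ _ f Num.sqrt); [exact: df|exact: dsq].
apply: (@Ck_ext _ _ _ _ _ (fun x => (2 * Num.sqrt (f x))^-1 *: 'D_v f x)) => //.
  move=> x Ox; rewrite (@derive_comp _ _ _ _ f Num.sqrt); [|exact: df|exact: dsq].
  rewrite -[X in 'd _ _ X]mulr1 -[_ * 1]/(_ *: 1) linearZ /=.
  have -> : 'd Num.sqrt (f x) 1 = (2 * Num.sqrt (f x))^-1.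
    by rewrite -deriveE; [exact: (@derive_val _ _ _ _ _ _ _ (sqd x Ox))|exact: dsq].
  exact: mulrC.
have Ik := IH (CkS H1).
apply: (Ck_scale oO _ (cf v)); apply: Ck_inv => //.
  by move=> x Ox; rewrite mulf_neq0 // ?gt_eqF // sqrtr_gt0 f0.
exact: (Ck_scale oO (@Ck_cst R V R k O 2) Ik).
Qed.

Lemma line_derive (V W : normedModType R) (f : V -> W) (y v : V) (t : R) :
  differentiable f (t *: v + y) ->
  is_derive t 1 (fun s => f (s *: v + y)) ('D_v f (t *: v + y)).
Proof.
move=> df; pose g := fun s : R => s *: v + y.
have dg : is_diff t g ( *:%R^~ v).
  have -> : g = (fun s => s *: v) + cst y by [].
  by apply: is_diff_eq; apply/funext => s; rewrite /= -[LHS]/(s *: v + 0) addr0.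
have dg' : differentiable g t by case: dg.
apply: DeriveDef.
  by apply: diff_derivable; apply: (@differentiable_comp _ _ _ _ g f).
rewrite (@derive_comp _ _ _ _ g f) // -deriveE // [in RHS]deriveE //.
by rewrite -(deriveE _ df) (deriveE _ dg') diff_val scale1r.
Qed.

(** By the mean value theorem the mixed second difference is [h] times a difference
    of derivatives along [v], which the differential of ['D_v f] at [x] controls. *)
Lemma second_difference (V : normedModType R) (f : V -> R) (x v w : V) (e : R) :
  0 < e -> (\forall y \near x, differentiable f y) -> differentiable ('D_v f) x ->
  exists2 r, 0 < r & forall h, 0 < h < r ->
    `|f (h *: v + (h *: w + x)) - f (h *: w + x) - f (h *: v + x) + f x
      - h ^+ 2 * 'D_w ('D_v f) x| <= e * h ^+ 2.
Proof.
move=> e0 df dvf.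
pose c := `|v| + `|w|.
have c0 : 0 <= c by rewrite addr_ge0.
pose e' := e / (2 * c + 1).
have c1 : 0 < 2 * c + 1 by lra.
have e'0 : 0 < e' by rewrite divr_gt0.
pose A := 'd ('D_v f) x.
have lo : \forall y \near (0 : V), `|'D_v f (y + x) - 'D_v f x - A y| <= e' * `|y|.
  have /eqaddoP /(_ _ e'0) := diff_locally dvf.
  apply: filterS => y; rewrite -[X in `|X| <= _]/('D_v f (y + x) - ('D_v f x + A y)).
  by rewrite opprD addrA.
have df0 : \forall y \near (0 : V), differentiable f (y + x).
  exact: near0_shift df.
have lo2 : nbhs (0 : V) [set y | `|'D_v f (y + x) - 'D_v f x - A y| <= e' * `|y|
    /\ differentiable f (y + x)] by exact: filterI lo df0.
have [r /= r0 hr] := (@nbhs_ballP _ _ _ _).1 lo2.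
have hr' y : `|y| < r -> `|'D_v f (y + x) - 'D_v f x - A y| <= e' * `|y|
    /\ differentiable f (y + x).
  by move=> yr; apply: hr; rewrite -ball_normE /ball_ /= sub0r normrN.
exists (r / (c + 1)); first by rewrite divr_gt0 //; lra.
move=> h /andP[h0]; rewrite ltr_pdivlMr; last by lra.
move=> hc.
have hvw t s : 0 <= t <= h -> 0 <= s <= h -> `|t *: v + s *: w| <= h * c.
  move=> /andP[t0 th] /andP[s0 sh].
  rewrite (le_trans (ler_normD _ _)) // !normrZ !ger0_norm // mulrDr lerD //.
    exact: ler_wpM2r.
  exact: ler_wpM2r.
have hvr t s : 0 <= t <= h -> 0 <= s <= h -> `|t *: v + s *: w| < r.
  by move=> th sh; apply: (le_lt_trans (hvw _ _ th sh)); nra.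
have hh : 0 <= h <= h by rewrite lexx ltW.
have h00 : 0 <= (0 : R) <= h by rewrite lexx ltW.
pose F s := f (s *: v + (h *: w + x)) - f (s *: v + x).
have dF s : 0 <= s <= h -> is_derive s 1 F
   ('D_v f (s *: v + (h *: w + x)) - 'D_v f (s *: v + x)).
  move=> sh.
  have d1 := line_derive (f := f) (y := h *: w + x) (v := v) (t := s).
  have d2 := line_derive (f := f) (y := x) (v := v) (t := s).
  have {}d1 := d1 ltac:(by rewrite addrA; have [] := hr' _ (hvr s h sh hh)).
  have {}d2 := d2 ltac:(by have [] := hr' _ (hvr s 0 sh h00); rewrite scale0r addr0).
  exact: (@is_deriveB R _ _ _ _ s 1 _ _ d1 d2).
have [s /andP[]|/=|s] := @MVT R F (fun s => 'D_v f (s *: v + (h *: w + x)) - 'D_v f (s *: v + x)) 0 h h0.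
- rewrite !bnd_simp => s0 sh; apply: dF; rewrite !ltW //.
- apply: derivable_within_continuous => s; rewrite in_itv /= => sh.
  by have [] := dF s sh.
rewrite in_itv /= => /andP[s0 sh].
rewrite subr0 /F !scale0r !add0r => EF.
have sI : 0 <= s <= h by rewrite !ltW.
have [l1 _] := hr' _ (hvr s h sI hh).
have [l2 _] := hr' _ (hvr s 0 sI h00).
have b1 := hvw s h sI hh; have b2 := hvw s 0 sI h00.
rewrite scale0r addr0 in l2 b2.
have Aw : A (s *: v + h *: w) - A (s *: v) = h * 'D_w ('D_v f) x.
  by rewrite linearD addrAC subrr add0r linearZ /= deriveE.
rewrite deriveE // -/(A w) in Aw *.
set D1 := 'D_v f (s *: v + (h *: w + x)) in EF.
set D2 := 'D_v f (s *: v + x) in EF l2.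
rewrite -(addrA (s *: v)) -/D1 in l1.
have -> : f (h *: v + (h *: w + x)) - f (h *: w + x) - f (h *: v + x) + f x - h ^+ 2 * A w
  = h * ((D1 - 'D_v f x - A (s *: v + h *: w)) - (D2 - 'D_v f x - A (s *: v))).
  have -> : f (h *: v + (h *: w + x)) - f (h *: w + x) - f (h *: v + x) + f x = (D1 - D2) * h.
    by rewrite -EF; ring.
  by rewrite expr2 -mulrA -Aw; ring.
rewrite normrM (gtr0_norm h0).
set X1 := (D1 - _ - _) in l1 *; set X2 := (D2 - _ - _) in l2 *.
have n12 : `|X1 - X2| <= 2 * e' * (h * c).
  rewrite (le_trans (ler_normB _ _)) //.
  have : e' * `|s *: v + h *: w| <= e' * (h * c) by exact: ler_wpM2l (ltW e'0) _ _ b1.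
  have : e' * `|s *: v| <= e' * (h * c) by exact: ler_wpM2l (ltW e'0) _ _ b2.
  lra.
have ee : e = e' * (2 * c + 1) by rewrite /e' divfK // gt_eqF.
apply: (le_trans (ler_wpM2l (ltW h0) n12)).
rewrite [X in X * h ^+ 2]ee expr2 -subr_ge0.
have -> : e' * (2 * c + 1) * (h * h) - h * (2 * e' * (h * c)) = e' * (h * h) by ring.
by apply: mulr_ge0; [exact: ltW|apply: mulr_ge0; exact: ltW].
Qed.

(** The second difference of [second_difference] is symmetric in [v] and [w]. *)
Lemma derive_sym (V : normedModType R) (f : V -> R) (x v w : V) :
  (\forall y \near x, differentiable f y) ->
  differentiable ('D_v f) x -> differentiable ('D_w f) x ->
  'D_w ('D_v f) x = 'D_v ('D_w f) x.
Proof.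
move=> df dv dw; apply/eqP; rewrite -subr_eq0 -normr_le0; apply/ler_addgt0Pr => e e0.
rewrite add0r.
have e2 : 0 < e / 2 by rewrite divr_gt0.
have [r1 r10 H1] := @second_difference V f x v w _ e2 df dv.
have [r2 r20 H2] := @second_difference V f x w v _ e2 df dw.
pose h := Num.min r1 r2 / 2.
have m0 : 0 < Num.min r1 r2 by rewrite lt_min r10.
have h0 : 0 < h by rewrite divr_gt0.
have hm : h < Num.min r1 r2 by rewrite /h; lra.
have {H1} := H1 h; rewrite h0 (lt_le_trans hm) ?ge_min ?lexx // => /(_ isT) H1.
have {H2} := H2 h; rewrite h0 (lt_le_trans hm) ?ge_min ?lexx ?orbT // => /(_ isT) H2.
have Evw : h *: w + (h *: v + x) = h *: v + (h *: w + x) by rewrite addrCA.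
rewrite {}Evw in H2.
have Ea (a b c d : R) : a - b - c + d = a - c - b + d by rewrite (addrAC a).
rewrite Ea in H2.
set S := _ - _ - _ + f x in H1 H2.
move: S ('D_w _ x) ('D_v _ x) H1 H2 => S S1 S2 H1 H2.
have hh : 0 < h ^+ 2 by rewrite exprn_gt0.
rewrite -(ler_pM2l hh) -[X in X * `|_|](gtr0_norm hh) -normrM mulrBr.
apply: (le_trans (ler_distD S _ _)).
have -> : h ^+ 2 * e = e / 2 * h ^+ 2 + e / 2 * h ^+ 2.
  by rewrite -mulrDl -splitr mulrC.
by apply: lerD => //; rewrite distrC.
Qed.

End SecondDerivatives.

(** * Quaternionic linear algebra *)

Lemma linear_DP (R : pzRingType) (U W : lmodType R) (T : U -> W) : linear T -> forall u v, T (u + v) = T u + T v.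
Proof. by move=> lT u v; have := lT 1 u v; rewrite !scale1r. Qed.
Lemma linear_0P (R : pzRingType) (U W : lmodType R) (T : U -> W) : linear T -> T 0 = 0.
Proof. by move=> lT; have := lT (-1) 0 0; rewrite scaler0 addr0 scaleN1r addNr. Qed.
Lemma linear_ZP (R : pzRingType) (U W : lmodType R) (T : U -> W) : linear T -> forall a u, T (a *: u) = a *: T u.
Proof. by move=> lT a u; have := lT a u 0; rewrite (linear_0P lT) !addr0. Qed.
Lemma linear_NP (R : pzRingType) (U W : lmodType R) (T : U -> W) : linear T -> forall u, T (- u) = - T u.
Proof. by move=> lT u; rewrite -scaleN1r linear_ZP // scaleN1r. Qed.
Lemma linear_BP (R : pzRingType) (U W : lmodType R) (T : U -> W) : linear T -> forall u v, T (u - v) = T u - T v.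
Proof. by move=> lT u v; rewrite linear_DP // linear_NP. Qed.

Section QuaternionicAlgebra.
Variables (R : realFieldType) (V : lmodType R).

Record quaternionic (J1 J2 J3 : V -> V) : Prop := {
  quat11 : forall X, J1 (J1 X) = - X ;
  quat22 : forall X, J2 (J2 X) = - X ;
  quat33 : forall X, J3 (J3 X) = - X ;
  quat12 : forall X, J1 (J2 X) = J3 X ;
  quat23 : forall X, J2 (J3 X) = J1 X ;
  quat31 : forall X, J3 (J1 X) = J2 X ;
  quat21 : forall X, J2 (J1 X) = - J3 X ;
  quat32 : forall X, J3 (J2 X) = - J1 X ;
  quat13 : forall X, J1 (J3 X) = - J2 X }.

Record bilinear_sym (G : V -> V -> R) : Prop := {
  bsym_linear : forall Z, scalar (G ^~ Z) ;
  bsym_sym : forall X Y, G X Y = G Y X }.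

Section Bsym.
Variables (G : V -> V -> R) (HG : bilinear_sym G).
Lemma bsymDl X Y Z : G (X + Y) Z = G X Z + G Y Z.
Proof. by have := bsym_linear HG Z 1 X Y; rewrite /= scale1r mul1r. Qed.
Lemma bsymDr X Y Z : G Z (X + Y) = G Z X + G Z Y.
Proof. by rewrite !(bsym_sym HG Z) bsymDl. Qed.
Lemma bsym0l Z : G 0 Z = 0.
Proof. by have := bsymDl 0 0 Z; rewrite addr0; lra. Qed.
Lemma bsym0r Z : G Z 0 = 0.
Proof. by rewrite (bsym_sym HG) bsym0l. Qed.
Lemma bsymZl a X Z : G (a *: X) Z = a * G X Z.
Proof. by have := bsym_linear HG Z a X 0; rewrite /= addr0 bsym0l addr0. Qed.
Lemma bsymZr a X Z : G Z (a *: X) = a * G Z X.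
Proof. by rewrite !(bsym_sym HG Z) bsymZl. Qed.
Lemma bsymNl X Z : G (- X) Z = - G X Z.
Proof. by rewrite -scaleN1r bsymZl mulN1r. Qed.
Lemma bsymNr X Z : G Z (- X) = - G Z X.
Proof. by rewrite !(bsym_sym HG Z) bsymNl. Qed.
Lemma bsymBl X Y Z : G (X - Y) Z = G X Z - G Y Z.
Proof. by rewrite bsymDl bsymNl. Qed.
Lemma bsymBr X Y Z : G Z (X - Y) = G Z X - G Z Y.
Proof. by rewrite bsymDr bsymNr. Qed.

Lemma polarize (P : V -> Prop) (B : V -> V -> R) (HB : bilinear_sym B) :
  (forall X Y, P X -> P Y -> P (X + Y)) ->
  (forall X, P X -> G X X = B X X) -> forall X Y, P X -> P Y -> G X Y = B X Y.
Proof.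
move=> PD H X Y PX PY; have := H _ (PD _ _ PX PY).
have BDl := bsymDl; rewrite !bsymDl !bsymDr.
have bD A1 A2 Z : B (A1 + A2) Z = B A1 Z + B A2 Z.
  by have := bsym_linear HB Z 1 A1 A2; rewrite /= scale1r mul1r.
have bDr A1 A2 Z : B Z (A1 + A2) = B Z A1 + B Z A2.
  by rewrite !(bsym_sym HB Z) bD.
rewrite bD !bDr (H X) // (H Y) // (bsym_sym HG Y) (bsym_sym HB Y); lra.
Qed.
End Bsym.

(** The relations express the positive form [g] by the skew forms
    [h Y (J X) - h X (J Y)]. On the pairs (X, J1 X), (J2 X, J3 X) and their
    analogues they show that the matrix of the coefficients, multiplied by the
    trace of [h] on the quaternionic line of [X], is a positive multiple of the
    identity. So the trace is nonzero, and the differences of the same equations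
    make the four diagonal values of [h] equal. *)
Lemma second_form_invariant (J1 J2 J3 : V -> V) (hor : V -> Prop)
    (g h : V -> V -> R) (a11 a12 a13 a21 a22 a23 a31 a32 a33 : R) :
  quaternionic J1 J2 J3 -> bilinear_sym h ->
  (forall X, hor X -> [/\ hor (- X), hor (J1 X), hor (J2 X) & hor (J3 X)]) ->
  (forall X Y, hor X -> hor Y -> g X Y = g Y X) ->
  (forall X Y, hor X -> hor Y -> g (- X) Y = - g X Y) ->
  (forall X Y, hor X -> hor Y -> [/\ g (J1 X) Y = - g X (J1 Y),
     g (J2 X) Y = - g X (J2 Y) & g (J3 X) Y = - g X (J3 Y)]) ->
  (forall X, hor X -> X != 0 -> 0 < g X X) ->
  (forall X Y, hor X -> hor Y ->
    [/\ 2 * g (J1 X) Y = a11 * (h Y (J1 X) - h X (J1 Y))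
          + a12 * (h Y (J2 X) - h X (J2 Y)) + a13 * (h Y (J3 X) - h X (J3 Y)),
        2 * g (J2 X) Y = a21 * (h Y (J1 X) - h X (J1 Y))
          + a22 * (h Y (J2 X) - h X (J2 Y)) + a23 * (h Y (J3 X) - h X (J3 Y))
      & 2 * g (J3 X) Y = a31 * (h Y (J1 X) - h X (J1 Y))
          + a32 * (h Y (J2 X) - h X (J2 Y)) + a33 * (h Y (J3 X) - h X (J3 Y))]) ->
  forall X, hor X -> X != 0 ->
    [/\ h X X != 0, h (J1 X) (J1 X) = h X X, h (J2 X) (J2 X) = h X X
      & h (J3 X) (J3 X) = h X X].
Proof.
move=> q hB horJ gS gN gJ gp E X hX X0.
have [hNX h1 h2 h3] := horJ X hX.
have k0 := gp X hX X0.
have [k Ek] : exists k, g X X = k by exists (g X X).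
rewrite Ek in k0.
have gNr A B : hor A -> hor B -> g A (- B) = - g A B.
  by move=> hA hB'; have [hNB _ _ _] := horJ _ hB'; rewrite gS // gN // gS.
have z1 : g (J1 X) X = 0 by have [-> _ _] := gJ X X hX hX; have [E1 _ _] := gJ X X hX hX; move: E1; rewrite (gS (J1 X)) //; lra.
have z2 : g (J2 X) X = 0 by have [_ -> _] := gJ X X hX hX; have [_ E1 _] := gJ X X hX hX; move: E1; rewrite (gS (J2 X)) //; lra.
have z3 : g (J3 X) X = 0 by have [_ _ ->] := gJ X X hX hX; have [_ _ E1] := gJ X X hX hX; move: E1; rewrite (gS (J3 X)) //; lra.
have k1 : g (J1 X) (J1 X) = k.
  by have [-> _ _] := gJ X (J1 X) hX h1; rewrite (quat11 q) gNr // Ek opprK.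
have k2 : g (J2 X) (J2 X) = k.
  by have [_ -> _] := gJ X (J2 X) hX h2; rewrite (quat22 q) gNr // Ek opprK.
have k3 : g (J3 X) (J3 X) = k.
  by have [_ _ ->] := gJ X (J3 X) hX h3; rewrite (quat33 q) gNr // Ek opprK.
have k12 : g (J1 X) (J2 X) = 0.
  by have [-> _ _] := gJ X (J2 X) hX h2; rewrite (quat12 q) gS // z3 oppr0.
have k23 : g (J2 X) (J3 X) = 0.
  by have [_ -> _] := gJ X (J3 X) hX h3; rewrite (quat23 q) gS // z1 oppr0.
have k31 : g (J3 X) (J1 X) = 0.
  by have [_ _ ->] := gJ X (J1 X) hX h1; rewrite (quat31 q) gS // z2 oppr0.
pose hS := bsym_sym hB.
have [e1a e2a e3a] := E X (J1 X) hX h1.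
have [e1b e2b e3b] := E (J2 X) (J3 X) h2 h3.
have [e1c e2c e3c] := E X (J2 X) hX h2.
have [e1d e2d e3d] := E (J3 X) (J1 X) h3 h1.
have [e1e e2e e3e] := E X (J3 X) hX h3.
have [e1f e2f e3f] := E (J1 X) (J2 X) h1 h2.
have J_ := (quat11 q, quat22 q, quat33 q, quat12 q, quat23 q, quat31 q,
  quat21 q, quat32 q, quat13 q).
have k21 : g (J2 X) (J1 X) = 0 by rewrite gS.
have k32 : g (J3 X) (J2 X) = 0 by rewrite gS.
have k13 : g (J1 X) (J3 X) = 0 by rewrite gS.
have y1 : g X (J1 X) = 0 by rewrite gS.
have y2 : g X (J2 X) = 0 by rewrite gS.
have y3 : g X (J3 X) = 0 by rewrite gS.
have N_ := (bsymNl hB, bsymNr hB).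
have S_ := (hS (J1 X) X, hS (J2 X) X, hS (J3 X) X, hS (J2 X) (J1 X),
  hS (J3 X) (J2 X), hS (J3 X) (J1 X)).
have gNN := (gN X _ hX h1, gN X _ hX h2, gN X _ hX h3, gN X _ hX hX,
  gN _ _ h1 h1, gN _ _ h1 h2, gN _ _ h1 h3, gN _ _ h2 h1, gN _ _ h2 h2,
  gN _ _ h2 h3, gN _ _ h3 h1, gN _ _ h3 h2, gN _ _ h3 h3).
rewrite !(J_, N_, S_, gNN, z1, z2, z3, y1, y2, y3, k1, k2, k3, k12, k23, k31, k21, k32, k13, Ek)
  in e1a e2a e3a e1b e2b e3b e1c e2c e3c e1d e2d e3d e1e e2e e3e e1f e2f e3f.
move: (h X X) (h (J1 X) (J1 X)) (h (J2 X) (J2 X)) (h (J3 X) (J3 X))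
  (h X (J1 X)) (h X (J2 X)) (h X (J3 X)) (h (J1 X) (J2 X)) (h (J2 X) (J3 X))
  (h (J1 X) (J3 X)) e1a e2a e3a e1b e2b e3b e1c e2c e3c e1d e2d e3d e1e e2e e3e e1f e2f e3f.
move=> d0 d1 d2 d3 p1 p2 p3 p12 p23 p13.
move=> e1a e2a e3a e1b e2b e3b e1c e2c e3c e1d e2d e3d e1e e2e e3e e1f e2f e3f.
pose tr := d0 + d1 + d2 + d3.
have t11 : a11 * tr = 4 * k by rewrite /tr; move: e1a e1b; clear; lra.
have t22 : a22 * tr = 4 * k by rewrite /tr; move: e2c e2d; clear; lra.
have t33 : a33 * tr = 4 * k by rewrite /tr; move: e3e e3f; clear; lra.
have t12 : a12 * tr = 0 by rewrite /tr; move: e1c e1d; clear; lra.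
have t13 : a13 * tr = 0 by rewrite /tr; move: e1e e1f; clear; lra.
have t21 : a21 * tr = 0 by rewrite /tr; move: e2a e2b; clear; lra.
have t23 : a23 * tr = 0 by rewrite /tr; move: e2e e2f; clear; lra.
have t31 : a31 * tr = 0 by rewrite /tr; move: e3a e3b; clear; lra.
have t32 : a32 * tr = 0 by rewrite /tr; move: e3c e3d; clear; lra.
have tr0 : tr != 0 by apply/eqP => t0; move: t11; rewrite t0; move: k0; clear; lra.
have a0 a : a * tr = 0 -> a = 0 by move/eqP; rewrite mulf_eq0 (negbTE tr0) orbF => /eqP.
have n0 a : a * tr = 4 * k -> a != 0.
  by move=> ta; apply/eqP => t0; move: ta k0; rewrite t0; clear; lra.
move/a0: t12 => t12; move/a0: t13 => t13; move/a0: t21 => t21.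
move/a0: t23 => t23; move/a0: t31 => t31; move/a0: t32 => t32.
rewrite {}t12 {}t13 in e1a e1b; rewrite {}t21 {}t23 in e2c e2d.
rewrite {}t31 {}t32 in e3e e3f.
have c1 : a11 * (d0 + d1 - d2 - d3) = 0 by move: e1a e1b; clear; lra.
have c2 : a22 * (d0 + d2 - d1 - d3) = 0 by move: e2c e2d; clear; lra.
have c3 : a33 * (d0 + d3 - d1 - d2) = 0 by move: e3e e3f; clear; lra.
move/eqP: c1; rewrite mulf_eq0 (negbTE (n0 _ t11)) /= => /eqP c1.
move/eqP: c2; rewrite mulf_eq0 (negbTE (n0 _ t22)) /= => /eqP c2.
move/eqP: c3; rewrite mulf_eq0 (negbTE (n0 _ t33)) /= => /eqP c3.
have E1 : d1 = d0 by move: c1 c2 c3; clear; lra.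
have E2 : d2 = d0 by move: c1 c2 c3; clear; lra.
have E3 : d3 = d0 by move: c1 c2 c3; clear; lra.
split=> //; apply: contra_neq tr0 => d00; rewrite /tr E1 E2 E3 d00; clear; lra.
Qed.
End QuaternionicAlgebra.

(** * The shape operator and the curvature at a point *)

Section Pointwise.
Variables (R : realFieldType) (V : lmodType R).
Variables (J1 J2 J3 L : V -> V) (G : V -> V -> R) (N : V).

Record hyperhermitian : Prop := {
  hyp_lin1 : linear J1 ;
  hyp_lin2 : linear J2 ;
  hyp_lin3 : linear J3 ;
  hyp_quat : quaternionic J1 J2 J3 ;
  hyp_bilin : bilinear_sym G ;
  hyp_pos : forall X, X != 0 -> 0 < G X X ;
  hyp_J1 : forall X Y, G (J1 X) (J1 Y) = G X Y ;
  hyp_J2 : forall X Y, G (J2 X) (J2 Y) = G X Y ;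
  hyp_J3 : forall X Y, G (J3 X) (J3 Y) = G X Y }.

Record hyperkahler_curvature (K : V -> V -> V -> V -> R) : Prop := {
  curv_linear : forall Y Z W, scalar (fun X => K X Y Z W) ;
  curv_skew12 : forall X Y Z W, K X Y Z W = - K Y X Z W ;
  curv_skew34 : forall X Y Z W, K X Y Z W = - K X Y W Z ;
  curv_pair : forall X Y Z W, K X Y Z W = K Z W X Y ;
  curv_bianchi : forall X Y Z W, K X Y Z W + K Y Z X W + K Z X Y W = 0 ;
  curv_J1 : forall X Y Z W, K X Y (J1 Z) (J1 W) = K X Y Z W ;
  curv_J2 : forall X Y Z W, K X Y (J2 Z) (J2 W) = K X Y Z W ;
  curv_J3 : forall X Y Z W, K X Y (J3 Z) (J3 W) = K X Y Z W }.

Record trilinear_sym (P : V -> V -> V -> R) : Prop := {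
  tri_linear1 : forall Y Z, scalar (fun X => P X Y Z) ;
  tri_linear2 : forall X Z, scalar (fun Y => P X Y Z) ;
  tri_sym : forall X Y Z, P X Y Z = P X Z Y }.

Definition horizontal X :=
  [/\ G X N = 0, G X (J1 N) = 0, G X (J2 N) = 0 & G X (J3 N) = 0].

(** The failure of [L] to commute with [J] as a bilinear form; [J] is skew. *)
Definition commdef (J : V -> V) X Y := G (L X) (J Y) + G (L (J X)) Y.

(** Minus the defect [commdef J] with, as first argument, the derivative along [v] of
    a horizontal field with value [Y]: its components on the normal quaternionic line
    are given by [L] (see [cov_hor_field]), and the others do not contribute where
    the defect vanishes on horizontal vectors. *)
Definition verticaldef (J : V -> V) v Y Z :=
  G Y (L v) * commdef J N Z - G (J1 Y) (L v) * commdef J (J1 N) Z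
  - G (J2 Y) (L v) * commdef J (J2 N) Z - G (J3 Y) (L v) * commdef J (J3 N) Z.

(* In the application [L] is the extended shape operator, [N] the normal, [K] the
   curvature and [P] the derivative of [L] in the Codazzi equation. *)
Variables (K : V -> V -> V -> V -> R) (P : V -> V -> V -> R).
Hypotheses (HG : hyperhermitian) (HK : hyperkahler_curvature K)
  (HP : trilinear_sym P).
Hypothesis Llin : linear L.
Hypothesis Lsym : forall X Y, G (L X) Y = G X (L Y).
Hypothesis N1 : G N N = 1.

Let q := hyp_quat HG.
Let b := hyp_bilin HG.

Lemma hyp_skew1 X Y : G X (J1 Y) = - G (J1 X) Y.
Proof. by rewrite -(hyp_J1 HG X) (quat11 q) (bsymNr b). Qed.
Lemma hyp_skew2 X Y : G X (J2 Y) = - G (J2 X) Y.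
Proof. by rewrite -(hyp_J2 HG X) (quat22 q) (bsymNr b). Qed.
Lemma hyp_skew3 X Y : G X (J3 Y) = - G (J3 X) Y.
Proof. by rewrite -(hyp_J3 HG X) (quat33 q) (bsymNr b). Qed.

Let Jq := (quat11 q, quat22 q, quat33 q, quat12 q, quat23 q, quat31 q,
  quat21 q, quat32 q, quat13 q).
Let GN := (bsymNl b, bsymNr b).
Let J1N X : J1 (- X) = - J1 X. Proof. exact: (linear_NP (hyp_lin1 HG)). Qed.
Let J2N X : J2 (- X) = - J2 X. Proof. exact: (linear_NP (hyp_lin2 HG)). Qed.
Let J3N X : J3 (- X) = - J3 X. Proof. exact: (linear_NP (hyp_lin3 HG)). Qed.
Let LopN X : L (- X) = - L X. Proof. exact: (linear_NP Llin). Qed.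
Let JN0 := (J1N, J2N, J3N, @opprK R, @opprK V, @oppr0 R).
Let JN := (JN0, LopN).
Let Gsk := (hyp_skew1, hyp_skew2, hyp_skew3).

Let n1 : G (J1 N) N = 0.
Proof. by have := hyp_skew1 N N; rewrite (bsym_sym b N); lra. Qed.
Let n2 : G (J2 N) N = 0.
Proof. by have := hyp_skew2 N N; rewrite (bsym_sym b N); lra. Qed.
Let n3 : G (J3 N) N = 0.
Proof. by have := hyp_skew3 N N; rewrite (bsym_sym b N); lra. Qed.

Lemma horizontalN X : horizontal X -> horizontal (- X).
Proof. by case=> *; split; rewrite GN; apply/eqP; rewrite oppr_eq0; apply/eqP. Qed.

Lemma horizontalJ X : horizontal X ->
  [/\ horizontal (J1 X), horizontal (J2 X) & horizontal (J3 X)].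
Proof.
case=> x0 x1 x2 x3; move: x1 x2 x3; rewrite !Gsk => x1 x2 x3.
by split; split; rewrite ?Gsk ?Jq ?GN ?Gsk ?opprK; lra.
Qed.

Lemma PN1 X Y Z : P (- X) Y Z = - P X Y Z.
Proof.
have := tri_linear1 HP Y Z (-1) X 0; have := tri_linear1 HP Y Z (-1) 0 0.
by rewrite /= !scaler0 !scaleN1r !addr0; lra.
Qed.
Lemma PN2 X Y Z : P X (- Y) Z = - P X Y Z.
Proof.
have := tri_linear2 HP X Z (-1) Y 0; have := tri_linear2 HP X Z (-1) 0 0.
by rewrite /= !scaler0 !scaleN1r !addr0; lra.
Qed.
Lemma PN3 X Y Z : P X Y (- Z) = - P X Y Z.
Proof. by rewrite !(tri_sym HP X Y) PN2. Qed.
Lemma KN1 X Y Z W : K (- X) Y Z W = - K X Y Z W.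
Proof.
have := curv_linear HK Y Z W (-1) X 0; have := curv_linear HK Y Z W (-1) 0 0.
by rewrite /= !scaler0 !scaleN1r !addr0; lra.
Qed.
Lemma KN2 X Y Z W : K X (- Y) Z W = - K X Y Z W.
Proof. by rewrite (curv_skew12 HK) KN1 -(curv_skew12 HK). Qed.
Lemma KN3 X Y Z W : K X Y (- Z) W = - K X Y Z W.
Proof. by rewrite (curv_pair HK) KN1 -(curv_pair HK). Qed.
Lemma KN4 X Y Z W : K X Y Z (- W) = - K X Y Z W.
Proof. by rewrite (curv_pair HK) KN2 -(curv_pair HK). Qed.
Let PN := (PN1, PN2, PN3).
Let KN := (KN1, KN2, KN3, KN4).
Lemma KJ1 X Y Z W : K (J1 X) (J1 Y) Z W = K X Y Z W.
Proof. by rewrite (curv_pair HK) (curv_J1 HK) -(curv_pair HK). Qed.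
Lemma KJ2 X Y Z W : K (J2 X) (J2 Y) Z W = K X Y Z W.
Proof. by rewrite (curv_pair HK) (curv_J2 HK) -(curv_pair HK). Qed.
Lemma KJ3 X Y Z W : K (J3 X) (J3 Y) Z W = K X Y Z W.
Proof. by rewrite (curv_pair HK) (curv_J3 HK) -(curv_pair HK). Qed.

Lemma curv_J_move A X Y Z : [/\ K (J1 A) X Y Z = - K A (J1 X) Y Z,
  K (J2 A) X Y Z = - K A (J2 X) Y Z & K (J3 A) X Y Z = - K A (J3 X) Y Z].
Proof.
by rewrite -(KJ1 A (J1 X)) -(KJ2 A (J2 X)) -(KJ3 A (J3 X)) !Jq !KN !JN.
Qed.

Definition hpart Y :=
  Y - G Y (J3 N) *: J3 N - G Y (J2 N) *: J2 N - G Y (J1 N) *: J1 N - G Y N *: N.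

Lemma horizontal_hpart Y : horizontal (hpart Y).
Proof.
have n21 : G (J2 N) (J1 N) = 0 by rewrite hyp_skew1 Jq n3 oppr0.
have n32 : G (J3 N) (J2 N) = 0 by rewrite hyp_skew2 Jq n1 oppr0.
have n31 : G (J3 N) (J1 N) = 0 by rewrite hyp_skew1 Jq GN n2 !oppr0.
have NN := (bsymZl b, bsymBl b, hyp_J1 HG, hyp_J2 HG, hyp_J3 HG, N1, n1, n2, n3,
  n21, n32, n31, bsym_sym b N (J1 N), bsym_sym b N (J2 N), bsym_sym b N (J3 N),
  bsym_sym b (J1 N) (J2 N), bsym_sym b (J1 N) (J3 N), bsym_sym b (J2 N) (J3 N)).
by rewrite /hpart; split; rewrite !NN; ring.
Qed.

Lemma hpart_id Y : horizontal Y -> hpart Y = Y.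
Proof. by case=> e0 e1 e2 e3; rewrite /hpart e0 e1 e2 e3 !scale0r !subr0. Qed.

Lemma horizontal_decomposition Y : exists2 X, horizontal X &
  Y = X + G Y N *: N + G Y (J1 N) *: J1 N + G Y (J2 N) *: J2 N + G Y (J3 N) *: J3 N.
Proof. by exists (hpart Y); [exact: horizontal_hpart|rewrite /hpart !subrK]. Qed.

Lemma commdef_sym (J : V -> V) X Y : (forall A B : V, G A (J B) = - G (J A) B) ->
  commdef J X Y = commdef J Y X.
Proof.
by move=> sk; rewrite /commdef (Lsym X) (Lsym (J X)) addrC (bsym_sym b (J X)) (bsym_sym b X).
Qed.

Lemma commdefDZ (J : V -> V) a X X' Y : linear J ->
  commdef J (X + a *: X') Y = commdef J X Y + a * commdef J X' Y.
Proof.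
move=> lJ; rewrite /commdef !(linear_DP Llin, linear_ZP Llin, linear_DP lJ, linear_ZP lJ).
by rewrite !(bsymDl b) !(bsymZl b); ring.
Qed.

Lemma commdef_vertical (J : V -> V) W Z : linear J ->
  (forall X, horizontal X -> commdef J X Z = 0) ->
  commdef J W Z = G W N * commdef J N Z + G W (J1 N) * commdef J (J1 N) Z
    + G W (J2 N) * commdef J (J2 N) Z + G W (J3 N) * commdef J (J3 N) Z.
Proof.
move=> lJ h0; have [X hX E] := horizontal_decomposition W.
by rewrite {1}E !commdefDZ // h0 // add0r.
Qed.

(** * Commutation on horizontal vectors *)

Section HorizontalCommutation.
Hypothesis E1 : L (J1 N) = J1 (L N).
Hypothesis LJH : forall X Y, horizontal X -> horizontal Y ->
  [/\ commdef J1 X Y = 0, commdef J2 X Y = 0 & commdef J3 X Y = 0].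
Hypothesis LH0 : forall X, horizontal X -> X != 0 -> G X (L X) != 0.
Hypothesis PJ : forall X Y Z, horizontal X -> horizontal Y -> horizontal Z ->
  [/\ P X Y (J1 Z) + P X (J1 Y) Z = verticaldef J1 X Y Z + verticaldef J1 X Z Y,
      P X Y (J2 Z) + P X (J2 Y) Z = verticaldef J2 X Y Z + verticaldef J2 X Z Y
    & P X Y (J3 Z) + P X (J3 Y) Z = verticaldef J3 X Y Z + verticaldef J3 X Z Y].
Hypothesis cod : forall X Y Z, horizontal X -> horizontal Y -> horizontal Z ->
  K X Y N Z = P X Y Z - P Y X Z.

(** [b2] and [b3] are the parts of the defects that pair the normal quaternionic
    line with horizontal vectors; the one for J1 vanishes by [E1]. They are the
    obstruction to [P] being skew under the three structures, and [P'] is [P]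
    corrected accordingly. *)
Let b2 Z := G (L (J2 N)) Z - G (J2 (L N)) Z.
Let b3 Z := G (L (J3 N)) Z - G (J3 (L N)) Z.
Let P' v Y Z := P v Y Z + b2 Y * G (J2 Z) (L v) + b3 Y * G (J3 Z) (L v)
   + b2 Z * G (J2 Y) (L v) + b3 Z * G (J3 Y) (L v).

Let PJ' X Y Z : horizontal X -> horizontal Y -> horizontal Z ->
  [/\ P' X Y (J1 Z) = - P' X (J1 Y) Z, P' X Y (J2 Z) = - P' X (J2 Y) Z
    & P' X Y (J3 Z) = - P' X (J3 Y) Z].
Proof.
move=> hX hY hZ; have [] := PJ hX hY hZ.
rewrite /P' /b2 /b3 /verticaldef /commdef !(E1, Jq, JN, GN, Gsk).
move: (P X Y (J1 Z)) (P X (J1 Y) Z) (P X Y (J2 Z)) (P X (J2 Y) Z) (P X Y (J3 Z)) (P X (J3 Y) Z).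
move=> p1 p1' p2 p2' p3 p3' e1 e2 e3.
have {}e1 := canRL (addrK _) e1; have {}e2 := canRL (addrK _) e2.
have {}e3 := canRL (addrK _) e3.
by rewrite e1 e2 e3; split; ring.
Qed.

Lemma Pprime_sym X Y Z : P' X Y Z = P' X Z Y.
Proof. by rewrite /P' (tri_sym HP X Y); ring. Qed.

(** The curvature is invariant under each structure in each pair of arguments, so
    K(J2 X, J3 X, N, .) and K(X, J1 X, N, .) are opposite. The Codazzi equation and
    the skewness of [P'] turn this into linear relations between the values of [b2]
    and [b3] with coefficient G(X, L X), which is nonzero. *)
Lemma mixed_part_zero X : horizontal X -> b2 (J3 X) = 0 /\ b3 (J2 X) = 0.
Proof.
move=> hX; have [-> | X0] := eqVneq X 0.
  by rewrite /b2 /b3 (linear_0P (hyp_lin3 HG)) (linear_0P (hyp_lin2 HG)) !(bsym0r b) subrr.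
have [h1 h2 h3] := horizontalJ hX.
have k0 := LH0 hX X0.
have B A Bb : horizontal A -> horizontal Bb -> [/\ G (J1 A) (L Bb) = - G A (L (J1 Bb)),
   G (J2 A) (L Bb) = - G A (L (J2 Bb)) & G (J3 A) (L Bb) = - G A (L (J3 Bb))].
  move=> hA hB; have [] := LJH hB hA; rewrite /commdef.
  rewrite !(bsym_sym b (L _)) => e1 e2 e3.
  by split; apply/eqP; rewrite -addr_eq0; apply/eqP.
have hs A Bb : G A (L Bb) = G Bb (L A) by rewrite -Lsym (bsym_sym b).
have z1 : G X (L (J1 X)) = 0.
  by have [e1 _ _] := B X X hX hX; move: e1; rewrite (hs (J1 X)); lra.
have z2 : G X (L (J2 X)) = 0.
  by have [_ e1 _] := B X X hX hX; move: e1; rewrite (hs (J2 X)); lra.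
have z3 : G X (L (J3 X)) = 0.
  by have [_ _ e1] := B X X hX hX; move: e1; rewrite (hs (J3 X)); lra.
have zz := (z1, z2, z3, Jq, JN, GN).
have hh : [/\ G (J1 X) (L (J1 X)) = G X (L X), G (J2 X) (L (J2 X)) = G X (L X)
    & G (J3 X) (L (J3 X)) = G X (L X)].
  have [e1 _ _] := B X (J1 X) hX h1; have [_ e2 _] := B X (J2 X) hX h2.
  have [_ _ e3] := B X (J3 X) hX h3.
  by split; [rewrite e1|rewrite e2|rewrite e3]; rewrite !zz.
have [k1 k2 k3] := hh.
have k01 : G (J1 X) (L X) = 0 by rewrite hs.
have k02 : G (J2 X) (L X) = 0 by rewrite hs.
have k03 : G (J3 X) (L X) = 0 by rewrite hs.
have k12 : G (J1 X) (L (J2 X)) = 0 by have [e1 _ _] := B X (J2 X) hX h2; rewrite e1 !zz.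
have k13 : G (J1 X) (L (J3 X)) = 0 by have [e1 _ _] := B X (J3 X) hX h3; rewrite e1 !zz.
have k23 : G (J2 X) (L (J3 X)) = 0 by have [_ e1 _] := B X (J3 X) hX h3; rewrite e1 !zz.
have k21 : G (J2 X) (L (J1 X)) = 0 by rewrite hs.
have k31 : G (J3 X) (L (J1 X)) = 0 by rewrite hs.
have k32 : G (J3 X) (L (J2 X)) = 0 by rewrite hs.
have kk := (zz, k1, k2, k3, k01, k02, k03, k12, k13, k23, k21, k31, k32).
have b2N A : b2 (- A) = - b2 A by rewrite /b2 !GN; ring.
have b3N A : b3 (- A) = - b3 A by rewrite /b3 !GN; ring.
have P'N A Bb C : P' A Bb (- C) = - P' A Bb C.
  by rewrite /P' !(b2N, b3N, JN, GN, PN); ring.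
have P'N2 A Bb C : P' A (- Bb) C = - P' A Bb C.
  by rewrite !(Pprime_sym A _ C) P'N.
have s0 A C1 : horizontal A -> horizontal C1 ->
  [/\ P' A C1 (J1 C1) = 0, P' A C1 (J2 C1) = 0 & P' A C1 (J3 C1) = 0].
  move=> hA hC; have [e1 e2 e3] := PJ' hA hC hC.
  by rewrite !(Pprime_sym A (J1 _), Pprime_sym A (J2 _), Pprime_sym A (J3 _)) in e1 e2 e3;
    split; lra.
have codP A C1 C2 : horizontal A -> horizontal C1 -> horizontal C2 ->
  K A C1 N C2 = P' A C1 C2 - P' C1 A C2
   + b2 A * G (J2 C2) (L C1) + b3 A * G (J3 C2) (L C1)
   + b2 C2 * G (J2 A) (L C1) + b3 C2 * G (J3 A) (L C1)
   - b2 C1 * G (J2 C2) (L A) - b3 C1 * G (J3 C2) (L A)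
   - b2 C2 * G (J2 C1) (L A) - b3 C2 * G (J3 C1) (L A).
  by move=> hA hC1 hC2; rewrite cod // /P'; ring.
have q1 : P' (J1 X) (J3 X) (J3 X) = P' (J1 X) X X.
  by have [_ _ e] := PJ' h1 h3 hX; have [_ _ e'] := PJ' h1 hX hX; rewrite !(Jq,P'N2) in e; lra.
have q2 : P' (J1 X) (J2 X) (J2 X) = P' (J1 X) X X.
  by have [_ e _] := PJ' h1 h2 hX; rewrite !(Jq,P'N2,P'N) in e; lra.
have KX C : [/\ K (J2 X) (J3 X) N C = - K X (J1 X) N C,
    K (J3 X) (J1 X) N C = - K X (J2 X) N C & K (J1 X) (J2 X) N C = - K X (J3 X) N C].
  rewrite -(KJ2 X (J1 X)) -(KJ3 X (J2 X)) -(KJ1 X (J3 X)) !(Jq, KN).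
  by rewrite !opprK.
have vals := (P'N, P'N2, kk, b2N, b3N).
have [s1 s2 s3] := s0 X X hX hX.
have [r1 r2 r3] := s0 _ _ h2 hX.
have [t1 t2 t3] := s0 _ _ h3 hX.
have [u1 u2 u3] := s0 _ _ hX h2.
have [v1 v2 v3] := s0 _ _ hX h3.
have [w1 w2 w3] := s0 _ _ h3 h1.
have [x1 x2 x3] := s0 _ _ h2 h1.
have [_ y2 _] := s0 _ _ h2 h2.
have [_ _ y3] := s0 _ _ h3 h3.
rewrite !Jq ?(P'N, P'N2) in u1 u2 u3 v1 v2 v3 w1 w2 w3 x1 x2 x3.
have psym A C1 : [/\ P' A (J1 C1) C1 = P' A C1 (J1 C1),
  P' A (J2 C1) C1 = P' A C1 (J2 C1) & P' A (J3 C1) C1 = P' A C1 (J3 C1)].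
  by split; rewrite Pprime_sym.
have [m1 m2 m3] := psym X X; have [m4 m5 m6] := psym (J2 X) X.
have [m7 m8 m9] := psym (J3 X) X.
have m10 : P' X (J3 X) (J2 X) = P' X (J2 X) (J3 X) by rewrite Pprime_sym.
have a1 := codP _ _ _ hX h1 hX; have a2 := codP _ _ _ h2 h3 hX.
have a3 := codP _ _ _ hX h2 h3; have a4 := codP _ _ _ h3 h1 h3.
have a5 := codP _ _ _ hX h3 h2; have a6 := codP _ _ _ h1 h2 h2.
have [f1 _ _] := KX X; have [_ f2 _] := KX (J3 X); have [_ _ f3] := KX (J2 X).
rewrite !kk in a1 a2 a3 a4 a5 a6.
rewrite f1 in a2; rewrite f2 in a4; rewrite f3 in a6.
rewrite m10 in a5.
rewrite ?(s1,s2,s3,r1,r2,r3,t1,t2,t3,u1,u2,u3,v1,v2,v3,w1,w2,w3,x1,x2,x3,y2,y3,m1,m2,m3,m4,m5,m6,m7,m8,m9,q1,q2) in a1 a2 a3 a4 a5 a6.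
rewrite ?(Pprime_sym _ (J3 X) X) ?(Pprime_sym _ (J2 X) X) ?(Pprime_sym _ (J1 X) X) ?(s1,s2,s3,r1,r2,r3,t1,t2,t3) in a1 a2 a3 a4 a5 a6.
rewrite ?(Pprime_sym _ (J3 X) (J1 X)) ?(Pprime_sym _ (J3 X) (J2 X)) ?(Pprime_sym _ (J2 X) (J1 X)) ?(s1,s2,s3,r1,r2,r3,t1,t2,t3) in a1 a2 a3 a4 a5 a6 u1 u2 u3 v1 v2 v3 w1 w2 w3 x1 x2 x3.
have bk : b2 (J3 X) * G X (L X) = 0 /\ b3 (J2 X) * G X (L X) = 0.
  by split; lra.
case: bk => /eqP; rewrite mulf_eq0 (negbTE k0) orbF => /eqP -> /eqP.
by rewrite mulf_eq0 (negbTE k0) orbF => /eqP ->.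
Qed.

Lemma nondeg X : (forall Y, G X Y = 0) -> X = 0.
Proof.
move=> X0; apply/eqP; apply: contraT => /(hyp_pos HG); rewrite X0 ltxx //.
Qed.

(** The horizontal components are given, and the normal ones follow from the
    vanishing of [b2] and [b3] together with [E1]. *)
Lemma shape_commutes_horizontal X : horizontal X ->
  [/\ L (J1 X) = J1 (L X), L (J2 X) = J2 (L X) & L (J3 X) = J3 (L X)].
Proof.
move=> hX; have [h1 h2 h3] := horizontalJ hX.
have b20 Y : horizontal Y -> G (L (J2 N)) Y = G (J2 (L N)) Y.
  move=> hY; have [_ _ /horizontalN h3Y] := horizontalJ hY.
  by have [+ _] := mixed_part_zero h3Y; rewrite /b2 !(JN, Jq); lra.
have b30 Y : horizontal Y -> G (L (J3 N)) Y = G (J3 (L N)) Y.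
  move=> hY; have [_ /horizontalN h2Y _] := horizontalJ hY.
  by have [_] := mixed_part_zero h2Y; rewrite /b3 !(JN, Jq); lra.
have main (J : V -> V) : (forall A B : V, G A (J B) = - G (J A) B) -> horizontal (J X) ->
    (forall Y, horizontal Y -> commdef J Y X = 0) ->
    (forall a, a \in [:: N; J1 N; J2 N; J3 N] -> commdef J a X = 0) -> L (J X) = J (L X).
  move=> sk hJ hh vv; apply/eqP; rewrite -subr_eq0; apply/eqP/nondeg => Y.
  rewrite (bsymBl b) !Lsym; have [Yh hY ->] := horizontal_decomposition Y.
  have e0 A : commdef J A X = 0 -> G (J X) (L A) - G (J (L X)) A = 0.
    rewrite /commdef => e.
    have E' : G (L (J A)) X = - G (J (L X)) A.
      by rewrite Lsym (bsym_sym b) sk.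
    by rewrite E' in e; rewrite (bsym_sym b (J X)).
  have := e0 _ (hh _ hY).
  have v0 := e0 _ (vv N _); have v1 := e0 _ (vv (J1 N) _).
  have v2 := e0 _ (vv (J2 N) _); have v3 := e0 _ (vv (J3 N) _).
  have {}v0 := v0 ltac:(by rewrite !inE eqxx). have {}v1 := v1 ltac:(by rewrite !inE eqxx ?orbT).
  have {}v2 := v2 ltac:(by rewrite !inE eqxx ?orbT). have {}v3 := v3 ltac:(by rewrite !inE eqxx ?orbT).
  move: (G Y N) (G Y (J1 N)) (G Y (J2 N)) (G Y (J3 N)) => y0 y1 y2 y3 vh.
  rewrite !(linear_DP Llin) !(linear_ZP Llin) !(bsymDr b) !(bsymZr b).
  move: v0 v1 v2 v3 vh => /subr0_eq -> /subr0_eq -> /subr0_eq -> /subr0_eq -> /subr0_eq ->.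
  by rewrite subrr.
have memV (J : V -> V) (Q : V -> Prop) : [/\ Q N, Q (J1 N), Q (J2 N) & Q (J3 N)] ->
    forall a, a \in [:: N; J1 N; J2 N; J3 N] -> Q a.
  by case=> q0 q1 q2 q3 a; rewrite !inE => /or4P[] /eqP ->.
have bb Y : horizontal Y -> G (L (J2 N)) Y = G (J2 (L N)) Y /\ G (L (J3 N)) Y = G (J3 (L N)) Y.
  by move=> hY; split; [exact: b20|exact: b30].
have sw (J : V -> V) A B Y : (forall A B : V, G A (J B) = - G (J A) B) ->
    G A (J Y) = G B (J Y) -> G (J A) Y = G (J B) Y.
  by move=> sk; rewrite !sk => /oppr_inj.
have [x2 x3] := bb _ hX.
have [x12 x13] := bb _ h1; have [x22 x23] := bb _ h2; have [x32 x33] := bb _ h3.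
have y12 := sw J1 _ _ _ hyp_skew1 x12; have y13 := sw J1 _ _ _ hyp_skew1 x13.
have y22 := sw J2 _ _ _ hyp_skew2 x22; have y23 := sw J2 _ _ _ hyp_skew2 x23.
have y32 := sw J3 _ _ _ hyp_skew3 x32; have y33 := sw J3 _ _ _ hyp_skew3 x33.
split; (apply: main => //; [by move=> A B; rewrite Gsk|
  by move=> Y hY; have [] := LJH hY hX|apply: memV => //; rewrite /commdef; split]);
  rewrite ?(E1, Jq, JN, GN, Gsk, y12, y13, y22, y23, y32, y33, x2, x3).
all: by rewrite ?(Jq, JN, GN) ?(addrN, addNr, opprK).
Qed.
End HorizontalCommutation.
(** * Commutation on the normal quaternionic line *)

Section VerticalPart.
Hypothesis cod : forall X Y Z, G X N = 0 -> G Y N = 0 -> horizontal Z ->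
  K X Y N Z = P X Y Z - P Y X Z.

Hypothesis E1 : L (J1 N) = J1 (L N).
Hypothesis LJ : forall X, horizontal X ->
  [/\ L (J1 X) = J1 (L X), L (J2 X) = J2 (L X) & L (J3 X) = J3 (L X)].
Hypothesis LH0 : forall X, horizontal X -> X != 0 -> G X (L X) != 0.
Hypothesis PJ : forall X Y Z, G X N = 0 -> horizontal Y ->
  [/\ P X Y (J1 Z) + P X (J1 Y) Z = verticaldef J1 X Y Z,
      P X Y (J2 Z) + P X (J2 Y) Z = verticaldef J2 X Y Z
    & P X Y (J3 Z) + P X (J3 Y) Z = verticaldef J3 X Y Z].

Let M Y Z := K N Y N Z.
Let Msym Y Z : M Y Z = M Z Y. Proof. exact: (curv_pair HK). Qed.
Let MN Y Z : M (- Y) Z = - M Y Z. Proof. exact: KN2. Qed.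
Let MNr Y Z : M Y (- Z) = - M Y Z. Proof. exact: KN4. Qed.

Let cd0 Z : horizontal Z -> forall A,
  [/\ commdef J1 A Z = 0, commdef J2 A Z = 0 & commdef J3 A Z = 0].
Proof.
move=> hZ A; have [e1 e2 e3] := LJ hZ.
by split; rewrite /commdef !Lsym ?(e1, e2, e3) Gsk addNr.
Qed.

(** The Codazzi equation for (J_s N, Y; Z), with J_s moved from N to Y in the
    curvature. *)
Lemma mixed_relation Y Z : horizontal Y -> horizontal Z ->
  [/\ P Y (J1 Z) N = - M (J1 Y) Z - P (J1 N) Y Z + verticaldef J1 Y Z N,
      P Y (J2 Z) N = - M (J2 Y) Z - P (J2 N) Y Z + verticaldef J2 Y Z N
    & P Y (J3 Z) N = - M (J3 Y) Z - P (J3 N) Y Z + verticaldef J3 Y Z N].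
Proof.
move=> hY hZ; have [yn _ _ _] := hY.
have [p1 p2 p3] := PJ N yn hZ.
have c1 := cod n1 yn hZ; have c2 := cod n2 yn hZ; have c3 := cod n3 yn hZ.
have [m1 m2 m3] := curv_J_move N Y N Z.
rewrite {}m1 in c1; rewrite {}m2 in c2; rewrite {}m3 in c3.
rewrite /M !(tri_sym HP Y _ Z) in c1 c2 c3 *.
by split; lra.
Qed.

Lemma vertical_P s Y Z : G s N = 0 -> horizontal Y -> horizontal Z ->
  [/\ P s Y (J1 Z) = - P s (J1 Y) Z, P s Y (J2 Z) = - P s (J2 Y) Z
    & P s Y (J3 Z) = - P s (J3 Y) Z].
Proof.
move=> sn hY hZ; have [p1 p2 p3] := PJ Z sn hY.
have cd := cd0 hZ.
have v J0 : (forall A, commdef J0 A Z = 0) -> verticaldef J0 s Y Z = 0.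
  by move=> c; rewrite /verticaldef !c !mulr0 !subr0.
rewrite (v J1) in p1; last by move=> A; have [] := cd A.
rewrite (v J2) in p2; last by move=> A; have [] := cd A.
rewrite (v J3) in p3; last by move=> A; have [] := cd A.
by split; lra.
Qed.

Let h A B := G (L A) B.

(** In [mixed_relation] on the quaternionic line of [X] the values of [P] can be
    eliminated. What is left compares [M] with the entries of [L] on the normal
    quaternionic line. *)
Lemma normal_block_relations X : horizontal X ->
  let k := G X (L X) in
  [/\ M (J1 X) (J1 X) = M (J2 X) (J2 X) - (h (J2 N) (J2 N) - h (J1 N) (J1 N)) * k,
      M (J1 X) (J1 X) = M (J3 X) (J3 X) - (h (J3 N) (J3 N) - h (J1 N) (J1 N)) * k,
      M (J2 X) (J3 X) = h (J2 N) (J3 N) * k,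
      M (J1 X) (J3 X) = h (J1 N) (J3 N) * k
    & M (J1 X) (J2 X) = h (J1 N) (J2 N) * k].
Proof.
move=> hX k; have [h1 h2 h3] := horizontalJ hX.
have [l1 l2 l3] := LJ hX.
have z1 : G (J1 X) (L X) = 0.
  have e : G (L X) (J1 X) = - G (L X) (J1 X) by rewrite {1}Lsym l1 (hyp_skew1 X) (bsym_sym b (J1 X)).
  by rewrite (bsym_sym b); lra.
have z2 : G (J2 X) (L X) = 0.
  have e : G (L X) (J2 X) = - G (L X) (J2 X) by rewrite {1}Lsym l2 (hyp_skew2 X) (bsym_sym b (J2 X)).
  by rewrite (bsym_sym b); lra.
have z3 : G (J3 X) (L X) = 0.
  have e : G (L X) (J3 X) = - G (L X) (J3 X) by rewrite {1}Lsym l3 (hyp_skew3 X) (bsym_sym b (J3 X)).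
  by rewrite (bsym_sym b); lra.
have hs A B : G (L A) B = G (L B) A by rewrite Lsym (bsym_sym b).
have g01 : G (L N) (J1 N) = 0.
  have e : G (L N) (J1 N) = - G (L N) (J1 N) by rewrite {1}Lsym E1 (hyp_skew1 N) (bsym_sym b (J1 N)).
  by lra.
have g00 : G (L N) N = h (J1 N) (J1 N) by rewrite /h E1 (hyp_J1 HG).
have g02 : G (L N) (J2 N) = h (J1 N) (J3 N).
  by rewrite /h E1 -(hyp_J1 HG) Jq.
have g03 : G (L N) (J3 N) = - h (J1 N) (J2 N).
  by rewrite /h E1 -(hyp_J1 HG) Jq GN.
have gg := (hs (J1 N) N, hs (J2 N) N, hs (J3 N) N, hs (J2 N) (J1 N), hs (J3 N) (J1 N),
  hs (J3 N) (J2 N), g00, g01, g02, g03).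
have cdv : forall Y, [/\ verticaldef J1 X Y N = 0,
    verticaldef J2 X Y N = G Y (L X) * (2 * h (J1 N) (J3 N))
      - G (J1 Y) (L X) * (2 * h (J1 N) (J2 N))
      - G (J2 Y) (L X) * (h (J2 N) (J2 N) - h (J1 N) (J1 N))
      - G (J3 Y) (L X) * h (J2 N) (J3 N)
  & verticaldef J3 X Y N = - G Y (L X) * (2 * h (J1 N) (J2 N))
      - G (J1 Y) (L X) * (2 * h (J1 N) (J3 N))
      - G (J2 Y) (L X) * h (J2 N) (J3 N)
      - G (J3 Y) (L X) * (h (J3 N) (J3 N) - h (J1 N) (J1 N))].
  move=> Y; rewrite /verticaldef /commdef !(Jq, GN, JN).
  by rewrite !gg /h; split; ring.
have [_ d2 d3] := cdv X; have [a1 a2 a3] := cdv (J1 X).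
have [b1 b2 b3] := cdv (J2 X); have [c1 c2 c3] := cdv (J3 X).
have [d1 _ _] := cdv X.
have [r1 _ _] := mixed_relation hX h1.
have [_ r2 _] := mixed_relation hX h2.
have [_ _ r3] := mixed_relation hX h3.
have [p1 p2 p3] := mixed_relation hX hX.
have [t1 t2 t3] := mixed_relation hX h1.
have [u1 u2 u3] := mixed_relation hX h2.
have [v1 v2 v3] := mixed_relation hX h3.
have kN A C : P A (- C) N = - P A C N by rewrite PN2.
have cc : forall s, G s N = 0 -> [/\ P s X (J1 X) = 0, P s X (J2 X) = 0 & P s X (J3 X) = 0].
  move=> s sn; have [] := vertical_P sn hX hX.
  by rewrite !(tri_sym HP s (J1 _)) !(tri_sym HP s (J2 _)) !(tri_sym HP s (J3 _)); split; lra.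
have [c11 c12 c13] := cc _ n1; have [c21 c22 c23] := cc _ n2.
have [c31 c32 c33] := cc _ n3.
rewrite ?(a1,a2,a3,b1,b2,b3,c1,c2,c3,d1,d2,d3) in p1 p2 p3 t1 t2 t3 u1 u2 u3 v1 v2 v3.
rewrite ?(Jq,JN,GN,z1,z2,z3,kN,MN,MNr,c11,c12,c13,c21,c22,c23,c31,c32,c33) -/k
  in p1 p2 p3 t1 t2 t3 u1 u2 u3 v1 v2 v3.
rewrite (Msym (J3 X) (J2 X)) (Msym (J3 X) (J1 X)) (Msym (J2 X) (J1 X)) in p1 p2 p3 t1 t2 t3 u1 u2 u3 v1 v2 v3.
split; lra.
Qed.

(** Applying [normal_block_relations] to X, J1 X, J2 X and J3 X permutes the values
    of [M] up to sign, while G(X, L X) stays the same and is nonzero. This is only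
    possible if [L] commutes with the structures on the normal quaternionic line. *)
Lemma shape_commutes X0 Z : horizontal X0 -> X0 != 0 ->
  [/\ L (J1 Z) = J1 (L Z), L (J2 Z) = J2 (L Z) & L (J3 Z) = J3 (L Z)].
Proof.
move=> hX X0n; have k0 := LH0 hX X0n.
have [h1 h2 h3] := horizontalJ hX; have [l1 l2 l3] := LJ hX.
have [r1 r2 r3 r4 r5] := normal_block_relations hX.
have [u1 u2 u3 u4 u5] := normal_block_relations h1.
have [v1 v2 v3 v4 v5] := normal_block_relations h2.
have [w1 w2 w3 w4 w5] := normal_block_relations h3.
rewrite ?(l1, l2, l3, hyp_J1 HG, hyp_J2 HG, hyp_J3 HG, Jq, MN, MNr, opprK) in u1 u2 u3 u4 u5 v1 v2 v3 v4 v5 w1 w2 w3 w4 w5.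
rewrite (Msym (J3 X0) (J2 X0)) in u3.
rewrite (Msym (J3 X0) (J1 X0)) in v4.
rewrite (Msym (J2 X0) (J1 X0)) in w5.
have cancel a : a * G X0 (L X0) = 0 -> a = 0.
  by move/eqP; rewrite mulf_eq0 (negbTE k0) orbF => /eqP.
have e22 : h (J2 N) (J2 N) - h (J1 N) (J1 N) = 0 by apply: cancel; lra.
have e33 : h (J3 N) (J3 N) - h (J1 N) (J1 N) = 0 by apply: cancel; lra.
have e23 : h (J2 N) (J3 N) = 0 by apply: cancel; lra.
have e13 : h (J1 N) (J3 N) = 0 by apply: cancel; lra.
have e12 : h (J1 N) (J2 N) = 0 by apply: cancel; lra.
move/subr0_eq: e22 => e22; move/subr0_eq: e33 => e33; rewrite /h in e12 e13 e22 e23 e33.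
have hs A B : G (L A) B = G (L B) A by rewrite Lsym (bsym_sym b).
have g01 : G (L N) (J1 N) = 0.
  have e : G (L N) (J1 N) = - G (L N) (J1 N) by rewrite {1}Lsym E1 (hyp_skew1 N) (bsym_sym b (J1 N)).
  by lra.
have g00 : G (L N) N = G (L (J1 N)) (J1 N) by rewrite E1 (hyp_J1 HG).
have g02 : G (L N) (J2 N) = 0 by rewrite -(hyp_J1 HG) Jq -E1.
have g03 : G (L N) (J3 N) = 0 by rewrite -(hyp_J1 HG) Jq GN -E1 e12 oppr0.
have gg := (hs (J1 N) N, hs (J2 N) N, hs (J3 N) N, hs (J2 N) (J1 N), hs (J3 N) (J1 N),
  hs (J3 N) (J2 N), g00, g01, g02, g03, e22, e33, e23, e13, e12).
have cN J0 A : commdef J0 A N = 0 -> commdef J0 A (J1 N) = 0 -> commdef J0 A (J2 N) = 0 ->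
  commdef J0 A (J3 N) = 0 -> (forall B, horizontal B -> commdef J0 A B = 0) ->
  (forall x B C, J0 (x *: B + C) = x *: J0 B + J0 C) -> forall B, commdef J0 A B = 0.
  move=> c0 c1 c2 c3 ch J0l B; have [Bh hB ->] := horizontal_decomposition B.
  have cl x B1 C1 : commdef J0 A (C1 + x *: B1) = commdef J0 A C1 + x * commdef J0 A B1.
    by rewrite /commdef (addrC C1) J0l !(bsymDr b) !(bsymZr b); ring.
  by rewrite !cl c0 c1 c2 c3 ch // !mulr0 !addr0.
have lin1 := hyp_lin1 HG; have lin2 := hyp_lin2 HG; have lin3 := hyp_lin3 HG.
have cd1 A B : horizontal B -> commdef J1 A B = 0 by move=> hB; have [] := cd0 hB A.
have cd2 A B : horizontal B -> commdef J2 A B = 0 by move=> hB; have [] := cd0 hB A.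
have cd3 A B : horizontal B -> commdef J3 A B = 0 by move=> hB; have [] := cd0 hB A.
have vv A : A \in [:: N; J1 N; J2 N; J3 N] ->
   [/\ forall B, commdef J1 A B = 0, forall B, commdef J2 A B = 0 & forall B, commdef J3 A B = 0].
  rewrite !inE => /or4P[] /eqP ->; split; apply: cN => //;
    try exact: cd1; try exact: cd2; try exact: cd3; try exact: lin1; try exact: lin2; try exact: lin3;
    by rewrite /commdef ?(Jq, JN, GN) ?gg ?(JN, addr0, subr0, add0r, addrN, addNr).
have vvN A J0 : (forall x B C, J0 (x *: B + C) = x *: J0 B + J0 C) ->
    (forall A B : V, G A (J0 B) = - G (J0 A) B) ->
    (forall B, B \in [:: N; J1 N; J2 N; J3 N] -> commdef J0 B A = 0) ->
    (forall B, horizontal B -> commdef J0 A B = 0) ->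
    forall B, commdef J0 A B = 0.
  move=> J0l sk hv hB.
  have cs B : commdef J0 A B = commdef J0 B A.
    by rewrite /commdef (Lsym A) (Lsym (J0 A)) addrC (bsym_sym b (J0 A)) (bsym_sym b A).
  by apply: cN => //; rewrite cs hv // !inE eqxx ?orbT.
have fin (J0 : V -> V) : (forall A B : V, G A (J0 B) = - G (J0 A) B) ->
    (forall B, commdef J0 Z B = 0) -> L (J0 Z) = J0 (L Z).
  move=> sk c; apply/eqP; rewrite -subr_eq0; apply/eqP; apply: nondeg => Y.
  by rewrite (bsymBl b) -(c Y) /commdef sk addrC.
have v1' B : B \in [:: N; J1 N; J2 N; J3 N] -> commdef J1 B Z = 0 by case/vv.
have v2' B : B \in [:: N; J1 N; J2 N; J3 N] -> commdef J2 B Z = 0 by case/vv.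
have v3' B : B \in [:: N; J1 N; J2 N; J3 N] -> commdef J3 B Z = 0 by case/vv.
split; apply: fin.
- exact: hyp_skew1.
- exact: (vvN _ _ lin1 hyp_skew1 v1' (cd1 Z)).
- exact: hyp_skew2.
- exact: (vvN _ _ lin2 hyp_skew2 v2' (cd2 Z)).
- exact: hyp_skew3.
- exact: (vvN _ _ lin3 hyp_skew3 v3' (cd3 Z)).
Qed.

End VerticalPart.

(** * Vanishing of the curvature on the normal *)

Section NormalCurvature.
Variable de : V -> V -> R.
Hypothesis cod : forall X Y Z, G X N = 0 -> G Y N = 0 ->
  K X Y N Z = P X Y Z - P Y X Z + de X Y * G N Z.
Hypothesis PJ : forall X Y Z, G X N = 0 ->
  [/\ P X Y (J1 Z) = - P X (J1 Y) Z, P X Y (J2 Z) = - P X (J2 Y) Z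
    & P X Y (J3 Z) = - P X (J3 Y) Z].

Let PJ1 X Y Z : G X N = 0 -> P X Y (J1 Z) = - P X (J1 Y) Z.
Proof. by case/(PJ Y Z). Qed.
Let PJ2 X Y Z : G X N = 0 -> P X Y (J2 Z) = - P X (J2 Y) Z.
Proof. by case/(PJ Y Z). Qed.
Let PJ3 X Y Z : G X N = 0 -> P X Y (J3 Z) = - P X (J3 Y) Z.
Proof. by case/(PJ Y Z). Qed.

Let PD1 X X' Y Z : P (X + X') Y Z = P X Y Z + P X' Y Z.
Proof. by have := tri_linear1 HP Y Z 1 X X'; rewrite /= scale1r mul1r. Qed.
Let PD2 X Y Y' Z : P X (Y + Y') Z = P X Y Z + P X Y' Z.
Proof. by have := tri_linear2 HP X Z 1 Y Y'; rewrite /= scale1r mul1r. Qed.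
Let PD3 X Y Z Z' : P X Y (Z + Z') = P X Y Z + P X Y Z'.
Proof. by rewrite !(tri_sym HP X Y) PD2. Qed.
Let KD1 X X' Y Z W : K (X + X') Y Z W = K X Y Z W + K X' Y Z W.
Proof. by have := curv_linear HK Y Z W 1 X X'; rewrite /= scale1r mul1r. Qed.
Let KD2 X Y Y' Z W : K X (Y + Y') Z W = K X Y Z W + K X Y' Z W.
Proof. by rewrite !(curv_skew12 HK X) KD1 opprD. Qed.
Let KD4 X Y Z W W' : K X Y Z (W + W') = K X Y Z W + K X Y Z W'.
Proof. by rewrite !(curv_pair HK X Y) KD2. Qed.
Let KZ1 a X Y Z W : K (a *: X) Y Z W = a * K X Y Z W.
Proof.
have := curv_linear HK Y Z W a X 0; have := curv_linear HK Y Z W 1 0 0.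
by rewrite /= !scaler0 !addr0; lra.
Qed.
Let KZ2 a X Y Z W : K X (a *: Y) Z W = a * K X Y Z W.
Proof. by rewrite (curv_skew12 HK X) KZ1 (curv_skew12 HK X Y); ring. Qed.
Let KZ4 a X Y Z W : K X Y Z (a *: W) = a * K X Y Z W.
Proof. by rewrite !(curv_pair HK X Y) KZ2. Qed.

Let horNl X : horizontal X -> G X N = 0. Proof. by case. Qed.
Let horNr X : horizontal X -> G N X = 0.
Proof. by case=> e _ _ _; rewrite (bsym_sym b). Qed.
Let codh X Y Z : G X N = 0 -> G Y N = 0 -> horizontal Z -> K X Y N Z = P X Y Z - P Y X Z.
Proof. by move=> hX hY hZ; rewrite cod // horNr // mulr0 addr0. Qed.

Let horD X Y : horizontal X -> horizontal Y -> horizontal (X + Y).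
Proof.
by case=> a1 a2 a3 a4 [b1 b2 b3 b4]; split; rewrite (bsymDl b) ?a1 ?a2 ?a3 ?a4 ?b1 ?b2 ?b3 ?b4 addr0.
Qed.

Let P0 X Y : G X N = 0 -> [/\ P X Y (J1 Y) = 0, P X Y (J2 Y) = 0 & P X Y (J3 Y) = 0].
Proof.
move=> hX; have [] := PJ Y Y hX.
by rewrite !(tri_sym HP X (J1 _)) !(tri_sym HP X (J2 _)) !(tri_sym HP X (J3 _)); split; lra.
Qed.
Let Pinv X Y : G X N = 0 -> [/\ P X (J1 Y) (J1 Y) = P X Y Y, P X (J2 Y) (J2 Y) = P X Y Y
  & P X (J3 Y) (J3 Y) = P X Y Y].
Proof. by move=> hX; rewrite PJ1 // PJ2 // PJ3 // !Jq !PN !opprK. Qed.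

(** The Codazzi equations for (X, J1 X; J1 X) and (J2 X, J3 X; J1 X) have opposite
    left-hand sides. *)
Lemma cubic_zero X : horizontal X -> P X X X = 0.
Proof.
move=> hX; have [h1 h2 h3] := horizontalJ hX.
have xn := horNl hX; have x1 := horNl h1; have x2 := horNl h2; have x3 := horNl h3.
have e1 := codh xn x1 h1; have e2 := codh x2 x3 h1.
have [i1 _ _] := Pinv X xn.
have KK : K (J2 X) (J3 X) N (J1 X) = - K X (J1 X) N (J1 X).
  by rewrite -(KJ2 X (J1 X)) !Jq !KN opprK.
have p2 : P (J2 X) (J3 X) (J1 X) = 0.
  by have [_ + _] := P0 (J1 X) x2; rewrite !Jq !PN (tri_sym HP (J2 X)) => /eqP; rewrite oppr_eq0 => /eqP.
have p3 : P (J3 X) (J2 X) (J1 X) = 0.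
  by have [_ _] := P0 (J1 X) x3; rewrite !Jq (tri_sym HP (J3 X)).
have p4 : P (J1 X) X (J1 X) = 0 by have [] := P0 X x1.
by rewrite KK e1 i1 p2 p3 p4 in e2; lra.
Qed.

Lemma cubic_polar X Y : horizontal X -> horizontal Y -> P X X Y = - P Y X X / 2.
Proof.
move=> hX hY; have f0 := cubic_zero hX; have f1 := cubic_zero hY.
have := cubic_zero (horD hX hY); have := cubic_zero (horD hX (horizontalN hY)).
rewrite !(PD1, PD2, PD3, PN) (tri_sym HP X Y X) (tri_sym HP Y Y X); lra.
Qed.

(** The Codazzi equation for (W, J1 W; J1 X) has right-hand side - P(X, W, W). When
    W is replaced by J2 W, its left-hand side changes sign and P(X, W, W) does not. *)
Lemma horizontal_P X Y Z : horizontal X -> horizontal Y -> horizontal Z -> P X Y Z = 0.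
Proof.
move=> hX.
have sq W : horizontal W -> P X W W = 0.
  move=> hW; have [h1 h2 h3] := horizontalJ hW.
  have xn := horNl hX; have wn := horNl hW; have w1 := horNl h1; have w2 := horNl h2.
  have [_ i2 _] := Pinv W xn.
  have key A : horizontal A -> K A (J1 A) N (J1 X) = - P X A A.
    move=> hA; have [a1 a2 a3] := horizontalJ hA; have [x1 _ _] := horizontalJ hX.
    have an := horNl hA; have a1n := horNl a1.
    rewrite codh //.
    have [i1 _ _] := Pinv A xn.
    have -> : P (J1 A) A (J1 X) = P X A A / 2.
      by rewrite PJ1 // cubic_polar // i1; lra.
    have -> : P A (J1 A) (J1 X) = - P X A A / 2.
      by rewrite PJ1 // Jq PN opprK cubic_polar.
    by lra.
  have k1 := key _ hW; have k2 := key _ h2.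
  have KK : K (J2 W) (J1 (J2 W)) N (J1 X) = - K W (J1 W) N (J1 X).
    by rewrite -(KJ2 W (J1 W)) !Jq !KN opprK.
  by rewrite KK k1 i2 in k2; lra.
move=> hY hZ; have := sq _ (horD hY hZ); rewrite !(PD2, PD3) (sq Y) // (sq Z) //.
by rewrite (tri_sym HP X Z); lra.
Qed.

Let M Y Z := K N Y N Z.
Let Msym Y Z : M Y Z = M Z Y. Proof. exact: (curv_pair HK). Qed.
Let MNl Y Z : M (- Y) Z = - M Y Z. Proof. exact: KN2. Qed.
Let MNr Y Z : M Y (- Z) = - M Y Z. Proof. exact: KN4. Qed.
Let MDl Y Y' Z : M (Y + Y') Z = M Y Z + M Y' Z. Proof. exact: KD2. Qed.
Let MDr Y Y' Z : M Z (Y + Y') = M Z Y + M Z Y'. Proof. exact: KD4. Qed.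
Let Kmv := curv_J_move N.

(** The Codazzi equation for (J_s N, W; J_s W) computes P(W, W, N) as M(J_s W, J_s W) for
    each of the three structures. *)
Lemma radial_invariant Y : horizontal Y ->
  [/\ M (J1 Y) (J1 Y) = M Y Y, M (J2 Y) (J2 Y) = M Y Y & M (J3 Y) (J3 Y) = M Y Y].
Proof.
have rel W : horizontal W -> [/\ P W W N = M (J1 W) (J1 W), P W W N = M (J2 W) (J2 W)
    & P W W N = M (J3 W) (J3 W)].
  move=> hW; have [h1 h2 h3] := horizontalJ hW; have wn := horNl hW.
  have [m1 _ _] := Kmv W N (J1 W); have [_ m2 _] := Kmv W N (J2 W).
  have [_ _ m3] := Kmv W N (J3 W).
  have c1 := codh n1 wn h1; have c2 := codh n2 wn h2; have c3 := codh n3 wn h3.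
  rewrite m1 in c1; rewrite m2 in c2; rewrite m3 in c3.
  have [z1 _ _] := P0 W n1; have [_ z2 _] := P0 W n2; have [_ _ z3] := P0 W n3.
  rewrite z1 in c1; rewrite z2 in c2; rewrite z3 in c3.
  rewrite (tri_sym HP W) PJ1 // Jq PN in c1.
  rewrite (tri_sym HP W) PJ2 // Jq PN in c2.
  rewrite (tri_sym HP W) PJ3 // Jq PN in c3.
  by rewrite /M; split; lra.
move=> hY; have [h1 h2 h3] := horizontalJ hY.
have [a1 a2 a3] := rel _ hY; have [b1 b2 b3] := rel _ h1.
by rewrite !(Jq, MNl, MNr, opprK) in b1 b2 b3; split; lra.
Qed.

Lemma radial_polar Y Z : horizontal Y -> horizontal Z ->
  [/\ M (J1 Y) (J1 Z) = M Y Z, M (J2 Y) (J2 Z) = M Y Z & M (J3 Y) (J3 Z) = M Y Z].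
Proof.
move=> hY hZ; have [a1 a2 a3] := radial_invariant hY; have [b1 b2 b3] := radial_invariant hZ.
have := radial_invariant (horD hY hZ); rewrite !(linear_DP (hyp_lin1 HG), linear_DP (hyp_lin2 HG), linear_DP (hyp_lin3 HG)) !(MDl, MDr) a1 a2 a3 b1 b2 b3.
rewrite (Msym Z Y) (Msym (J1 Z) (J1 Y)) (Msym (J2 Z) (J2 Y)) (Msym (J3 Z) (J3 Y)).
by case=> c1 c2 c3; split; lra.
Qed.

Lemma bianchi_N Y Z : [/\ K N (J1 N) Y Z = M (J1 Y) Z - M Y (J1 Z),
  K N (J2 N) Y Z = M (J2 Y) Z - M Y (J2 Z) & K N (J3 N) Y Z = M (J3 Y) Z - M Y (J3 Z)].
Proof.
have e1 := curv_bianchi HK N (J1 N) Y Z; have e2 := curv_bianchi HK N (J2 N) Y Z.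
have e3 := curv_bianchi HK N (J3 N) Y Z.
have [m1 m2 m3] := Kmv Y N Z.
have f1 : K Y N (J1 N) Z = M Y (J1 Z).
  by rewrite -(curv_J1 HK) Jq !KN (curv_skew12 HK) opprK.
have f2 : K Y N (J2 N) Z = M Y (J2 Z).
  by rewrite -(curv_J2 HK) Jq !KN (curv_skew12 HK) opprK.
have f3 : K Y N (J3 N) Z = M Y (J3 Z).
  by rewrite -(curv_J3 HK) Jq !KN (curv_skew12 HK) opprK.
by rewrite /M in f1 f2 f3 *; split; lra.
Qed.

(** By the Bianchi identity K(N, J1 N, A, B) is twice M(J1 A, B). It is invariant
    under J2, as a curvature, and changes sign under J2, because M is invariant and
    J1 anticommutes with J2. *)
Lemma radial_zero Y Z : horizontal Y -> horizontal Z -> M Y Z = 0.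
Proof.
have main A B : horizontal A -> horizontal B -> M (J1 A) B = 0.
  move=> hA hB; have [h1 h2 h3] := horizontalJ hA; have [k1 k2 k3] := horizontalJ hB.
  have [b1 _ _] := bianchi_N A B; have [b2 _ _] := bianchi_N (J2 A) (J2 B).
  have i1 : K N (J1 N) (J2 A) (J2 B) = K N (J1 N) A B by rewrite (curv_J2 HK).
  have [r1 _ _] := radial_polar hA k1; have [_ r2 _] := radial_polar hA k1.
  have [_ r3 _] := radial_polar h1 hB.
  rewrite !(Jq, MNl, MNr) in b1 b2 r1 r2 r3.
  by lra.
move=> hY hZ; have [/horizontalN h1 _ _] := horizontalJ hY.
by have := main _ _ h1 hZ; rewrite !(JN0, Jq).
Qed.

Let mu Y := P Y N N.

(** The Codazzi equations for (J_s N, Y; J_t N). *)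
Lemma mixed_codazzi Y : horizontal Y ->
  [/\ [/\ P (J1 N) (J1 Y) N = M (J1 N) (J1 Y) - mu Y,
          P (J1 N) (J2 Y) N = M (J2 N) (J1 Y) & P (J1 N) (J3 Y) N = M (J3 N) (J1 Y)],
      [/\ P (J2 N) (J1 Y) N = M (J1 N) (J2 Y),
          P (J2 N) (J2 Y) N = M (J2 N) (J2 Y) - mu Y & P (J2 N) (J3 Y) N = M (J3 N) (J2 Y)]
    & [/\ P (J3 N) (J1 Y) N = M (J1 N) (J3 Y),
          P (J3 N) (J2 Y) N = M (J2 N) (J3 Y) & P (J3 N) (J3 Y) N = M (J3 N) (J3 Y) - mu Y]].
Proof.
move=> hY; have yn := horNl hY.
have c sN C : G sN N = 0 -> G N C = 0 -> K sN Y N C = P sN Y C - P Y sN C.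
  by move=> hs hC; rewrite cod // hC mulr0 addr0.
have m1 : G N (J1 N) = 0 by rewrite (bsym_sym b).
have m2 : G N (J2 N) = 0 by rewrite (bsym_sym b).
have m3 : G N (J3 N) = 0 by rewrite (bsym_sym b).
have [i1 i2 i3] := Pinv N yn.
have [z1 z2 z3] := P0 N yn.
have [y1 y2 y3] := P0 (J1 N) yn; have [y4 y5 y6] := P0 (J2 N) yn.
rewrite !Jq !PN in y1 y2 y3 y4 y5 y6.
have Kv C : [/\ K (J1 N) Y N C = - M (J1 Y) C, K (J2 N) Y N C = - M (J2 Y) C
  & K (J3 N) Y N C = - M (J3 Y) C] by exact: Kmv.
have [k11 k21 k31] := Kv (J1 N); have [k12 k22 k32] := Kv (J2 N).
have [k13 k23 k33] := Kv (J3 N).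
have c11 := c _ _ n1 m1; have c12 := c _ _ n1 m2; have c13 := c _ _ n1 m3.
have c21 := c _ _ n2 m1; have c22 := c _ _ n2 m2; have c23 := c _ _ n2 m3.
have c31 := c _ _ n3 m1; have c32 := c _ _ n3 m2; have c33 := c _ _ n3 m3.
rewrite PJ1 // k11 in c11; rewrite PJ2 // k12 in c12; rewrite PJ3 // k13 in c13.
rewrite PJ1 // k21 in c21; rewrite PJ2 // k22 in c22; rewrite PJ3 // k23 in c23.
rewrite PJ1 // k31 in c31; rewrite PJ2 // k32 in c32; rewrite PJ3 // k33 in c33.
rewrite !(Msym _ (J1 Y)) !(Msym _ (J2 Y)) !(Msym _ (J3 Y)) /mu.
have s12 : P Y (J2 N) (J1 N) = 0 by rewrite (tri_sym HP); move: y3; lra.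
have s13 : P Y (J3 N) (J1 N) = 0 by rewrite (tri_sym HP); move: y2; lra.
have s23 : P Y (J3 N) (J2 N) = 0 by rewrite (tri_sym HP); move: y4; lra.
have s21 : P Y (J1 N) (J2 N) = 0 by rewrite (tri_sym HP).
have s31 : P Y (J1 N) (J3 N) = 0 by rewrite (tri_sym HP).
have s32 : P Y (J2 N) (J3 N) = 0 by rewrite (tri_sym HP).
rewrite i1 in c11; rewrite i2 in c22; rewrite i3 in c33.
rewrite s12 in c21; rewrite s13 in c31; rewrite s23 in c32.
rewrite s21 in c12; rewrite s31 in c13; rewrite s32 in c23.
by split; split; lra.
Qed.

(** The Codazzi equation for (J2 N, J3 N; Y), its cyclic images and [mixed_codazzi]
    on the quaternionic line of [Y] form a homogeneous linear system without
    nonzero solutions. *)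
Lemma mixed_zero Y : horizontal Y -> [/\ M (J1 N) Y = 0, M (J2 N) Y = 0 & M (J3 N) Y = 0].
Proof.
move=> hY; have [h1 h2 h3] := horizontalJ hY.
have K23 C : [/\ K (J2 N) (J3 N) N C = - M (J1 N) C, K (J3 N) (J1 N) N C = - M (J2 N) C
    & K (J1 N) (J2 N) N C = - M (J3 N) C].
  have [k1 _ _] := Kmv (J2 N) N C; have [_ k2 _] := Kmv (J3 N) N C.
  have [_ _ k3] := Kmv (J1 N) N C.
  by rewrite k1 k2 k3 !Jq.
have [k1 k2 k3] := K23 Y.
have c1 := codh n2 n3 hY; have c2 := codh n3 n1 hY; have c3 := codh n1 n2 hY.
rewrite k1 !(tri_sym HP _ _ Y) in c1; rewrite k2 !(tri_sym HP _ _ Y) in c2.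
rewrite k3 !(tri_sym HP _ _ Y) in c3.
rewrite PJ3 // PJ2 // in c1; rewrite PJ1 // PJ3 // in c2; rewrite PJ2 // PJ1 // in c3.
have [[q11 q12 q13] [q21 q22 q23] [q31 q32 q33]] := mixed_codazzi hY.
have [[r11 r12 r13] [r21 r22 r23] [r31 r32 r33]] := mixed_codazzi h1.
have [[s11 s12 s13] [s21 s22 s23] [s31 s32 s33]] := mixed_codazzi h2.
have [[t11 t12 t13] [t21 t22 t23] [t31 t32 t33]] := mixed_codazzi h3.
rewrite !(Jq, PN, MNr) in r11 r12 r13 r21 r22 r23 r31 r32 r33 s11 s12 s13 s21 s22 s23 s31 s32 s33 t11 t12 t13 t21 t22 t23 t31 t32 t33.
by split; lra.
Qed.

(** The Codazzi equations for pairs of vectors J_s N, evaluated on the J_t N, again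
    form a homogeneous system. *)
Lemma vertical_zero : forall A B, A \in [:: J1 N; J2 N; J3 N] ->
  B \in [:: J1 N; J2 N; J3 N] -> M A B = 0.
Proof.
have m1 : G N (J1 N) = 0 by rewrite (bsym_sym b).
have m2 : G N (J2 N) = 0 by rewrite (bsym_sym b).
have m3 : G N (J3 N) = 0 by rewrite (bsym_sym b).
have K23 C : [/\ K (J2 N) (J3 N) N C = - M (J1 N) C, K (J3 N) (J1 N) N C = - M (J2 N) C
    & K (J1 N) (J2 N) N C = - M (J3 N) C].
  have [k1 _ _] := Kmv (J2 N) N C; have [_ k2 _] := Kmv (J3 N) N C.
  have [_ _ k3] := Kmv (J1 N) N C.
  by rewrite k1 k2 k3 !Jq.
have c X C sN : G X N = 0 -> G sN N = 0 -> G N C = 0 -> K X sN N C = P X sN C - P sN X C.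
  by move=> h1 h2 hC; rewrite cod // hC mulr0 addr0.
have off sN : G sN N = 0 -> [/\ P sN (J1 N) (J2 N) = 0, P sN (J1 N) (J3 N) = 0
    & P sN (J2 N) (J3 N) = 0].
  move=> hs; have [z1 z2 z3] := P0 N hs.
  have [_ y2 y3] := P0 (J1 N) hs; have [_ _ y6] := P0 (J2 N) hs.
  rewrite !Jq !PN in y2 y3 y6; split; [lra|lra|].
  by rewrite PJ3 // Jq PN (tri_sym HP) z1 !oppr0.
have [i11 i12 i13] := Pinv N n1; have [i21 i22 i23] := Pinv N n2.
have [i31 i32 i33] := Pinv N n3.
have [off1 off2 off3] := off _ n1; have [off4 off5 off6] := off _ n2; have [off7 off8 off9] := off _ n3.
have [a1 a2 a3] := K23 (J1 N); have [b1 b2 b3] := K23 (J2 N); have [d1 d2 d3] := K23 (J3 N).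
rewrite !c // in a1 a2 a3 b1 b2 b3 d1 d2 d3.
rewrite !(tri_sym HP _ (J2 N) (J1 N)) !(tri_sym HP _ (J3 N) (J1 N)) !(tri_sym HP _ (J3 N) (J2 N))
  ?(off1,off2,off3,off4,off5,off6,off7,off8,off9,i11,i12,i13,i21,i22,i23,i31,i32,i33)
  in a1 a2 a3 b1 b2 b3 d1 d2 d3.
rewrite (Msym (J2 N) (J1 N)) in a2; rewrite (Msym (J3 N) (J1 N)) in a3.
rewrite (Msym (J3 N) (J2 N)) in b3.
have e11 : M (J1 N) (J1 N) = 0 by lra.
have e22 : M (J2 N) (J2 N) = 0 by lra.
have e33 : M (J3 N) (J3 N) = 0 by lra.
have e12 : M (J1 N) (J2 N) = 0 by lra.
have e13 : M (J1 N) (J3 N) = 0 by lra.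
have e23 : M (J2 N) (J3 N) = 0 by lra.
move=> A B; rewrite !inE => /or3P[] /eqP -> /or3P[] /eqP -> //; by rewrite Msym.
Qed.

Lemma radial_curvature_zero Y Z : M Y Z = 0.
Proof.
have MZl a A B : M (a *: A) B = a * M A B by exact: KZ2.
have MZr a A B : M A (a *: B) = a * M A B by exact: KZ4.
have MNN A : M N A = 0 by have := curv_skew12 HK N N N A; rewrite /M; lra.
have MNN' A : M A N = 0 by rewrite Msym.
have v := vertical_zero.
have in1 : J1 N \in [:: J1 N; J2 N; J3 N] by rewrite !inE eqxx.
have in2 : J2 N \in [:: J1 N; J2 N; J3 N] by rewrite !inE eqxx orbT.
have in3 : J3 N \in [:: J1 N; J2 N; J3 N] by rewrite !inE eqxx !orbT.
have mh A : horizontal A -> forall B, M A B = 0.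
  move=> hA B; have [Bh hB ->] := horizontal_decomposition B.
  have [x1 x2 x3] := mixed_zero hA.
  rewrite !MDr !MZr radial_zero // MNN' !(Msym A (J1 N), Msym A (J2 N), Msym A (J3 N)).
  by rewrite x1 x2 x3 !mulr0 !addr0.
have [Yh hY ->] := horizontal_decomposition Y.
have [Zh hZ ->] := horizontal_decomposition Z.
rewrite !MDl !MZl MNN !(mh _ hY) !MDr !MZr !(Msym _ Zh) !(mh _ hZ) !MNN' !v //.
by rewrite !mulr0 !addr0 !mulr0 !addr0.
Qed.

(** The components with N or some J_s N among the first two arguments reduce to
    [radial_curvature_zero] by the invariance of the curvature, those with such a
    vector as last argument by the Bianchi identity; on horizontal vectors [P]
    vanishes. *)
Lemma curvature_normal_zero X Y Z : K X Y N Z = 0.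
Proof.
have M0 A B : K N A N B = 0 by exact: radial_curvature_zero.
have K0 A B : K A N N B = 0 by rewrite (curv_skew12 HK) M0 oppr0.
have Ks A B : [/\ K (J1 N) A N B = 0, K (J2 N) A N B = 0 & K (J3 N) A N B = 0].
  by have [-> -> ->] := Kmv A N B; rewrite !M0 oppr0.
have Ks' A B : [/\ K A (J1 N) N B = 0, K A (J2 N) N B = 0 & K A (J3 N) N B = 0].
  by rewrite !(curv_skew12 HK A); have [-> -> ->] := Ks A B; rewrite oppr0.
have [Xh hX ->] := horizontal_decomposition X.
have [Yh hY ->] := horizontal_decomposition Y.
rewrite !KD1 !KZ1; set W := (Yh + _ + _ + _ + _).
have [-> -> ->] := Ks W Z; rewrite M0 !mulr0 !addr0 /W.
rewrite !KD2 !KZ2 K0; have [-> -> ->] := Ks' Xh Z; rewrite !mulr0 !addr0.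
have [Zh hZ ->] := horizontal_decomposition Z.
rewrite !KD4 !KZ4 codh; [|exact: horNl|exact: horNl|exact: hZ].
rewrite !horizontal_P // subrr.
have -> : K Xh Yh N N = 0 by have := curv_skew34 HK Xh Yh N N; lra.
have [e1 e2 e3] := bianchi_N Xh Yh.
rewrite /M !M0 in e1 e2 e3; rewrite !(curv_pair HK Xh Yh) e1 e2 e3.
by rewrite subrr !mulr0 !addr0.
Qed.

End NormalCurvature.

End Pointwise.

(** * Smooth maps on open sets *)

Section Smooth.
Variable R : realType.

Lemma smooth_ext (V W : normedModType R) (O : set V) (f g : V -> W) : open O ->
  (forall x, O x -> f x = g x) -> smooth_on O f -> smooth_on O g.
Proof. by move=> oO fg sf k; apply: Ck_ext (sf k). Qed.

Lemma smooth_sub (V W : normedModType R) (O O' : set V) (f : V -> W) :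
  O' `<=` O -> smooth_on O f -> smooth_on O' f.
Proof. by move=> s sf k; apply: Ck_sub (sf k). Qed.

Lemma smooth_diff (V W : normedModType R) (O : set V) (f : V -> W) x :
  smooth_on O f -> O x -> differentiable f x.
Proof. by move=> /(_ 1%N)[h _]; exact: h. Qed.

Lemma smooth_derive (V W : normedModType R) (O : set V) (f : V -> W) v :
  smooth_on O f -> smooth_on O ('D_v f).
Proof. by move=> sf k; have [_] := sf k.+1; exact. Qed.

Lemma smooth_cst (V W : normedModType R) (O : set V) (c : W) : smooth_on O (fun _ : V => c).
Proof. by move=> k; exact: Ck_cst. Qed.

Lemma smooth_add (V W : normedModType R) (O : set V) (f g : V -> W) : open O ->
  smooth_on O f -> smooth_on O g -> smooth_on O (fun x => f x + g x).
Proof. by move=> oO sf sg k; exact: Ck_add. Qed.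

Lemma smooth_sum (V W : normedModType R) (O : set V) (I : Type) (r : seq I)
  (P : pred I) (f : I -> V -> W) : open O ->
  (forall i, smooth_on O (f i)) -> smooth_on O (fun x => \sum_(i <- r | P i) f i x).
Proof. by move=> oO sf k; apply: Ck_sum => // i; exact: sf. Qed.

Lemma smooth_scale (V W : normedModType R) (O : set V) (f : V -> R) (Y : V -> W) : open O ->
  smooth_on O f -> smooth_on O Y -> smooth_on O (fun x => f x *: Y x).
Proof. by move=> oO sf sY k; exact: Ck_scale. Qed.

Lemma smooth_mul (V : normedModType R) (O : set V) (f g : V -> R) : open O ->
  smooth_on O f -> smooth_on O g -> smooth_on O (fun x => f x * g x).
Proof. by move=> oO sf sg; exact: (smooth_scale oO sf sg). Qed.

Lemma smooth_opp (V W : normedModType R) (O : set V) (f : V -> W) : open O ->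
  smooth_on O f -> smooth_on O (fun x => - f x).
Proof.
move=> oO sf; apply: (smooth_ext oO _ (smooth_scale oO (@smooth_cst V R O (-1)) sf)).
by move=> x _; rewrite scaleN1r.
Qed.

Lemma smooth_sub2 (V W : normedModType R) (O : set V) (f g : V -> W) : open O ->
  smooth_on O f -> smooth_on O g -> smooth_on O (fun x => f x - g x).
Proof. by move=> oO sf sg; apply: smooth_add => //; exact: smooth_opp. Qed.

Lemma smooth_prod (V : normedModType R) (O : set V) (I : Type) (r : seq I)
  (P : pred I) (f : I -> V -> R) : open O ->
  (forall i, smooth_on O (f i)) -> smooth_on O (fun x => \prod_(i <- r | P i) f i x).
Proof.
move=> oO sf; elim: r => [|i r IH].
  by apply: (smooth_ext oO _ (@smooth_cst V R O 1)) => x _; rewrite big_nil.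
case Pi : (P i); last first.
  by apply: (smooth_ext oO _ IH) => x _; rewrite big_cons Pi.
by apply: (smooth_ext oO _ (smooth_mul oO (sf i) IH)) => x _; rewrite big_cons Pi.
Qed.

Lemma smooth_inv (V : normedModType R) (O : set V) (f : V -> R) : open O ->
  (forall x, O x -> f x != 0) -> smooth_on O f -> smooth_on O (fun x => (f x)^-1).
Proof. by move=> oO f0 sf k; exact: Ck_inv. Qed.

Lemma smooth_sqrt (V : normedModType R) (O : set V) (f : V -> R) : open O ->
  (forall x, O x -> 0 < f x) -> smooth_on O f -> smooth_on O (fun x => Num.sqrt (f x)).
Proof. by move=> oO f0 sf k; exact: Ck_sqrt. Qed.

Lemma smooth_coord n (V : normedModType R) (O : set V) (Y : V -> 'rV[R]_n) i :
  open O -> smooth_on O Y -> smooth_on O (fun z => Y z 0 i).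
Proof. by move=> oO sY k; exact: Ck_coord. Qed.

Lemma smooth_row n (V : normedModType R) (O : set V) (Y : V -> 'rV[R]_n) :
  open O -> (forall i, smooth_on O (fun z => Y z 0 i)) -> smooth_on O Y.
Proof.
move=> oO sY; have H : smooth_on O (fun x => \sum_i Y x 0 i *: (delta_mx 0 i : 'rV[R]_n)).
  by apply: smooth_sum => // i; apply: smooth_scale => //; exact: smooth_cst.
by apply: smooth_ext H => // x _; rewrite -row_basis_sum.
Qed.

Lemma smooth_comp n (V W : normedModType R) (O : set 'rV[R]_n) (P : set V)
    (f : 'rV[R]_n -> W) (g : V -> 'rV[R]_n) : open P ->
  (forall x, P x -> O (g x)) ->
  smooth_on O f -> smooth_on P g -> smooth_on P (fun x => f (g x)).
Proof. by move=> oP s sf sg k; exact: (Ck_comp oP s (sf k) (sg k)). Qed.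

Lemma smooth_derive_sym n (V : normedModType R) (O : set V) (f : V -> 'rV[R]_n) x v w :
  open O -> smooth_on O f -> O x -> 'D_w ('D_v f) x = 'D_v ('D_w f) x.
Proof.
move=> oO sf Ox; apply/rowP => i.
have A v1 v2 : ('D_v2 ('D_v1 f) x) 0 i = 'D_v2 ('D_v1 (fun z => f z 0 i)) x.
  have h := smooth_derive v1 sf; have d := smooth_diff h Ox.
  rewrite -(derive_coord v2 i d).
  apply: near_eq_derive; have := open_nbhs_nbhs (conj oO Ox).
  by apply: filterS => y Oy; rewrite derive_coord //; exact: smooth_diff sf Oy.
apply: (etrans (A v w)); apply: (etrans _ (esym (A w v))).
have si := smooth_coord i oO sf.
have dd u := smooth_diff (smooth_derive u si) Ox.
apply: (derive_sym _ (dd v) (dd w)).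
have := open_nbhs_nbhs (conj oO Ox).
by apply: filterS => y Oy; exact: smooth_diff si Oy.
Qed.

Lemma smooth_derive_symR (V : normedModType R) (O : set V) (f : V -> R) x v w :
  open O -> smooth_on O f -> O x -> 'D_w ('D_v f) x = 'D_v ('D_w f) x.
Proof.
move=> oO sf Ox; have dd u := smooth_diff (smooth_derive u sf) Ox.
apply: (derive_sym _ (dd v) (dd w)).
have := open_nbhs_nbhs (conj oO Ox).
by apply: filterS => y Oy; exact: smooth_diff sf Oy.
Qed.

Lemma linear_rowE n (W : lmodType R) (T : 'rV[R]_n -> W) (w : 'rV[R]_n) :
  linear T -> T w = \sum_i w 0 i *: T (delta_mx 0 i).
Proof.
move=> lT; pose TM := GRing.isLinear.Build _ _ _ _ T lT.
pose TT : {linear 'rV[R]_n -> W} := HB.pack T TM.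
rewrite -[T]/(TT : _ -> _) {1}(row_basis_sum w) linear_sum.
by apply: eq_bigr => i _; rewrite linearZ.
Qed.

Section Apply.
Variables (n : nat) (V W : normedModType R) (O : set V) (T : V -> 'rV[R]_n -> W).
Hypotheses (oO : open O) (Tlin : forall y, O y -> linear (T y)).

Lemma smooth_apply (Y : V -> 'rV[R]_n) :
  (forall w, smooth_on O (T ^~ w)) -> smooth_on O Y ->
  smooth_on O (fun y => T y (Y y)).
Proof.
move=> sT sY.
have H : smooth_on O (fun x => \sum_i Y x 0 i *: T x (delta_mx 0 i)).
  by apply: smooth_sum => // i; apply: smooth_scale => //; exact: smooth_coord.
by apply: smooth_ext H => // x Ox; rewrite -linear_rowE //; exact: Tlin.
Qed.

(** Product rule for a field of linear maps applied to a field of vectors, through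
    the coordinates of [Y]. *)
Lemma derive_apply (Y : V -> 'rV[R]_n) x v : O x ->
  (forall w, differentiable (T ^~ w) x) -> differentiable Y x ->
  'D_v (fun y => T y (Y y)) x = 'D_v (T ^~ (Y x)) x + T x ('D_v Y x).
Proof.
move=> Ox dT dY.
have sc i : differentiable (fun y => Y y 0 i *: T y (delta_mx 0 i)) x.
  by apply: differentiable_scale => //; exact: differentiable_coord_row.
have sc' i : differentiable (fun y => Y x 0 i *: T y (delta_mx 0 i)) x.
  by apply: differentiableZ.
have E1 : 'D_v (fun y => T y (Y y)) x =
    'D_v (\sum_i (fun y => Y y 0 i *: T y (delta_mx 0 i))) x.
  apply: near_eq_derive; have := open_nbhs_nbhs (conj oO Ox).
  by apply: filterS => y Oy; rewrite fct_sumE -linear_rowE //; exact: Tlin.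
have E2 : 'D_v (T ^~ (Y x)) x =
    'D_v (\sum_i (fun y => Y x 0 i *: T y (delta_mx 0 i))) x.
  apply: near_eq_derive; have := open_nbhs_nbhs (conj oO Ox).
  by apply: filterS => y Oy; rewrite fct_sumE -linear_rowE //; exact: Tlin.
rewrite E1 E2 !derive_sum; try by move=> i; apply: diff_derivable.
rewrite (linear_rowE _ (Tlin Ox)) -big_split /=; apply: eq_bigr => i _.
rewrite derive_scale //; last exact: differentiable_coord_row.
by rewrite derive_coord // deriveZ 1?addrC //; apply: diff_derivable.
Qed.
End Apply.

Lemma smooth_det n (V : normedModType R) (O : set V) (A : V -> 'M[R]_n) : open O ->
  (forall i j, smooth_on O (fun x => A x i j)) -> smooth_on O (fun x => \det (A x)).
Proof.
move=> oO sA; rewrite /determinant; apply: smooth_sum => // s.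
apply: smooth_mul => //; first exact: smooth_cst.
by apply: smooth_prod => // i; exact: sA.
Qed.

(** Cramer's rule. *)
Lemma smooth_invmx n (V : normedModType R) (O : set V) (A : V -> 'M[R]_n) i j : open O ->
  (forall x, O x -> A x \in unitmx) ->
  (forall i j, smooth_on O (fun x => A x i j)) -> smooth_on O (fun x => invmx (A x) i j).
Proof.
move=> oO uA sA.
have sd : smooth_on O (fun x => (\det (A x))^-1).
  apply: smooth_inv => //; last exact: smooth_det.
  by move=> x /uA; rewrite unitmxE unitfE.
have sc : smooth_on O (fun x => cofactor (A x) j i).
  rewrite /cofactor; apply: smooth_mul => //; first exact: smooth_cst.
  apply: smooth_det => // k l; apply: (smooth_ext oO _ (sA (lift j k) (lift i l))).
  by move=> x _; rewrite !mxE.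
apply: (smooth_ext oO _ (smooth_mul oO sd sc)) => x Ox.
by rewrite /invmx uA // !mxE.
Qed.

End Smooth.

(** * Coordinates of row vectors *)

(* Coordinates of row vectors over a real type, in a form where equal
   coordinates are syntactically equal, so that they can be generalized before
   calling [ring] or [lra]. Derivatives are generalized first, because trying to
   unify them with sums is expensive. *)
Section RowCoordinates.
Variables (R : realType) (n : nat).
Implicit Types u v : 'rV[R]_n.
Lemma row_eq u v : (forall i, u 0 i = v 0 i) -> u = v.
Proof. by move=> E; apply/rowP. Qed.
Lemma rowDE u v i : (u + v) 0 i = u 0 i + v 0 i. Proof. by rewrite mxE. Qed.
Lemma rowNE u i : (- u) 0 i = - u 0 i. Proof. by rewrite mxE. Qed.
Lemma rowZE (a : R) u i : (a *: u) 0 i = a * u 0 i. Proof. by rewrite mxE. Qed.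
Lemma row0E i : (0 : 'rV[R]_n) 0 i = 0. Proof. by rewrite mxE. Qed.
End RowCoordinates.

Ltac gen_derive :=
  repeat match goal with
  | |- context [@derive ?R ?V ?W ?f ?a ?v] => generalize (@derive R V W f a v); intro
  end.
Ltac gen_coords :=
  gen_derive;
  rewrite ?(rowDE, rowNE, rowZE, row0E);
  repeat match goal with
  | |- context [@fun_of_matrix ?T ?p ?q ?A ?j ?i] => generalize (@fun_of_matrix T p q A j i); intro
  end.
Ltac row_ring := apply: row_eq => ?; gen_coords; ring.

(** * Hyper-Kaehler structures on open sets of R^d *)

Lemma ord3P (s : 'I_3) : [\/ s = 0, s = 1 | s = 2].
Proof.
by case: s => [[|[|[|//]]] i]; [constructor 1|constructor 2|constructor 3]; exact: val_inj.
Qed.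

Section LocalHyperkahler.
Variables (R : realType) (d : nat).
Local Notation vec := 'rV[R]_d.

(** [Ga] are the Christoffel symbols: [Ga x v w] is the covariant derivative along
    [v] of the field with constant components [w]. *)
Record local_hyperkahler (O : set vec) (g : vec -> vec -> vec -> R)
    (Ga : vec -> vec -> vec -> vec) (J : 'I_3 -> vec -> vec -> vec) : Prop := {
  lhk_open : open O ;
  lhk_herm : forall x, O x -> hyperhermitian (J 0 x) (J 1 x) (J 2 x) (g x) ;
  lhk_g_smooth : forall v w, smooth_on O (fun x => g x v w) ;
  lhk_G_smooth : forall v w, smooth_on O (fun x => Ga x v w) ;
  lhk_J_smooth : forall s w, smooth_on O (fun x => J s x w) ;
  lhk_G_linear : forall x w, O x -> linear (fun v => Ga x v w) ;
  lhk_G_sym : forall x v w, O x -> Ga x v w = Ga x w v ;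
  lhk_metric : forall x u v w, O x ->
    'D_u (fun y => g y v w) x = g x (Ga x u v) w + g x v (Ga x u w) ;
  lhk_parallel : forall s x u w, O x ->
    'D_u (fun y => J s y w) x = J s x (Ga x u w) - Ga x u (J s x w) }.

Definition curv (Ga : vec -> vec -> vec -> vec) (x v w u : vec) : vec :=
  'D_v (fun y => Ga y w u) x - 'D_w (fun y => Ga y v u) x
  + Ga x v (Ga x w u) - Ga x w (Ga x v u).

Section LHK.
Variables (O : set vec) (g : vec -> vec -> vec -> R)
  (Ga : vec -> vec -> vec -> vec) (J : 'I_3 -> vec -> vec -> vec).
Hypothesis H : local_hyperkahler O g Ga J.
Let oO := lhk_open H.

Lemma Ga_linear2 x v : O x -> linear (Ga x v).
Proof. by move=> Ox a u w; rewrite !(lhk_G_sym H v) //; exact: (lhk_G_linear H v Ox a u w). Qed.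

Lemma g_bilin x : O x -> bilinear_sym (g x).
Proof. by move=> Ox; exact: hyp_bilin (lhk_herm H Ox). Qed.

Lemma g_linear x w : O x -> linear (fun v => g x v w : R^o).
Proof. by move=> Ox a u v; exact: (bsym_linear (g_bilin Ox)). Qed.

Lemma Ga_diff x v w : O x -> differentiable (fun y => Ga y v w) x.
Proof. exact: smooth_diff (lhk_G_smooth H v w). Qed.

Lemma J_linear s x : O x -> linear (J s x).
Proof.
move=> Ox; have hh := lhk_herm H Ox.
by case: (ord3P s) => ->; [exact: (hyp_lin1 hh)|exact: (hyp_lin2 hh)|exact: (hyp_lin3 hh)].
Qed.

Lemma J_skew s x A B : O x -> g x A (J s x B) = - g x (J s x A) B.
Proof.
move=> Ox; have hh := lhk_herm H Ox.
by case: (ord3P s) => ->; [exact: (hyp_skew1 hh)|exact: (hyp_skew2 hh)|exact: (hyp_skew3 hh)].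
Qed.

Lemma open_near (P : vec -> Prop) x : O x -> (forall y, O y -> P y) -> \forall y \near x, P y.
Proof. by move=> Ox HP; have := open_nbhs_nbhs (conj oO Ox); apply: filterS. Qed.

Lemma curv_skew x v w u : curv Ga x v w u = - curv Ga x w v u.
Proof. by rewrite /curv; row_ring. Qed.

Lemma curv_linear1 x w u : O x -> linear (fun v => curv Ga x v w u).
Proof.
move=> Ox a v1 v2; rewrite /curv.
have D v : 'D_v (fun y => Ga y w u) x = 'd (fun y => Ga y w u) x v by rewrite deriveE //; exact: Ga_diff.
have -> : 'D_w (fun y => Ga y (a *: v1 + v2) u) x
   = a *: 'D_w (fun y => Ga y v1 u) x + 'D_w (fun y => Ga y v2 u) x.
  have E : 'D_w (fun y => Ga y (a *: v1 + v2) u) x =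
     'D_w ((a *: (fun y => Ga y v1 u)) + (fun y => Ga y v2 u)) x.
    by apply: near_eq_derive; apply: open_near => // y Oy; rewrite (lhk_G_linear H).
  have d1 : derivable (fun y => Ga y v1 u) x w by apply: diff_derivable; exact: Ga_diff.
  have d2 : derivable (fun y => Ga y v2 u) x w by apply: diff_derivable; exact: Ga_diff.
  by rewrite E (deriveD (@derivableZ _ _ _ _ a _ _ d1) d2) (deriveZ a d1).
rewrite !D linearP !(lhk_G_linear H) // (Ga_linear2 w Ox).
by row_ring.
Qed.

Lemma curv_bianchi1 x X Y Z : O x -> curv Ga x X Y Z + curv Ga x Y Z X + curv Ga x Z X Y = 0.
Proof.
move=> Ox; rewrite /curv.
have S v w u : 'D_v (fun y => Ga y w u) x = 'D_v (fun y => Ga y u w) x.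
  by apply: near_eq_derive; apply: open_near => // y Oy; rewrite (lhk_G_sym H).
rewrite (S X Z Y) (S Y X Z) (S Z Y X) (lhk_G_sym H Z Y) // (lhk_G_sym H Y X) // (lhk_G_sym H X Z) //.
by row_ring.
Qed.

(** Symmetry of the second derivatives of [fun y => g y u z]. *)
Lemma curv_metric x v w u z : O x -> g x (curv Ga x v w u) z = - g x u (curv Ga x v w z).
Proof.
move=> Ox.
have gd a b : differentiable (fun y => g y a b) x.
  exact: smooth_diff (lhk_g_smooth H a b) Ox.
have pull_g_linear b y : O y -> linear (fun a => g y a b : R^o) by exact: g_linear.
have key v1 w1 u1 z1 : 'D_v1 (fun y => g y (Ga y w1 u1) z1) x =
   g x (Ga x v1 (Ga x w1 u1)) z1 + g x (Ga x w1 u1) (Ga x v1 z1)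
   + g x ('D_v1 (fun y => Ga y w1 u1) x) z1.
  rewrite (@derive_apply R d _ _ O (fun y a => g y a z1) oO (pull_g_linear z1) (fun y => Ga y w1 u1) x v1 Ox (gd^~ z1) (Ga_diff w1 u1 Ox)).
  by rewrite (lhk_metric H).
have second v1 w1 : 'D_v1 ('D_w1 (fun y => g y u z)) x =
   'D_v1 (fun y => g y (Ga y w1 u) z) x + 'D_v1 (fun y => g y (Ga y w1 z) u) x.
  have E : 'D_v1 ('D_w1 (fun y => g y u z)) x
     = 'D_v1 ((fun y => g y (Ga y w1 u) z) + (fun y => g y (Ga y w1 z) u)) x.
    apply: near_eq_derive; apply: open_near => // y Oy.
    by rewrite (lhk_metric H) // (bsym_sym (g_bilin Oy) u).
  have d1 := diff_derivable (v := v1)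
    (smooth_diff (smooth_apply oO (pull_g_linear z) (lhk_g_smooth H ^~ z) (lhk_G_smooth H w1 u)) Ox).
  have d2 := diff_derivable (v := v1)
    (smooth_diff (smooth_apply oO (pull_g_linear u) (lhk_g_smooth H ^~ u) (lhk_G_smooth H w1 z)) Ox).
  by rewrite E (deriveD d1 d2).
have sy := smooth_derive_symR w v oO (lhk_g_smooth H u z) Ox.
rewrite !second !key in sy.
have b := g_bilin Ox.
rewrite /curv !(bsymDl b, bsymDr b, bsymNl b, bsymNr b).
have S1 := bsym_sym b (Ga x v u) (Ga x w z); have S2 := bsym_sym b (Ga x w u) (Ga x v z).
rewrite !(bsym_sym b u).
by lra.
Qed.

(** Symmetry of the second derivatives of [fun y => J s y u]. *)
Lemma curv_J s x v w u : O x -> curv Ga x v w (J s x u) = J s x (curv Ga x v w u).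
Proof.
move=> Ox.
have Jl y : O y -> linear (J s y) by exact: J_linear.
have Gl v1 y : O y -> linear (fun a => Ga y v1 a) by exact: Ga_linear2.
have Jd b : differentiable (fun y => J s y b) x.
  exact: smooth_diff (lhk_J_smooth H s b) Ox.
have k1 v1 w1 : 'D_v1 (fun y => J s y (Ga y w1 u)) x =
    J s x (Ga x v1 (Ga x w1 u)) - Ga x v1 (J s x (Ga x w1 u)) + J s x ('D_v1 (fun y => Ga y w1 u) x).
  rewrite (@derive_apply R d _ _ O (fun y a => J s y a) oO Jl (fun y => Ga y w1 u) x v1 Ox Jd (Ga_diff w1 u Ox)).
  by rewrite (lhk_parallel H).
have k2 v1 w1 : 'D_v1 (fun y => Ga y w1 (J s y u)) x =
    'D_v1 (fun y => Ga y w1 (J s x u)) x + Ga x w1 (J s x (Ga x v1 u)) - Ga x w1 (Ga x v1 (J s x u)).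
  rewrite (@derive_apply R d _ _ O (fun y a => Ga y w1 a) oO (Gl w1) (fun y => J s y u) x v1 Ox
    (fun b => Ga_diff w1 b Ox) (Jd u)).
  by rewrite (lhk_parallel H) // (linear_BP (Ga_linear2 w1 Ox)) addrA.
have second v1 w1 : 'D_v1 ('D_w1 (fun y => J s y u)) x =
   'D_v1 (fun y => J s y (Ga y w1 u)) x - 'D_v1 (fun y => Ga y w1 (J s y u)) x.
  have E : 'D_v1 ('D_w1 (fun y => J s y u)) x
     = 'D_v1 ((fun y => J s y (Ga y w1 u)) - (fun y => Ga y w1 (J s y u))) x.
    by apply: near_eq_derive; apply: open_near => // y Oy; rewrite (lhk_parallel H).
  have d1 := diff_derivable (v := v1)
    (smooth_diff (smooth_apply oO Jl (lhk_J_smooth H s) (lhk_G_smooth H w1 u)) Ox).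
  have d2 := diff_derivable (v := v1)
    (smooth_diff (smooth_apply oO (Gl w1) (lhk_G_smooth H w1) (lhk_J_smooth H s u)) Ox).
  by rewrite E (deriveB d1 d2).
have sy := smooth_derive_sym w v oO (lhk_J_smooth H s u) Ox.
rewrite !second !k1 !k2 in sy.
rewrite /curv !(linear_DP (Jl x Ox), linear_NP (Jl x Ox)).
apply: row_eq => i; move: sy => /(congr1 (fun u : vec => u 0 i)); cbv beta.
by gen_coords; lra.
Qed.

(** The symmetry by pairs follows from the Bianchi identity and the two skew
    symmetries. *)
Lemma curv_hyperkahler x : O x ->
  hyperkahler_curvature (J 0 x) (J 1 x) (J 2 x) (fun X Y Z W => g x (curv Ga x X Y Z) W).
Proof.
move=> Ox; have b := g_bilin Ox; have hh := lhk_herm H Ox.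
have s12 X Y Z W : g x (curv Ga x X Y Z) W = - g x (curv Ga x Y X Z) W.
  by rewrite (curv_skew x X) (bsymNl b).
have s34 X Y Z W : g x (curv Ga x X Y Z) W = - g x (curv Ga x X Y W) Z.
  by rewrite curv_metric // (bsym_sym b Z).
have bi X Y Z W : g x (curv Ga x X Y Z) W + g x (curv Ga x Y Z X) W + g x (curv Ga x Z X Y) W = 0.
  by rewrite -!(bsymDl b) curv_bianchi1 // (bsym0l b).
split=> //.
- by move=> Y Z W a X X' /=; rewrite curv_linear1 // (bsymDl b) (bsymZl b).
- move=> X Y Z W; have b1 := bi X Y Z W; have b2 := bi Y Z W X.
  have b3 := bi Z W X Y; have b4 := bi W X Y Z.
  rewrite (s34 Y Z X) (s34 Z W X) (s12 Z X Y) in b1 b2 b3 b4.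
  have := s34 Z X Y W; have := s34 W Y Z X; have := s12 Y X Z W; have := s12 X W Y Z.
  have := s34 X Y Z W; have := s34 Z W X Y; have := s34 W X Y Z; have := s12 X Z W Y.
  have := s12 W Y Z X; have := s34 Y W Z X; have := s34 Y Z X W; have := s34 X Z W Y.
  by move: b1 b2 b3 b4; lra.
- by move=> X Y Z W; rewrite curv_J // (hyp_J1 hh).
- by move=> X Y Z W; rewrite curv_J // (hyp_J2 hh).
- by move=> X Y Z W; rewrite curv_J // (hyp_J3 hh).
Qed.
End LHK.
End LocalHyperkahler.

(** * Covariant derivatives along a map *)

Section Pullback.
Variables (R : realType) (m d : nat).
Local Notation vec := 'rV[R]_d.
Variables (O : set vec) (g : vec -> vec -> vec -> R)
  (Ga : vec -> vec -> vec -> vec) (J : 'I_3 -> vec -> vec -> vec).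
Hypothesis H : local_hyperkahler O g Ga J.
Variables (U : set 'rV[R]_m) (phi : 'rV[R]_m -> vec).
Hypotheses (oU : open U) (phiU : forall x, U x -> O (phi x)) (sphi : smooth_on U phi).

Definition push (x v : 'rV[R]_m) : vec := 'D_v phi x.

(** Covariant derivative along [phi] of a field of ambient vectors. *)
Definition cov (v : 'rV[R]_m) (Y : 'rV[R]_m -> vec) (x : 'rV[R]_m) : vec :=
  'D_v Y x + Ga (phi x) (push x v) (Y x).

Let b x (Ux : U x) := g_bilin H (phiU Ux).

Lemma near_U (P : 'rV[R]_m -> Prop) x : U x -> (forall y, U y -> P y) -> \forall y \near x, P y.
Proof. by move=> Ux HP; have := open_nbhs_nbhs (conj oU Ux); apply: filterS. Qed.

Lemma diff_phi x : U x -> differentiable phi x.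
Proof. exact: smooth_diff sphi. Qed.

Lemma smooth_push v : smooth_on U (push ^~ v).
Proof. exact: smooth_derive. Qed.

Lemma push_linear x : U x -> linear (push x).
Proof. by move=> Ux a v w; rewrite /push !deriveE ?linearP //; exact: diff_phi. Qed.

Lemma smooth_pull (W : normedModType R) (T : vec -> W) : smooth_on O T ->
  smooth_on U (fun x => T (phi x)).
Proof. by move=> sT; exact: smooth_comp sT sphi. Qed.

Lemma derive_pull (W : normedModType R) (T : vec -> W) x v : smooth_on O T -> U x ->
  'D_v (fun y => T (phi y)) x = 'D_(push x v) T (phi x).
Proof.
move=> sT Ux; have dT := smooth_diff sT (phiU Ux).
by rewrite (derive_comp v (diff_phi Ux) dT) -(deriveE _ dT).
Qed.

Lemma pull_g_linear y Z : U y -> linear (fun X => g (phi y) X Z : R^o).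
Proof. by move=> Uy; exact: (g_linear H Z (phiU Uy)). Qed.

Lemma smooth_g Y Z : smooth_on U Y -> smooth_on U Z ->
  smooth_on U (fun x => g (phi x) (Y x) (Z x)).
Proof.
move=> sY sZ.
apply: (@smooth_apply R d _ _ U (fun y X => g (phi y) X (Z y)) oU) => //.
  by move=> y Uy; exact: (pull_g_linear (Z y) Uy).
move=> w; apply: (smooth_ext oU (f := fun x => g (phi x) (Z x) w)).
  by move=> y Uy; exact: (bsym_sym (b Uy)).
apply: (@smooth_apply R d _ _ U (fun y X => g (phi y) X w) oU) => //.
  by move=> y Uy; exact: (pull_g_linear w Uy).
by move=> w'; exact: smooth_pull (lhk_g_smooth H w' w).
Qed.

Lemma derive_g v Y Z x : smooth_on U Y -> smooth_on U Z -> U x ->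
  'D_v (fun y => g (phi y) (Y y) (Z y)) x
  = g (phi x) (cov v Y x) (Z x) + g (phi x) (Y x) (cov v Z x).
Proof.
move=> sY sZ Ux; have bx := b Ux.
have gly Z1 y : U y -> linear (fun X => g (phi y) X Z1 : R^o) by exact: (pull_g_linear Z1).
have glZ y : U y -> linear (fun X => g (phi y) X (Z y) : R^o) by exact: (pull_g_linear (Z y)).
have s1 w w' : smooth_on U (fun y => g (phi y) w w') by exact: smooth_pull (lhk_g_smooth H w w').
have s2 w : smooth_on U (fun y => g (phi y) w (Z y)).
  by apply: smooth_g => //; exact: smooth_cst.
rewrite (@derive_apply R d _ _ U (fun y X => g (phi y) X (Z y)) oU glZ Y x v Ux
  (fun w => smooth_diff (s2 w) Ux) (smooth_diff sY Ux)).
have -> : 'D_v (fun y => g (phi y) (Y x) (Z y)) x = 'D_v (fun y => g (phi y) (Z y) (Y x)) x.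
  by apply: near_eq_derive; apply: near_U => // y Uy; exact: (bsym_sym (b Uy)).
rewrite (@derive_apply R d _ _ U (fun y X => g (phi y) X (Y x)) oU (gly (Y x)) Z x v Ux
  (fun w => smooth_diff (s1 w (Y x)) Ux) (smooth_diff sZ Ux)).
rewrite (derive_pull v (lhk_g_smooth H (Z x) (Y x)) Ux) (lhk_metric H); last exact: phiU.
rewrite /cov !(bsymDl bx, bsymDr bx).
rewrite (bsym_sym bx ('D_v Z x)) (bsym_sym bx (Z x)) (bsym_sym bx (Ga _ _ (Z x)) (Y x)).
by lra.
Qed.

Lemma smooth_J s Y : smooth_on U Y -> smooth_on U (fun x => J s (phi x) (Y x)).
Proof.
move=> sY; apply: (@smooth_apply R d _ _ U (fun y X => J s (phi y) X) oU) => //.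
  by move=> y Uy; exact: (J_linear H s (phiU Uy)).
by move=> w; exact: smooth_pull (lhk_J_smooth H s w).
Qed.

Lemma cov_J s v Y x : smooth_on U Y -> U x ->
  cov v (fun y => J s (phi y) (Y y)) x = J s (phi x) (cov v Y x).
Proof.
move=> sY Ux; rewrite /cov.
have Jl y : U y -> linear (J s (phi y)) by move=> Uy; exact: (J_linear H s (phiU Uy)).
rewrite (@derive_apply R d _ _ U (fun y X => J s (phi y) X) oU Jl Y x v Ux
  (fun w => smooth_diff (smooth_pull (lhk_J_smooth H s w)) Ux) (smooth_diff sY Ux)).
rewrite (derive_pull v (lhk_J_smooth H s (Y x)) Ux) (lhk_parallel H); last exact: phiU.
by rewrite (linear_DP (Jl x Ux)); row_ring.
Qed.

Lemma smooth_Ga X Y : smooth_on U X -> smooth_on U Y ->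
  smooth_on U (fun x => Ga (phi x) (X x) (Y x)).
Proof.
move=> sX sY.
apply: (@smooth_apply R d _ _ U (fun y Z => Ga (phi y) Z (Y y)) oU) => //.
  by move=> y Uy; exact: (lhk_G_linear H (Y y) (phiU Uy)).
move=> w; apply: (@smooth_apply R d _ _ U (fun y Z => Ga (phi y) w Z) oU) => //.
  by move=> y Uy; exact: (Ga_linear2 H w (phiU Uy)).
by move=> w'; exact: smooth_pull (lhk_G_smooth H w w').
Qed.

Lemma smooth_cov v Y : smooth_on U Y -> smooth_on U (cov v Y).
Proof.
move=> sY; apply: smooth_add => //; first exact: smooth_derive.
by apply: smooth_Ga => //; exact: smooth_push.
Qed.

Lemma cov_push v w x : U x -> cov v (push ^~ w) x = cov w (push ^~ v) x.
Proof.
move=> Ux; have E : 'D_v (push ^~ w) x = 'D_w (push ^~ v) x.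
  exact: (smooth_derive_sym w v oU sphi Ux).
exact: (congr2 +%R E (lhk_G_sym H (push x v) (push x w) (phiU Ux))).
Qed.

Lemma cov_add v (Y Z : 'rV[R]_m -> vec) x : smooth_on U Y -> smooth_on U Z -> U x ->
  cov v (fun y => Y y + Z y) x = cov v Y x + cov v Z x.
Proof.
move=> sY sZ Ux.
have E : 'D_v (fun y => Y y + Z y) x = 'D_v Y x + 'D_v Z x.
  exact: (deriveD (diff_derivable (v := v) (smooth_diff sY Ux))
    (diff_derivable (v := v) (smooth_diff sZ Ux))).
apply: (etrans (congr2 +%R E (linear_DP (Ga_linear2 H (push x v) (phiU Ux)) _ _))).
by rewrite /cov; gen_derive; rewrite addrACA.
Qed.

Lemma cov_scale v (f : 'rV[R]_m -> R) (Y : 'rV[R]_m -> vec) x : smooth_on U f -> smooth_on U Y -> U x ->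
  cov v (fun y => (f y : R) *: (Y y : vec)) x = 'D_v f x *: Y x + f x *: cov v Y x.
Proof.
move=> sf sY Ux.
have E := derive_scale v (smooth_diff sf Ux) (smooth_diff sY Ux).
apply: (etrans (congr2 +%R E (linear_ZP (Ga_linear2 H (push x v) (phiU Ux)) _ _))).
by rewrite /cov; gen_derive; rewrite scalerDr addrA.
Qed.

Lemma cov_ext v Y Z x : (forall y, U y -> Y y = Z y) -> U x -> cov v Y x = cov v Z x.
Proof.
move=> E Ux; rewrite /cov E //; congr (_ + _).
by apply: near_eq_derive; exact: near_U.
Qed.

Lemma cov_linear1 x Y : U x -> smooth_on U Y -> linear (fun v => cov v Y x).
Proof.
move=> Ux sY a v w; rewrite /cov (push_linear Ux) (lhk_G_linear H _ (phiU Ux)).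
have D u : 'D_u Y x = 'd Y x u by rewrite deriveE //; exact: smooth_diff sY Ux.
have : 'D_(a *: v + w) Y x = a *: 'D_v Y x + 'D_w Y x.
  by rewrite (D (a *: v + w)) (D v) (D w) linearP.
by gen_derive => ->; row_ring.
Qed.

Lemma cov_curv v w Y x : smooth_on U Y -> U x ->
  cov v (cov w Y) x - cov w (cov v Y) x = curv Ga (phi x) (push x v) (push x w) (Y x).
Proof.
move=> sY Ux.
have key v1 w1 : cov v1 (cov w1 Y) x =
   'D_v1 ('D_w1 Y) x + 'D_(push x v1) (fun y => Ga y (push x w1) (Y x)) (phi x)
   + Ga (phi x) (push x w1) ('D_v1 Y x) + Ga (phi x) ('D_v1 (push ^~ w1) x) (Y x)
   + Ga (phi x) (push x v1) ('D_w1 Y x)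
   + Ga (phi x) (push x v1) (Ga (phi x) (push x w1) (Y x)).
  have dc := smooth_diff (smooth_derive w1 sY) Ux.
  have dG := smooth_diff (smooth_Ga (smooth_push w1) sY) Ux.
  have E : 'D_v1 (cov w1 Y) x = 'D_v1 ('D_w1 Y) x + 'D_v1 (fun y => Ga (phi y) (push y w1) (Y y)) x.
    exact: (deriveD (diff_derivable (v := v1) dc) (diff_derivable (v := v1) dG)).
  rewrite -[LHS]/('D_v1 (cov w1 Y) x + Ga (phi x) (push x v1) (cov w1 Y x)) E.
  have l1 y : U y -> linear (fun Z => Ga (phi y) Z (Y y)).
    by move=> Uy; exact: (lhk_G_linear H (Y y) (phiU Uy)).
  have l2 Z y : U y -> linear (fun X => Ga (phi y) Z X).
    by move=> Uy; exact: (Ga_linear2 H Z (phiU Uy)).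
  have s1 Z : smooth_on U (fun y => Ga (phi y) Z (Y y)).
    by apply: smooth_Ga => //; exact: smooth_cst.
  have s2 Z X : smooth_on U (fun y => Ga (phi y) Z X) by exact: smooth_pull (lhk_G_smooth H Z X).
  rewrite (@derive_apply R d _ _ U (fun y Z => Ga (phi y) Z (Y y)) oU l1 (push ^~ w1) x v1 Ux
    (fun Z => smooth_diff (s1 Z) Ux) (smooth_diff (smooth_push w1) Ux)).
  rewrite (@derive_apply R d _ _ U (fun y X => Ga (phi y) (push x w1) X) oU (l2 (push x w1)) Y x v1 Ux
    (fun X => smooth_diff (s2 (push x w1) X) Ux) (smooth_diff sY Ux)).
  rewrite (derive_pull v1 (lhk_G_smooth H (push x w1) (Y x)) Ux).
  rewrite /cov (linear_DP (Ga_linear2 H (push x v1) (phiU Ux))).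
  by rewrite !addrA.
have sy := smooth_derive_sym w v oU sY Ux.
have sp : 'D_v (push ^~ w) x = 'D_w (push ^~ v) x by exact: (smooth_derive_sym w v oU sphi Ux).
rewrite (key v w) (key w v) /curv; move: sy sp.
by gen_derive => -> ->; row_ring.
Qed.

End Pullback.

(** * Hypersurfaces of a hyper-Kaehler open set *)

Section Hypersurface.
Variables (R : realType) (m : nat).
Local Notation vec := 'rV[R]_(m + 1).
Variables (O : set vec) (g : vec -> vec -> vec -> R)
  (Ga : vec -> vec -> vec -> vec) (J : 'I_3 -> vec -> vec -> vec).
Hypothesis H : local_hyperkahler O g Ga J.
Variables (U : set 'rV[R]_m) (phi nu : 'rV[R]_m -> vec).
Hypotheses (oU : open U) (phiU : forall x, U x -> O (phi x)) (sphi : smooth_on U phi).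
Hypotheses (snu : smooth_on U nu)
  (nu1 : forall x, U x -> g (phi x) (nu x) (nu x) = 1)
  (nuT : forall x v, U x -> g (phi x) (nu x) (push phi x v) = 0)
  (pinj : forall x v, U x -> push phi x v = 0 -> v = 0).

Local Notation push := (push phi).
Local Notation cov := (cov Ga phi).
Let b x (Ux : U x) := g_bilin H (phiU Ux).
Let hh x (Ux : U x) := lhk_herm H (phiU Ux).
Let plin x (Ux : U x) : linear (push x) := push_linear sphi Ux.

(** Its inverse splits an ambient vector into tangent and normal parts, smoothly in
    the point. *)
Definition frame_mx (x : 'rV[R]_m) : 'M[R]_(m + 1) :=
  col_mx (\matrix_(i < m) push x (delta_mx 0 i)) (nu x).

Lemma mul_frame x (y : 'rV[R]_(m + 1)) : U x ->
  y *m frame_mx x = push x (lsubmx y) + rsubmx y 0 0 *: nu x.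
Proof.
move=> Ux; rewrite /frame_mx -{1}(hsubmxK y) mul_row_col; congr (_ + _).
  rewrite (linear_rowE _ (plin Ux)) mulmx_sum_row.
  by apply: eq_bigr => i _; rewrite rowK.
by rewrite mulmx_sum_row big_ord1; congr (_ *: _); apply/rowP => j; rewrite mxE.
Qed.

Lemma frame_unit x : U x -> frame_mx x \in unitmx.
Proof.
move=> Ux; rewrite -row_free_unit; apply/inj_row_free => y.
rewrite mul_frame // => E.
have r0 : rsubmx y 0 0 = 0.
  have : g (phi x) (nu x) (push x (lsubmx y) + rsubmx y 0 0 *: nu x) = 0 by rewrite E (bsym0r (b Ux)).
  by rewrite (bsymDr (b Ux)) nuT // (bsymZr (b Ux)) nu1 // mulr1 add0r.
rewrite r0 scale0r addr0 in E; have l0 := pinj Ux E.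
rewrite -(hsubmxK y) l0 (_ : rsubmx y = 0) ?row_mx0 //.
by apply/rowP => j; rewrite (ord1 j) r0 mxE.
Qed.

Definition tproj x (Y : vec) : 'rV[R]_m := lsubmx (Y *m invmx (frame_mx x)).

Lemma tproj_decomp x Y : U x -> Y = push x (tproj x Y) + g (phi x) (nu x) Y *: nu x.
Proof.
move=> Ux; have E : Y = Y *m invmx (frame_mx x) *m frame_mx x by rewrite mulmxKV // frame_unit.
have E2 := mul_frame (Y *m invmx (frame_mx x)) Ux.
have EY : Y = push x (tproj x Y) + rsubmx (Y *m invmx (frame_mx x)) 0 0 *: nu x.
  by rewrite {1}E E2.
suff -> : g (phi x) (nu x) Y = rsubmx (Y *m invmx (frame_mx x)) 0 0 by [].
by rewrite {1}EY (bsymDr (b Ux)) nuT // (bsymZr (b Ux)) nu1 // mulr1 add0r.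
Qed.

Lemma tproj_linear x : linear (tproj x).
Proof. by move=> a Y Z; rewrite /tproj mulmxDl -scalemxAl linearP. Qed.

Lemma push_inj x v w : U x -> push x v = push x w -> v = w.
Proof.
move=> Ux E; apply/eqP; rewrite -subr_eq0; apply/eqP/(pinj Ux).
by rewrite (linear_BP (plin Ux)) E subrr.
Qed.

Lemma tproj_push x v : U x -> tproj x (push x v) = v.
Proof.
move=> Ux; apply: (push_inj Ux).
by have := tproj_decomp (push x v) Ux; rewrite nuT // scale0r addr0 => <-.
Qed.

Lemma tproj_nu x : U x -> tproj x (nu x) = 0.
Proof.
move=> Ux; apply: (pinj Ux).
have := tproj_decomp (nu x) Ux; rewrite nu1 // scale1r => /esym/eqP.
by rewrite -subr_eq0 addrK => /eqP.
Qed.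

Lemma smooth_tproj Y : smooth_on U (tproj ^~ Y).
Proof.
apply: smooth_row => // i.
apply: (smooth_ext oU (f := fun x => \sum_j Y 0 j * invmx (frame_mx x) j (lshift 1 i))).
  by move=> x _; rewrite /tproj !mxE.
apply: smooth_sum => // j; apply: smooth_mul => //; first exact: smooth_cst.
apply: smooth_invmx => //; first exact: frame_unit.
move=> k l; case: (split_ordP k) => k' ->.
  apply: (smooth_ext oU _ (smooth_coord l oU (smooth_push sphi (delta_mx 0 k')))).
  by move=> x _; rewrite /frame_mx col_mxEu mxE.
apply: (smooth_ext oU _ (smooth_coord l oU snu)) => x _.
by rewrite /frame_mx col_mxEd (ord1 k').
Qed.

Definition shape x Y : vec := cov (tproj x Y) nu x.

Lemma shape_linear x : U x -> linear (shape x).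
Proof.
move=> Ux a Y Z; rewrite /shape tproj_linear.
exact: (cov_linear1 H phiU sphi Ux snu).
Qed.

Lemma smooth_shape Y : smooth_on U (shape ^~ Y).
Proof.
apply: (@smooth_apply R m _ _ U (fun y v => cov v nu y) oU).
- by move=> y Uy; exact: (cov_linear1 H phiU sphi Uy snu).
- by move=> v; exact: (smooth_cov H oU phiU sphi v snu).
- exact: smooth_tproj.
Qed.

Lemma shape_push x v : U x -> shape x (push x v) = cov v nu x.
Proof. by move=> Ux; rewrite /shape tproj_push. Qed.

Lemma shape_nu x : U x -> shape x (nu x) = 0.
Proof.
move=> Ux; rewrite /shape tproj_nu //.
exact: (linear_0P (cov_linear1 H phiU sphi Ux snu)).
Qed.

Lemma shape_perp x Y : U x -> g (phi x) (shape x Y) (nu x) = 0.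
Proof.
move=> Ux; rewrite /shape; set v := tproj x Y.
have E := derive_g H oU phiU sphi v snu snu Ux.
have E0 : 'D_v (fun y => g (phi y) (nu y) (nu y)) x = 0.
  rewrite -(derive_cst (1 : R) x v); apply: near_eq_derive.
  by apply: (near_U oU Ux) => y Uy; rewrite nu1.
rewrite {}E0 in E; move: E; rewrite (bsym_sym (b Ux) (nu x)).
by move: (g _ _ _) => *; lra.
Qed.

Lemma shape_sym_push x v w : U x ->
  g (phi x) (cov v nu x) (push x w) = g (phi x) (cov w nu x) (push x v).
Proof.
move=> Ux.
have key v1 w1 : g (phi x) (cov v1 nu x) (push x w1) = - g (phi x) (nu x) (cov v1 (push ^~ w1) x).
  have E := derive_g H oU phiU sphi v1 snu (smooth_push sphi w1) Ux.
  have E0 : 'D_v1 (fun y => g (phi y) (nu y) (push y w1)) x = 0.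
    rewrite -(derive_cst (0 : R) x v1); apply: near_eq_derive.
    by apply: (near_U oU Ux) => y Uy; rewrite nuT.
  by rewrite {}E0 in E; apply/eqP; rewrite -addr_eq0; apply/eqP.
by rewrite (key v w) (key w v) (cov_push H oU phiU sphi v w Ux).
Qed.

Lemma shape_sym x Y Z : U x -> g (phi x) (shape x Y) Z = g (phi x) Y (shape x Z).
Proof.
move=> Ux.
have k A B : g (phi x) (shape x A) B = g (phi x) (shape x A) (push x (tproj x B)).
  rewrite {1}(tproj_decomp B Ux); have := shape_perp A Ux.
  by generalize (shape x A) => S e; rewrite (bsymDr (b Ux)) (bsymZr (b Ux)) e mulr0 addr0.
apply: (etrans (k Y Z)).
apply: (etrans _ (esym (etrans (bsym_sym (b Ux) Y (shape x Z)) (k Z Y)))).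
exact: (shape_sym_push _ _ Ux).
Qed.

(** The value at the normal of the extended shape operator, see [Lop_J0nu]. *)
Definition normal_image x : vec := - J 0 (phi x) (shape x (J 0 (phi x) (nu x))).

(** A symmetric extension of the shape operator to all ambient vectors. It gives the
    derivative of the normal up to a multiple [tau] of the normal ([cov_nu]), and
    its value at the normal is chosen so that it commutes with the first complex
    structure there ([Lop_J0nu]). Both are needed in order to treat the normal
    quaternionic line like the horizontal directions. *)
Definition Lop x (Y : vec) : vec := shape x Y + g (phi x) (normal_image x) Y *: nu x
  + g (phi x) (nu x) Y *: (normal_image x - g (phi x) (normal_image x) (nu x) *: nu x).

Lemma smooth_shape_apply Y : smooth_on U Y -> smooth_on U (fun x => shape x (Y x)).
Proof.
move=> sY; apply: (@smooth_apply R _ _ _ U shape oU) => //.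
  by move=> y Uy; exact: shape_linear.
exact: smooth_shape.
Qed.

Lemma smooth_normal_image : smooth_on U normal_image.
Proof.
apply: smooth_opp => //; apply: (smooth_J H oU phiU sphi).
by apply: smooth_shape_apply; apply: (smooth_J H oU phiU sphi).
Qed.

Lemma Lop_linear x : U x -> linear (Lop x).
Proof.
move=> Ux a Y Z; rewrite /Lop shape_linear //.
generalize (shape x Y) (shape x Z) (normal_image x) (nu x) => S1 S2 r n.
by rewrite !(bsymDr (b Ux)) !(bsymZr (b Ux)); row_ring.
Qed.

Lemma smooth_Lop_apply Y : smooth_on U Y -> smooth_on U (fun x => Lop x (Y x)).
Proof.
move=> sY; have sg := smooth_g H oU phiU sphi; have sr := smooth_normal_image.
apply: smooth_add => //; first apply: smooth_add => //.
- exact: smooth_shape_apply.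
- by apply: smooth_scale => //; exact: sg.
apply: smooth_scale => //; first exact: sg.
apply: smooth_sub2 => //; apply: smooth_scale => //; exact: sg.
Qed.

Lemma Lop_sym x Y Z : U x -> g (phi x) (Lop x Y) Z = g (phi x) Y (Lop x Z).
Proof.
move=> Ux; have bx := b Ux; rewrite /Lop; have := shape_sym Y Z Ux.
generalize (shape x Y) (shape x Z) (normal_image x) (nu x) => S1 S2 r n e.
rewrite !(bsymDl bx, bsymDr bx, bsymZl bx, bsymZr bx, bsymNl bx, bsymNr bx) e.
by rewrite !(bsym_sym bx Y n) !(bsym_sym bx Y r) !(bsym_sym bx n); ring.
Qed.

Lemma Lop_nu x : U x -> Lop x (nu x) = normal_image x.
Proof.
move=> Ux; rewrite /Lop shape_nu // nu1 // scale1r add0r.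
by generalize (normal_image x) (nu x) => r n; rewrite addrC subrK.
Qed.

Lemma normal_image_J0nu x : U x -> g (phi x) (normal_image x) (J 0 (phi x) (nu x)) = 0.
Proof.
move=> Ux; rewrite /normal_image (bsymNl (b Ux)) (hyp_J1 (hh Ux)).
by apply/eqP; rewrite oppr_eq0; apply/eqP/shape_perp.
Qed.

Lemma Lop_J0nu x : U x -> Lop x (J 0 (phi x) (nu x)) = J 0 (phi x) (Lop x (nu x)).
Proof.
move=> Ux; rewrite Lop_nu // {1}/Lop normal_image_J0nu // scale0r addr0.
have -> : g (phi x) (nu x) (J 0 (phi x) (nu x)) = 0.
  have := hyp_skew1 (hh Ux) (nu x) (nu x); rewrite (bsym_sym (b Ux) (J 0 _ _)); lra.
rewrite scale0r addr0 /normal_image (linear_NP (J_linear H 0 (phiU Ux))).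
by rewrite (quat11 (hyp_quat (hh Ux))) opprK.
Qed.

Definition tau x v : R := - g (phi x) (normal_image x) (push x v).

Lemma cov_nu x v : U x -> cov v nu x = Lop x (push x v) + tau x v *: nu x.
Proof.
move=> Ux; rewrite /Lop shape_push // nuT // scale0r addr0 /tau scaleNr.
by rewrite addrK.
Qed.

Lemma smooth_tau v : smooth_on U (tau ^~ v).
Proof.
apply: smooth_opp => //; apply: (smooth_g H oU phiU sphi); first exact: smooth_normal_image.
exact: smooth_push.
Qed.

Definition cst_field (Y : vec) (y : 'rV[R]_m) : vec := Y.
Definition Lop_cst (Y : vec) (y : 'rV[R]_m) : vec := Lop y Y.

(** Covariant derivative of the field of operators [Lop]. *)
Definition dLop x v (Y : vec) : vec :=
  cov v (Lop_cst Y) x - Lop x (cov v (cst_field Y) x).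

Lemma cov_cst v (Y : vec) x : cov v (cst_field Y) x = Ga (phi x) (push x v) Y.
Proof.
have E : 'D_v (fun _ : 'rV[R]_m => Y) x = 0 by exact: derive_cst.
by rewrite -[RHS]add0r; exact: (congr2 +%R E erefl).
Qed.

Lemma cov_Lop x v Y : smooth_on U Y -> U x ->
  cov v (fun y => Lop y (Y y)) x = dLop x v (Y x) + Lop x (cov v Y x).
Proof.
move=> sY Ux.
have sL Z : smooth_on U (Lop ^~ Z) by apply: smooth_Lop_apply; exact: smooth_cst.
have E : 'D_v (fun y => Lop y (Y y)) x =
    'D_v (Lop_cst (Y x)) x + Lop x ('D_v Y x).
  exact: (@derive_apply R _ _ _ U Lop oU (fun y Uy => Lop_linear Uy) Y x v Ux
  (fun Z => smooth_diff (sL Z) Ux) (smooth_diff sY Ux)).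
rewrite /dLop cov_cst.
apply: (etrans (congr2 +%R E erefl)).
rewrite /cov (linear_DP (Lop_linear Ux)).
by gen_derive; rewrite /Lop_cst; generalize Lop => L'; row_ring.
Qed.

(** The derivative of [Lop], twisted by the form [tau] that makes up for the normal
    part of the derivative of the normal. *)
Definition codazzi_form x (X Y Z : vec) : R :=
  g (phi x) (dLop x (tproj x X) Y - tau x (tproj x X) *: Lop x Y) Z.

Let smL Y : smooth_on U (Lop_cst Y).
Proof. by apply: smooth_Lop_apply; exact: smooth_cst. Qed.
Let smC (Y : vec) : smooth_on U (cst_field Y).
Proof. exact: smooth_cst. Qed.

Lemma dLop_linear1 x Y : U x -> linear (fun v => dLop x v Y).
Proof.
move=> Ux a v w; rewrite /dLop.
have E1 := cov_linear1 H phiU sphi Ux (smL Y) a v w.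
have E2 := cov_linear1 H phiU sphi Ux (smC Y) a v w.
rewrite E1 E2 Lop_linear //.
generalize (cov v (Lop_cst Y) x) (cov w (Lop_cst Y) x).
generalize (Lop x (cov v (cst_field Y) x)) (Lop x (cov w (cst_field Y) x)) => *.
by row_ring.
Qed.

Lemma dLop_linear2 x v : U x -> linear (dLop x v).
Proof.
move=> Ux a Y Z; rewrite /dLop !cov_cst (Ga_linear2 H (push x v) (phiU Ux)) Lop_linear //.
have sa : smooth_on U (fun _ : 'rV[R]_m => a) by exact: smooth_cst.
have s1 := smooth_scale oU sa (smL Y).
have E : cov v (Lop_cst (a *: Y + Z)) x = a *: cov v (Lop_cst Y) x + cov v (Lop_cst Z) x.
  have E1 : cov v (Lop_cst (a *: Y + Z)) x = cov v (fun y => a *: Lop_cst Y y + Lop_cst Z y) x.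
    by apply: (cov_ext Ga phi oU) => // y Uy; exact: Lop_linear.
  have E2 := cov_add H phiU v s1 (smL Z) Ux; have E3 := cov_scale H phiU v sa (smL Y) Ux.
  have E4 : 'D_v (fun _ : 'rV[R]_m => a) x = 0 by exact: derive_cst.
  rewrite {}E4 scale0r add0r in E3.
  exact: (etrans E1 (etrans E2 (congr2 +%R E3 erefl))).
rewrite E; generalize (cov v (Lop_cst Y) x) (cov v (Lop_cst Z) x).
generalize (Lop x (Ga (phi x) (push x v) Y)) (Lop x (Ga (phi x) (push x v) Z)) => *.
by row_ring.
Qed.

Lemma dLop_sym x v Y Z : U x -> g (phi x) (dLop x v Y) Z = g (phi x) Y (dLop x v Z).
Proof.
move=> Ux; have bx := b Ux.
have E1 : 'D_v (fun y => g (phi y) (Lop y Y) Z) x = g (phi x) (cov v (Lop_cst Y) x) Z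
   + g (phi x) (Lop x Y) (cov v (cst_field Z) x).
  exact: (derive_g H oU phiU sphi v (smL Y) (smC Z) Ux).
have E2 : 'D_v (fun y => g (phi y) Y (Lop y Z)) x = g (phi x) (cov v (cst_field Y) x) (Lop x Z)
   + g (phi x) Y (cov v (Lop_cst Z) x).
  exact: (derive_g H oU phiU sphi v (smC Y) (smL Z) Ux).
have E3 : 'D_v (fun y => g (phi y) (Lop y Y) Z) x = 'D_v (fun y => g (phi y) Y (Lop y Z)) x.
  by apply: near_eq_derive; apply: (near_U oU Ux) => y Uy; exact: Lop_sym.
have {E1 E2 E3} E := etrans (esym E1) (etrans E3 E2).
have l1 := Lop_sym (cov v (cst_field Y) x) Z Ux.
have l2 := Lop_sym Y (cov v (cst_field Z) x) Ux.
rewrite /dLop; move: E l1 l2.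
generalize (cov v (Lop_cst Y) x) (cov v (Lop_cst Z) x) (cov v (cst_field Y) x) (cov v (cst_field Z) x).
move=> A B C D; generalize (Lop x Y) (Lop x Z) (Lop x C) (Lop x D) => *.
by rewrite (bsymBl bx) (bsymBr bx); lra.
Qed.

Lemma tau_linear x : U x -> forall a v w, tau x (a *: v + w) = a * tau x v + tau x w.
Proof.
move=> Ux a v w; rewrite /tau (plin Ux) (bsymDr (b Ux)) (bsymZr (b Ux)) opprD mulrN.
by [].
Qed.

Lemma codazzi_form_trilinear x : U x -> trilinear_sym (codazzi_form x).
Proof.
move=> Ux; have bx := b Ux; split.
- move=> Y Z a X X' /=; rewrite /codazzi_form tproj_linear (dLop_linear1 Y Ux) tau_linear //.
  generalize (dLop x (tproj x X) Y) (dLop x (tproj x X') Y) (Lop x Y) => D1 D2 l.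
  generalize (tau x (tproj x X)) (tau x (tproj x X')) => t t'.
  by rewrite !(bsymBl bx, bsymDl bx, bsymZl bx); ring.
- move=> X Z a Y Y' /=; rewrite /codazzi_form (dLop_linear2 _ Ux) Lop_linear //.
  generalize (dLop x (tproj x X) Y) (dLop x (tproj x X) Y') (Lop x Y) (Lop x Y') => D1 D2 l l'.
  generalize (tau x (tproj x X)) => t.
  by rewrite !(bsymBl bx, bsymDl bx, bsymZl bx); ring.
- move=> X Y Z; rewrite /codazzi_form; have := dLop_sym (tproj x X) Y Z Ux; have := Lop_sym Y Z Ux.
  generalize (dLop x (tproj x X) Y) (dLop x (tproj x X) Z) (Lop x Y) (Lop x Z) => D1 D2 l l' e1 e2.
  generalize (tau x (tproj x X)) => t.
  by rewrite !(bsymBl bx, bsymZl bx) e1 e2 !(bsym_sym bx Y).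
Qed.

(** The curvature is the commutator of second covariant derivatives of the normal;
    [cov_nu] gives these in terms of [Lop] and [tau]. *)
Lemma codazzi_vec x v w : U x -> curv Ga (phi x) (push x v) (push x w) (nu x) =
  dLop x v (push x w) - tau x v *: Lop x (push x w)
  - (dLop x w (push x v) - tau x w *: Lop x (push x v))
  + ('D_v (tau ^~ w) x - 'D_w (tau ^~ v) x) *: nu x.
Proof.
move=> Ux; rewrite -(cov_curv H oU phiU sphi v w snu Ux).
have sp := smooth_push sphi.
have key v1 w1 : cov v1 (cov w1 nu) x = dLop x v1 (push x w1) + Lop x (cov v1 (push ^~ w1) x)
   + ('D_v1 (tau ^~ w1) x *: nu x + tau x w1 *: (Lop x (push x v1) + tau x v1 *: nu x)).
  rewrite -(cov_nu v1 Ux) -(cov_Lop v1 (sp w1) Ux).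
  have s1 := smooth_Lop_apply (sp w1).
  have s2 := smooth_scale oU (smooth_tau w1) snu.
  rewrite -(cov_scale H phiU v1 (smooth_tau w1) snu Ux) -(cov_add H phiU v1 s1 s2 Ux).
  by apply: (cov_ext Ga phi oU) => // y Uy; exact: cov_nu.
rewrite (key v w) (key w v) (cov_push H oU phiU sphi v w Ux).
gen_derive; generalize dLop Lop tau nu => f1 f2 f3 f4; row_ring.
Qed.

Lemma push_tproj x X : U x -> g (phi x) X (nu x) = 0 -> push x (tproj x X) = X.
Proof.
move=> Ux hX; have := tproj_decomp X Ux.
by rewrite (bsym_sym (b Ux)) hX scale0r addr0 => <-.
Qed.

Definition dtau x X Y : R := 'D_(tproj x X) (tau ^~ (tproj x Y)) x - 'D_(tproj x Y) (tau ^~ (tproj x X)) x.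

Lemma codazzi x X Y Z : U x -> g (phi x) X (nu x) = 0 -> g (phi x) Y (nu x) = 0 ->
  g (phi x) (curv Ga (phi x) X Y (nu x)) Z = codazzi_form x X Y Z - codazzi_form x Y X Z + dtau x X Y * g (phi x) (nu x) Z.
Proof.
move=> Ux hX hY; have := codazzi_vec (tproj x X) (tproj x Y) Ux.
rewrite !push_tproj // /codazzi_form => ->.
rewrite -/(dtau x X Y); generalize dLop Lop tau (dtau x X Y) => f1 f2 f3 f4.
by have bx := b Ux; rewrite (bsymDl bx) (bsymBl bx (_ - _)) (bsymZl bx).
Qed.

(** The complex structures are parallel, so apart from the arguments only [Lop] is
    differentiated. *)
Lemma commdef_derive s x v Y Z : smooth_on U Y -> smooth_on U Z -> U x ->
  (forall y, U y -> commdef (Lop y) (g (phi y)) (J s (phi y)) (Y y) (Z y) = 0) ->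
  g (phi x) (dLop x v (Y x)) (J s (phi x) (Z x)) + g (phi x) (dLop x v (J s (phi x) (Y x))) (Z x)
  = - commdef (Lop x) (g (phi x)) (J s (phi x)) (cov v Y x) (Z x)
    - commdef (Lop x) (g (phi x)) (J s (phi x)) (Y x) (cov v Z x).
Proof.
move=> sY sZ Ux F0; have bx := b Ux.
have sJY := smooth_J H oU phiU sphi s sY; have sJZ := smooth_J H oU phiU sphi s sZ.
have sLY := smooth_Lop_apply sY; have sLJ := smooth_Lop_apply sJY.
have E1 := derive_g H oU phiU sphi v sLY sJZ Ux.
have E2 := derive_g H oU phiU sphi v sLJ sZ Ux.
have g1 := smooth_diff (smooth_g H oU phiU sphi sLY sJZ) Ux.
have g2 := smooth_diff (smooth_g H oU phiU sphi sLJ sZ) Ux.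
have E3 := deriveD (diff_derivable (v := v) g1) (diff_derivable (v := v) g2).
have E0 : 'D_v ((fun y => g (phi y) (Lop y (Y y)) (J s (phi y) (Z y))) +
    (fun y => g (phi y) (Lop y (J s (phi y) (Y y))) (Z y))) x = 0.
  rewrite -(derive_cst (0 : R) x v); apply: near_eq_derive.
  by apply: (near_U oU Ux) => y Uy; exact: F0.
have {E1 E2 E3 E0} E := etrans (esym E0) (etrans E3 (congr2 +%R E1 E2)).
rewrite (cov_Lop v sY Ux) (cov_Lop v sJY Ux) (cov_J H oU phiU sphi s v sY Ux)
  (cov_J H oU phiU sphi s v sZ Ux) in E.
move: E; rewrite /commdef; generalize dLop Lop (cov v Y x) (cov v Z x) => f1 f2 c1 c2.
by rewrite !(bsymDl bx) => E; lra.
Qed.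

Local Notation Jx x s := (J s (phi x)).
Local Notation horx x := (horizontal (J 0 (phi x)) (J 1 (phi x)) (J 2 (phi x)) (g (phi x)) (nu x)).
Local Notation Fx x s := (commdef (Lop x) (g (phi x)) (J s (phi x))).

(** A horizontal field with given value: derivatives of identities that hold on
    horizontal vectors are taken along such fields. *)
Definition hor_field Y y : vec := hpart (J 0 (phi y)) (J 1 (phi y)) (J 2 (phi y)) (g (phi y)) (nu y) Y.

Lemma smooth_hor_field Y : smooth_on U (hor_field Y).
Proof.
have sg := smooth_g H oU phiU sphi; have sJ := smooth_J H oU phiU sphi.
have tJ s : smooth_on U (fun y => g (phi y) Y (J s (phi y) (nu y)) *: J s (phi y) (nu y)).
  apply: smooth_scale => //; last exact: sJ.
  by apply: sg; [exact: smC|exact: sJ].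
have tN : smooth_on U (fun y => g (phi y) Y (nu y) *: nu y).
  by apply: smooth_scale => //; apply: sg => //; exact: smC.
exact: (smooth_sub2 oU (smooth_sub2 oU (smooth_sub2 oU
  (smooth_sub2 oU (smC Y) (tJ 2)) (tJ 1)) (tJ 0)) tN).
Qed.

Lemma horx_hor_field Y y : U y -> horx y (hor_field Y y).
Proof. by move=> Uy; exact: (horizontal_hpart (hh Uy) (nu1 Uy)). Qed.

Lemma hor_field_id x Y : horx x Y -> hor_field Y x = Y.
Proof. exact: hpart_id. Qed.

(** Derivative of the orthogonality of the field to the normal quaternionic line,
    along which the derivatives are given by [Lop]. *)
Lemma cov_hor_field x v Y : U x -> horx x Y ->
  [/\ g (phi x) (cov v (hor_field Y) x) (nu x) = - g (phi x) Y (Lop x (push x v)),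
      g (phi x) (cov v (hor_field Y) x) (Jx x 0 (nu x)) = g (phi x) (Jx x 0 Y) (Lop x (push x v)),
      g (phi x) (cov v (hor_field Y) x) (Jx x 1 (nu x)) = g (phi x) (Jx x 1 Y) (Lop x (push x v))
    & g (phi x) (cov v (hor_field Y) x) (Jx x 2 (nu x)) = g (phi x) (Jx x 2 Y) (Lop x (push x v))].
Proof.
move=> Ux hY; have bx := b Ux; have sh := smooth_hor_field Y.
have [y0 y1 y2 y3] := hY.
have key W : smooth_on U W -> (forall y, U y -> g (phi y) (hor_field Y y) (W y) = 0) ->
   g (phi x) (cov v (hor_field Y) x) (W x) = - g (phi x) Y (cov v W x).
  move=> sW W0; have E := derive_g H oU phiU sphi v sh sW Ux.
  have E0 : 'D_v (fun y => g (phi y) (hor_field Y y) (W y)) x = 0.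
    rewrite -(derive_cst (0 : R) x v); apply: near_eq_derive.
    by apply: (near_U oU Ux) => y Uy; exact: W0.
  rewrite {}E0 (hor_field_id hY) in E.
  by apply/eqP; rewrite -addr_eq0; apply/eqP.
have keyJ s : (forall y, U y -> g (phi y) (hor_field Y y) (J s (phi y) (nu y)) = 0) ->
   g (phi x) (cov v (hor_field Y) x) (J s (phi x) (nu x)) = - g (phi x) Y (J s (phi x) (cov v nu x)).
  move=> e; rewrite (key _ (smooth_J H oU phiU sphi s snu) e).
  by rewrite (cov_J H oU phiU sphi s v snu Ux).
have hz y (Uy : U y) := horx_hor_field Y Uy.
have k0 := key nu snu (fun y Uy => let: And4 e _ _ _ := hz y Uy in e).
have k1 := keyJ 0 (fun y Uy => let: And4 _ e _ _ := hz y Uy in e).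
have k2 := keyJ 1 (fun y Uy => let: And4 _ _ e _ := hz y Uy in e).
have k3 := keyJ 2 (fun y Uy => let: And4 _ _ _ e := hz y Uy in e).
have D s : J s (phi x) (Lop x (push x v) + tau x v *: nu x)
   = J s (phi x) (Lop x (push x v)) + tau x v *: J s (phi x) (nu x).
  by rewrite (linear_DP (J_linear H s (phiU Ux))) (linear_ZP (J_linear H s (phiU Ux))).
have aux A t B : g (phi x) Y B = 0 -> g (phi x) Y (A + t *: B) = g (phi x) Y A.
  by move=> e; rewrite (bsymDr bx) (bsymZr bx) e mulr0 addr0.
rewrite (cov_nu v Ux) (aux _ _ _ y0) in k0; rewrite (cov_nu v Ux) D (aux _ _ _ y1) in k1.
rewrite (cov_nu v Ux) D (aux _ _ _ y2) in k2; rewrite (cov_nu v Ux) D (aux _ _ _ y3) in k3.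
have sk1 := hyp_skew1 (hh Ux); have sk2 := hyp_skew2 (hh Ux); have sk3 := hyp_skew3 (hh Ux).
by split; [exact: k0|rewrite k1 sk1 opprK|rewrite k2 sk2 opprK|rewrite k3 sk3 opprK].
Qed.

Local Notation vertx x s := (verticaldef (J 0 (phi x)) (J 1 (phi x)) (J 2 (phi x))
  (Lop x) (g (phi x)) (nu x) (J s (phi x))).

Let Jlx s x (Ux : U x) : linear (J s (phi x)) := J_linear H s (phiU Ux).
Let Jsk s x (Ux : U x) A B := J_skew H s A B (phiU Ux).

Lemma commdef_cov_hor_field s x X Y Z : U x -> g (phi x) X (nu x) = 0 -> horx x Y ->
  (forall A, horx x A -> Fx x s A Z = 0) ->
  - Fx x s (cov (tproj x X) (hor_field Y) x) Z = vertx x s X Y Z.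
Proof.
move=> Ux hX hY h0; have [e0 e1 e2 e3] := cov_hor_field (tproj x X) Ux hY.
rewrite push_tproj // in e0 e1 e2 e3.
rewrite (commdef_vertical (hh Ux) (Lop_linear Ux) (nu1 Ux) _ (Jlx s Ux) h0) e0 e1 e2 e3.
by rewrite /verticaldef; generalize (Fx x s) (Lop x X) => F l; ring.
Qed.

Lemma codazzi_form_pair s x X Y Z : Fx x s Y Z = 0 ->
  U x -> codazzi_form x X Y (J s (phi x) Z) + codazzi_form x X (J s (phi x) Y) Z =
  g (phi x) (dLop x (tproj x X) Y) (J s (phi x) Z)
  + g (phi x) (dLop x (tproj x X) (J s (phi x) Y)) Z.
Proof.
rewrite /commdef /codazzi_form => F0 Ux; have bx := b Ux; move: F0.
generalize (Lop x Y) (Lop x (J s (phi x) Y)) (tau x (tproj x X)).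
generalize dLop => f l l' t F0; rewrite !(bsymBl bx) !(bsymZl bx).
move: F0; generalize (g (phi x) l (J s (phi x) Z)) (g (phi x) l' Z).
generalize (g (phi x) (f x (tproj x X) Y) (J s (phi x) Z)).
generalize (g (phi x) (f x (tproj x X) (J s (phi x) Y)) Z) => a c d e F0.
have -> : d = - e by lra.
by ring.
Qed.

(** The derivative of the vanishing of the commutation defect on horizontal fields:
    the right-hand side comes from the derivatives of the two fields. In the next
    two lemmas the defect vanishes for more arguments, and fewer terms remain. *)
Lemma codazzi_form_J_hor2 s x X Y Z : U x -> g (phi x) X (nu x) = 0 -> horx x Y -> horx x Z ->
  (forall y A B, U y -> horx y A -> horx y B -> Fx y s A B = 0) ->
  codazzi_form x X Y (J s (phi x) Z) + codazzi_form x X (J s (phi x) Y) Z = vertx x s X Y Z + vertx x s X Z Y.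
Proof.
move=> Ux hX hY hZ F0; rewrite codazzi_form_pair //; last exact: F0.
have E := commdef_derive (s := s) (tproj x X) (smooth_hor_field Y) (smooth_hor_field Z) Ux
  (fun y Uy => F0 y _ _ Uy (horx_hor_field Y Uy) (horx_hor_field Z Uy)).
rewrite (hor_field_id hY) (hor_field_id hZ) in E; rewrite {}E.
rewrite (commdef_sym (hh Ux) (fun A B => Lop_sym A B Ux) Y _ (fun A B => Jsk s Ux A B)).
by rewrite !commdef_cov_hor_field // => A hA; apply: F0.
Qed.

Lemma codazzi_form_J_hor s x X Y Z : U x -> g (phi x) X (nu x) = 0 -> horx x Y ->
  (forall y A B, U y -> horx y A -> Fx y s A B = 0) ->
  codazzi_form x X Y (J s (phi x) Z) + codazzi_form x X (J s (phi x) Y) Z = vertx x s X Y Z.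
Proof.
move=> Ux hX hY F0; rewrite codazzi_form_pair //; last exact: F0.
have E := commdef_derive (s := s) (tproj x X) (smooth_hor_field Y) (smC Z) Ux
  (fun y Uy => F0 y _ _ Uy (horx_hor_field Y Uy)).
rewrite (hor_field_id hY) in E; rewrite {}E (F0 x Y) // subr0.
by rewrite -commdef_cov_hor_field // => A hA; apply: F0.
Qed.

Lemma codazzi_form_J s x X Y Z : U x ->
  (forall y A B, U y -> Fx y s A B = 0) ->
  codazzi_form x X Y (J s (phi x) Z) + codazzi_form x X (J s (phi x) Y) Z = 0.
Proof.
move=> Ux F0; rewrite codazzi_form_pair //; last exact: F0.
have E := commdef_derive (s := s) (tproj x X) (smC Y) (smC Z) Ux (fun y Uy => F0 y _ _ Uy).
by rewrite {}E !F0 // oppr0 addr0.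
Qed.

Hypothesis comm_hor : forall x X Y, U x -> horx x X -> horx x Y ->
  [/\ Fx x 0 X Y = 0, Fx x 1 X Y = 0 & Fx x 2 X Y = 0].
Hypothesis LH0 : forall x X, U x -> horx x X -> X != 0 -> g (phi x) X (Lop x X) != 0.
Hypothesis hor_ex : forall x, U x -> exists2 X, horx x X & X != 0.

Let KH x (Ux : U x) := curv_hyperkahler H (phiU Ux).

Lemma commdef_horizontal0 x X : U x -> horx x X -> forall Y, [/\ Fx x 0 X Y = 0, Fx x 1 X Y = 0 & Fx x 2 X Y = 0].
Proof.
move=> Ux hX Y.
have [] := shape_commutes_horizontal (hh Ux) (KH Ux) (codazzi_form_trilinear Ux) (Lop_linear Ux) (fun A B => Lop_sym A B Ux) (nu1 Ux)
   (Lop_J0nu Ux) (fun A B => @comm_hor x A B Ux) (fun A => @LH0 x A Ux) _ _ hX.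
- move=> A B C hA hB hC; have [a0 _ _ _] := hA; split; apply: codazzi_form_J_hor2 => //.
  + by move=> y D E Uy hD hE; have [] := comm_hor Uy hD hE.
  + by move=> y D E Uy hD hE; have [] := comm_hor Uy hD hE.
  + by move=> y D E Uy hD hE; have [] := comm_hor Uy hD hE.
- move=> A B C [a0 _ _ _] [b0 _ _ _] [c0 _ _ _].
  by rewrite codazzi // (bsym_sym (b Ux) (nu x)) c0 mulr0 addr0.
move=> e0 e1 e2; rewrite /commdef e0 e1 e2 !Jsk //.
by split; rewrite addNr.
Qed.

Lemma commdef0 x X : U x -> forall Y, [/\ Fx x 0 X Y = 0, Fx x 1 X Y = 0 & Fx x 2 X Y = 0].
Proof.
move=> Ux Y; have [X0 hX0 X00] := hor_ex Ux.
have LJ A : horx x A -> [/\ Lop x (J 0 (phi x) A) = J 0 (phi x) (Lop x A),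
    Lop x (J 1 (phi x) A) = J 1 (phi x) (Lop x A) & Lop x (J 2 (phi x) A) = J 2 (phi x) (Lop x A)].
  move=> hA; have F0 B := commdef_horizontal0 Ux hA B.
  have key s : (forall B, Fx x s A B = 0) -> Lop x (J s (phi x) A) = J s (phi x) (Lop x A).
    move=> e; apply/eqP; rewrite -subr_eq0; apply/eqP; apply: (nondeg (hh Ux)) => B.
    by rewrite (bsymBl (b Ux)) -(e B) /commdef Jsk // addrC.
  by split; apply: key => B; have [] := F0 B.
have [] := shape_commutes (hh Ux) (KH Ux) (codazzi_form_trilinear Ux) (Lop_linear Ux) (fun A B => Lop_sym A B Ux) (nu1 Ux)
  _ (Lop_J0nu Ux) LJ (fun A => @LH0 x A Ux) _ X hX0 X00.
- move=> A B C a0 b0 [c0 _ _ _].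
  by rewrite codazzi // (bsym_sym (b Ux) (nu x)) c0 mulr0 addr0.
- move=> A B C a0 hB; split; apply: codazzi_form_J_hor => //.
  + by move=> y D E Uy hD; have [] := commdef_horizontal0 Uy hD E.
  + by move=> y D E Uy hD; have [] := commdef_horizontal0 Uy hD E.
  + by move=> y D E Uy hD; have [] := commdef_horizontal0 Uy hD E.
move=> e0 e1 e2; rewrite /commdef e0 e1 e2 !Jsk //.
by split; rewrite addNr.
Qed.

(** Commutation of [Lop] with the complex structures is known on pairs of horizontal
    vectors, then with one horizontal argument, then for all vectors: each time the
    rule for [codazzi_form] obtained by differentiation gives the next step, and
    the last rule annihilates the curvature. *)
Lemma hypersurface_curvature x X Y : U x -> curv Ga (phi x) X Y (nu x) = 0.
Proof.
move=> Ux; apply: (nondeg (hh Ux)) => Z.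
apply: (curvature_normal_zero (hh Ux) (KH Ux) (codazzi_form_trilinear Ux) (nu1 Ux) (de := dtau x)).
- by move=> A B C a0 b0; rewrite codazzi.
move=> A B C a0; have F s : (forall y D E, U y -> Fx y s D E = 0) ->
    codazzi_form x A B (J s (phi x) C) = - codazzi_form x A (J s (phi x) B) C.
  by move=> F0; apply/eqP; rewrite -addr_eq0; apply/eqP/codazzi_form_J.
by split; apply: F => y D E Uy; have [] := commdef0 D Uy E.
Qed.

End Hypersurface.

(** * The second fundamental form of a qc hypersurface *)

Section QCHypersurface.
Variables (R : realType) (m : nat).
Local Notation vec := 'rV[R]_(m + 1).
Local Notation tan := 'rV[R]_m.

(** The qc relations at a point; [deta] stands for the differentials of the contact
    forms. *)
Record qc_at (Hx : tan -> Prop) (gg : tan -> tan -> R) (I : 'I_3 -> tan -> tan)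
    (deta : 'I_3 -> tan -> tan -> R) : Prop := {
  qca_linear : forall a u v w, Hx u -> Hx v -> Hx w -> gg (a *: u + v) w = a * gg u w + gg v w ;
  qca_sym : forall v w, Hx v -> Hx w -> gg v w = gg w v ;
  qca_pos : forall v, Hx v -> v != 0 -> 0 < gg v v ;
  qca_stable : forall s v, Hx v -> Hx (I s v) ;
  qca_square : forall s v, Hx v -> I s (I s v) = - v ;
  qca_herm : forall s v w, Hx v -> Hx w -> gg (I s v) (I s w) = gg v w ;
  qca_deta : forall s v w, Hx v -> Hx w -> 2 * gg (I s v) w = deta s v w }.

Variables (O : set vec) (g : vec -> vec -> vec -> R)
  (Ga : vec -> vec -> vec -> vec) (J : 'I_3 -> vec -> vec -> vec).
Hypothesis H : local_hyperkahler O g Ga J.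
Variables (U : set tan) (phi nu : tan -> vec).
Hypotheses (oU : open U) (phiU : forall x, U x -> O (phi x)) (sphi : smooth_on U phi).
Hypotheses (snu : smooth_on U nu)
  (nu1 : forall x, U x -> g (phi x) (nu x) (nu x) = 1)
  (nuT : forall x v, U x -> g (phi x) (nu x) (push phi x v) = 0)
  (pinj : forall x v, U x -> push phi x v = 0 -> v = 0).
Variable (eta : 'I_3 -> tan -> tan -> R).
Hypothesis eta_linear : forall s x, U x -> linear (eta s x : tan -> R^o).
Hypothesis eta_smooth : forall s v, smooth_on U (fun x => eta s x v).

Local Notation push := (push phi).
Local Notation cov := (cov Ga phi).
Local Notation tproj := (tproj phi nu).
Local Notation shape := (shape Ga phi nu).
Local Notation Lop := (Lop g Ga J phi nu).
Local Notation horx x := (horizontal (J 0 (phi x)) (J 1 (phi x)) (J 2 (phi x)) (g (phi x)) (nu x)).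
Local Notation Fx x s := (commdef (Lop x) (g (phi x)) (J s (phi x))).
Let b x (Ux : U x) := g_bilin H (phiU Ux).
Let hh x (Ux : U x) := lhk_herm H (phiU Ux).

(** The contact form that the ambient metric attaches to the normal. *)
Definition eta0 s x v : R := g (phi x) (J s (phi x) (nu x)) (push x v).
Definition tan_hor x v := forall s, eta0 s x v = 0.

Hypothesis eta_ker : forall s x v, U x -> tan_hor x v -> eta s x v = 0.

Let ptj x X (Ux : U x) := push_tproj H phiU sphi nu1 nuT pinj (X := X) Ux.

Lemma J_nu_orth s t x : U x ->
  g (phi x) (J s (phi x) (nu x)) (J t (phi x) (nu x)) = (s == t)%:R.
Proof.
move=> Ux; have q := hyp_quat (hh Ux); have bx := b Ux; have n := nu1 Ux.
have z r : g (phi x) (nu x) (J r (phi x) (nu x)) = 0.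
  by have := J_skew H r (nu x) (nu x) (phiU Ux); rewrite (bsym_sym bx (J _ _ _)); lra.
have z' r : g (phi x) (J r (phi x) (nu x)) (nu x) = 0 by rewrite (bsym_sym bx).
have same r : g (phi x) (J r (phi x) (nu x)) (J r (phi x) (nu x)) = 1.
  rewrite (J_skew H r _ _ (phiU Ux)).
  have -> : J r (phi x) (J r (phi x) (nu x)) = - nu x; last by rewrite (bsymNl bx) n opprK.
  by case: (ord3P r) => ->; [exact: (quat11 q _)|exact: (quat22 q _)|exact: (quat33 q _)].
have [->|st] := eqVneq s t; first exact: same.
have e01 : g (phi x) (J 0 (phi x) (nu x)) (J 1 (phi x) (nu x)) = 0.
  by rewrite (J_skew H 1 _ _ (phiU Ux)) (quat21 q) (bsymNl bx) z' !oppr0.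
have e02 : g (phi x) (J 0 (phi x) (nu x)) (J 2 (phi x) (nu x)) = 0.
  by rewrite (J_skew H 2 _ _ (phiU Ux)) (quat31 q) z' oppr0.
have e12 : g (phi x) (J 1 (phi x) (nu x)) (J 2 (phi x) (nu x)) = 0.
  by rewrite (J_skew H 2 _ _ (phiU Ux)) (quat32 q) (bsymNl bx) z' !oppr0.
by case: (ord3P s) st => ->; case: (ord3P t) => -> // _;
  rewrite ?e01 ?e02 ?e12 // (bsym_sym bx) ?e01 ?e02 ?e12.
Qed.

Lemma J_nu_tangent s x : U x -> g (phi x) (J s (phi x) (nu x)) (nu x) = 0.
Proof.
move=> Ux; have := J_skew H s (nu x) (nu x) (phiU Ux).
by rewrite (bsym_sym (b Ux) (nu x)); lra.
Qed.

Lemma eta0_reeb s t x : U x -> eta0 s x (tproj x (J t (phi x) (nu x))) = (s == t)%:R.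
Proof. by move=> Ux; rewrite /eta0 ptj ?J_nu_orth // J_nu_tangent. Qed.

Lemma eta0_linear s x : U x -> linear (eta0 s x : tan -> R^o).
Proof.
move=> Ux a v w; rewrite /eta0 (push_linear sphi Ux).
by rewrite (bsymDr (b Ux)) (bsymZr (b Ux)).
Qed.

Definition eta_coef s t x : R := eta s x (tproj x (J t (phi x) (nu x))).

(** The forms [eta0] are dual to the tangent parts of the J_t nu, and [eta] vanishes
    on their common kernel. *)
Lemma eta_expand s x v : U x -> eta s x v = \sum_t eta_coef s t x * eta0 t x v.
Proof.
move=> Ux; pose z t := tproj x (J t (phi x) (nu x)).
have lin := eta_linear s Ux; have lin0 t := eta0_linear t Ux.
have : tan_hor x (v - \sum_t eta0 t x v *: z t).
  move=> r; rewrite (linear_BP (lin0 r)).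
  rewrite big_ord_recl !big_ord_recl big_ord0 addr0 !(linear_DP (lin0 r)) !(linear_ZP (lin0 r)).
  rewrite /z !eta0_reeb //; have cases := ord3P r.
  have -> : lift ord0 ord0 = 1 :> 'I_3 by exact: val_inj.
  have -> : lift ord0 (lift ord0 ord0) = 2 :> 'I_3 by exact: val_inj.
  by case: cases => -> /=; rewrite /GRing.scale /= ?mulr1 ?mulr0 ?addr0 ?add0r subrr.
move=> /(eta_ker s Ux); rewrite (linear_BP lin) => /subr0_eq ->.
rewrite !big_ord_recl !big_ord0 !addr0 !(linear_DP lin) !(linear_ZP lin).
by rewrite /eta_coef /z /GRing.scale /= ![eta0 _ _ _ * _]mulrC.
Qed.

Lemma smooth_eta_coef s t : smooth_on U (eta_coef s t).
Proof.
apply: (@smooth_apply R m _ _ U (eta s : tan -> tan -> R^o) oU).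
- by move=> y Uy; exact: eta_linear.
- by move=> w; exact: eta_smooth.
apply: (@smooth_apply R _ _ _ U tproj oU).
- by move=> y Uy; exact: tproj_linear.
- by move=> w; exact: (smooth_tproj H oU phiU sphi snu nu1 nuT pinj w).
exact: (smooth_J H oU phiU sphi t snu).
Qed.

Lemma smooth_eta0 s v : smooth_on U (fun x => eta0 s x v).
Proof.
apply: (smooth_g H oU phiU sphi); first exact: (smooth_J H oU phiU sphi s snu).
exact: (smooth_push sphi).
Qed.

(** The complex structures are parallel, so the normal alone is differentiated: this
    is where the second fundamental form enters. *)
Lemma deta0 s v w x : U x -> 'D_v (fun y => eta0 s y w) x - 'D_w (fun y => eta0 s y v) x =
  g (phi x) (shape x (push x w)) (J s (phi x) (push x v))
  - g (phi x) (shape x (push x v)) (J s (phi x) (push x w)).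
Proof.
move=> Ux; have sJ := smooth_J H oU phiU sphi s snu.
have E v1 w1 : 'D_v1 (fun y => eta0 s y w1) x =
   - g (phi x) (shape x (push x v1)) (J s (phi x) (push x w1))
   + g (phi x) (J s (phi x) (nu x)) (cov v1 (push ^~ w1) x).
  have E1 : 'D_v1 (fun y => eta0 s y w1) x
      = g (phi x) (cov v1 (fun y => J s (phi y) (nu y)) x) (push x w1)
      + g (phi x) (J s (phi x) (nu x)) (cov v1 (push ^~ w1) x).
    exact: (derive_g H oU phiU sphi v1 sJ (smooth_push sphi w1) Ux).
  rewrite (cov_J H oU phiU sphi s v1 snu Ux) in E1.
  rewrite E1 (J_skew H s (shape x (push x v1)) (push x w1) (phiU Ux)) opprK.
  by rewrite (shape_push H phiU sphi nu1 nuT pinj).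
rewrite (E v w) (E w v) (cov_push H oU phiU sphi v w Ux).
generalize (g (phi x) (J s (phi x) (nu x)) (cov w (push ^~ v) x)) => c.
generalize (g (phi x) (shape x (push x v)) (J s (phi x) (push x w))) => d.
by generalize (g (phi x) (shape x (push x w)) (J s (phi x) (push x v))) => e; ring.
Qed.

(** The derivatives of the coefficients are multiplied by values of [eta0] on
    horizontal vectors. *)
Lemma deta_expand s v w x : U x -> tan_hor x v -> tan_hor x w ->
  'D_v (fun y => eta s y w) x - 'D_w (fun y => eta s y v) x =
  \sum_t eta_coef s t x * (g (phi x) (shape x (push x w)) (J t (phi x) (push x v))
    - g (phi x) (shape x (push x v)) (J t (phi x) (push x w))).
Proof.
move=> Ux hv hw.
have E v1 w1 : tan_hor x w1 -> 'D_v1 (fun y => eta s y w1) x =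
    \sum_t eta_coef s t x * 'D_v1 (fun y => eta0 t y w1) x.
  move=> hw1.
  have sc t := smooth_diff (smooth_eta_coef s t) Ux.
  have s0 t := smooth_diff (smooth_eta0 t w1) Ux.
  have E1 : 'D_v1 (fun y => eta s y w1) x =
     'D_v1 (\sum_t (fun y => eta_coef s t y *: eta0 t y w1)) x.
    apply: near_eq_derive; apply: (near_U oU Ux) => y Uy.
    by rewrite fct_sumE eta_expand.
  have E2 := derive_sum (h := fun t y => eta_coef s t y *: eta0 t y w1)
     (fun t => diff_derivable (v := v1) (differentiable_scale (sc t) (s0 t))).
  apply: (etrans E1); apply: (etrans E2); apply: eq_bigr => t _.
  by rewrite (derive_scale v1 (sc t) (s0 t)) (hw1 t) scaler0 add0r.
rewrite (E v w hw) (E w v hv) -sumrB; apply: eq_bigr => t _.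
by rewrite -mulrBr deta0.
Qed.

Section AtPoint.
Variables (x : tan) (Ux : U x) (gg : tan -> tan -> R) (I : 'I_3 -> tan -> tan)
  (bb : 'I_3 -> 'I_3 -> R).
Hypothesis qc : qc_at (tan_hor x) gg I
  (fun s v w => 'D_v (fun y => eta s y w) x - 'D_w (fun y => eta s y v) x).
Hypothesis IJ : forall t v, tan_hor x v ->
  push x (\sum_u bb t u *: I u v) = J t (phi x) (push x v).

Let hortan X : horx x X -> tan_hor x (tproj x X).
Proof.
case=> x0 x1 x2 x3 s; rewrite /eta0 ptj // (bsym_sym (b Ux)).
have := ord3P s.
by case=> ->.
Qed.

Let tan_horP a v w : tan_hor x v -> tan_hor x w -> tan_hor x (a *: v + w).
Proof. by move=> hv hw s; rewrite eta0_linear // hv hw scaler0 addr0. Qed.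
Let tan_horD v w : tan_hor x v -> tan_hor x w -> tan_hor x (v + w).
Proof. by move=> hv hw; have := tan_horP 1 hv hw; rewrite scale1r. Qed.
Let tan_hor0 : tan_hor x 0.
Proof. by move=> s; rewrite (linear_0P (eta0_linear s Ux)). Qed.
Let tan_horZ a v : tan_hor x v -> tan_hor x (a *: v).
Proof. by move=> hv; have := tan_horP a hv tan_hor0; rewrite addr0. Qed.
Let tan_hor_sum (F : 'I_3 -> tan) : (forall u, tan_hor x (F u)) -> tan_hor x (\sum_u F u).
Proof.
by move=> hF; apply: big_ind => // v w hv hw; exact: tan_horD.
Qed.

Let gg0 w : tan_hor x w -> gg 0 w = 0.
Proof.
move=> hw; have := qca_linear qc 1 tan_hor0 tan_hor0 hw.
by rewrite scaler0 addr0; lra.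
Qed.
Let ggZ a v w : tan_hor x v -> tan_hor x w -> gg (a *: v) w = a * gg v w.
Proof.
by move=> hv hw; have := qca_linear qc a hv tan_hor0 hw; rewrite gg0 // !addr0.
Qed.
Let gg_sum (F : 'I_3 -> tan) w : (forall u, tan_hor x (F u)) -> tan_hor x w ->
  gg (\sum_u F u) w = \sum_u gg (F u) w.
Proof.
move=> hF hw; rewrite !big_ord_recl !big_ord0 !addr0.
have hD v1 w1 z1 : tan_hor x v1 -> tan_hor x w1 -> tan_hor x z1 -> gg (v1 + w1) z1 = gg v1 z1 + gg w1 z1.
  by move=> h1 h2 h3; have := qca_linear qc 1 h1 h2 h3; rewrite scale1r mul1r.
rewrite (hD _ _ w (hF _) (tan_horD (hF _) (hF _)) hw).
by rewrite (hD _ _ w (hF _) (hF _) hw).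
Qed.
Let gg_skew s v w : tan_hor x v -> tan_hor x w -> gg (I s v) w = - gg v (I s w).
Proof.
move=> hv hw; have hI := qca_stable qc s.
rewrite -(qca_herm qc s (hI _ hv) hw) (qca_square qc) //.
by rewrite -[- v]scaleN1r (ggZ (-1) hv (hI _ hw)) mulN1r.
Qed.

Let tprojJ t X : horx x X -> tproj x (J t (phi x) X) = \sum_u bb t u *: I u (tproj x X).
Proof.
move=> hX; have [x0 _ _ _] := hX; have hv := hortan hX.
apply: (push_inj sphi pinj Ux); rewrite IJ // !ptj //.
have := ord3P t.
have [h1 h2 h3] := horizontalJ (hh Ux) hX.
by case=> ->; [case: h1|case: h2|case: h3].
Qed.

Let horJ t X : horx x X -> horx x (J t (phi x) X).
Proof.
have := ord3P t.
by case=> -> /(horizontalJ (hh Ux)) [].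
Qed.

Let h (X Y : vec) := g (phi x) (shape x X) Y.
Let g' (X Y : vec) := gg (tproj x X) (tproj x Y).

Let hB : bilinear_sym h.
Proof.
split=> [Z a X Y|X Y]; rewrite /h.
  by rewrite /= (shape_linear H phiU sphi snu Ux) (bsymDl (b Ux)) (bsymZl (b Ux)).
exact: (etrans (shape_sym H oU phiU sphi snu nu1 nuT pinj X Y Ux) (bsym_sym (b Ux) _ _)).
Qed.

Let eqn t X Y : horx x X -> horx x Y -> 2 * g' (J t (phi x) X) Y =
  \sum_s (\sum_u bb t u * eta_coef u s x) * (h Y (J s (phi x) X) - h X (J s (phi x) Y)).
Proof.
move=> hX hY; have hv := hortan hX; have hw := hortan hY.
have hI u := qca_stable qc u hv.
rewrite /g' (tprojJ t hX) (gg_sum (fun u => tan_horZ _ (hI u)) hw).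
rewrite mulr_sumr.
rewrite (eq_bigr (fun u => \sum_s bb t u * eta_coef u s x * (h Y (J s (phi x) X) - h X (J s (phi x) Y)))).
  by rewrite exchange_big; apply: eq_bigr => s _; rewrite mulr_suml.
move=> u _; rewrite (ggZ _ (hI u) hw) mulrCA (qca_deta qc u hv hw) (deta_expand u Ux hv hw) mulr_sumr.
apply: eq_bigr => s _; rewrite mulrA; have [x0 _ _ _] := hX; have [y0 _ _ _] := hY.
by rewrite !ptj.
Qed.

Lemma qc_invariant X : horx x X -> X != 0 ->
  [/\ h X X != 0, h (J 0 (phi x) X) (J 0 (phi x) X) = h X X,
    h (J 1 (phi x) X) (J 1 (phi x) X) = h X X & h (J 2 (phi x) X) (J 2 (phi x) X) = h X X].
Proof.
pose al t s := \sum_u bb t u * eta_coef u s x.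
have eqn3 t A B : horx x A -> horx x B -> 2 * g' (J t (phi x) A) B =
   al t 0 * (h B (J 0 (phi x) A) - h A (J 0 (phi x) B))
   + al t 1 * (h B (J 1 (phi x) A) - h A (J 1 (phi x) B))
   + al t 2 * (h B (J 2 (phi x) A) - h A (J 2 (phi x) B)).
  move=> hA hB'; transitivity (\sum_s al t s * (h B (J s (phi x) A) - h A (J s (phi x) B))).
    exact: eqn.
  rewrite !big_ord_recl big_ord0 addr0 addrA.
  have -> : lift ord0 ord0 = 1 :> 'I_3 by exact: val_inj.
  by have -> : lift ord0 (lift ord0 ord0) = 2 :> 'I_3 by exact: val_inj.
apply: (second_form_invariant (g := g') (hyp_quat (hh Ux)) hB
  (a11 := al 0 0) (a12 := al 0 1) (a13 := al 0 2) (a21 := al 1 0) (a22 := al 1 1) (a23 := al 1 2)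
  (a31 := al 2 0) (a32 := al 2 1) (a33 := al 2 2)).
- by move=> A hA; split; [exact: (horizontalN (hh Ux))|exact: horJ|exact: horJ|exact: horJ].
- by move=> A B hA hB'; apply: (qca_sym qc); exact: hortan.
- move=> A B hA hB'; rewrite /g' (linear_NP (tproj_linear phi nu x)).
  by rewrite -[- tproj x A]scaleN1r (ggZ (-1) (hortan hA) (hortan hB')) mulN1r.
- have sk t A B : horx x A -> horx x B -> g' (J t (phi x) A) B = - g' A (J t (phi x) B).
    move=> hA hB'; have hv := hortan hA; have hw := hortan hB'.
    have hIA u := tan_horZ (bb t u) (qca_stable qc u hv).
    have hIB u := tan_horZ (bb t u) (qca_stable qc u hw).
    rewrite /g' (tprojJ t hA) (tprojJ t hB') (gg_sum hIA hw).
    rewrite (qca_sym qc hv (tan_hor_sum hIB)) (gg_sum hIB hv).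
    rewrite -sumrN; apply: eq_bigr => u _.
    have hIv := qca_stable qc u hv; have hIw := qca_stable qc u hw.
    by rewrite (ggZ _ hIv hw) (ggZ _ hIw hv) (gg_skew u hv hw) (qca_sym qc hv hIw) mulrN.
  by move=> A B hA hB'; split; exact: sk.
- move=> A hA A0; apply: (qca_pos qc); first exact: hortan.
  by apply: contra_neq A0 => A0; have [a0 _ _ _] := hA; rewrite -(ptj Ux a0) A0
    (linear_0P (push_linear sphi Ux)).
- by move=> A B hA hB'; split; exact: eqn3.
Qed.

(** Commutation against horizontal vectors is the invariance of the second
    fundamental form on the horizontal space, obtained from [qc_invariant] by
    polarisation. *)
Lemma qc_shape : [/\ forall X Y, horx x X -> horx x Y ->
    [/\ Fx x 0 X Y = 0, Fx x 1 X Y = 0 & Fx x 2 X Y = 0]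
  & forall X, horx x X -> X != 0 -> g (phi x) X (Lop x X) != 0].
Proof.
have Lh X Y : horx x X -> horx x Y -> g (phi x) (Lop x X) Y = h X Y.
  case=> x0 _ _ _ [y0 _ _ _]; have bx := b Ux.
  have nx : g (phi x) (nu x) X = 0 by rewrite (bsym_sym bx).
  have ny : g (phi x) (nu x) Y = 0 by rewrite (bsym_sym bx).
  rewrite -[Lop x X]/(shape x X + g (phi x) (normal_image Ga J phi nu x) X *: nu x
    + g (phi x) (nu x) X *: (normal_image Ga J phi nu x - g (phi x) (normal_image Ga J phi nu x) (nu x) *: nu x)).
  rewrite nx scale0r addr0 /h; generalize (shape x X) (normal_image Ga J phi nu x) => S r.
  by rewrite (bsymDl bx) (bsymZl bx) ny mulr0 addr0.
have inv s X Y : horx x X -> horx x Y -> h (J s (phi x) X) (J s (phi x) Y) = h X Y.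
  move=> hX hY; symmetry.
  have hJB : bilinear_sym (fun A B => h (J s (phi x) A) (J s (phi x) B)).
    split=> [Z a A B|A B]; last exact: (bsym_sym hB).
    by rewrite /= (J_linear H s (phiU Ux)) (bsymDl hB) (bsymZl hB).
  apply: (polarize hB hJB (P := fun A => horx x A)) => //.
    move=> A B [a0 a1 a2 a3] [b0 b1 b2 b3].
    by split; rewrite (bsymDl (b Ux)) ?a0 ?a1 ?a2 ?a3 ?b0 ?b1 ?b2 ?b3 addr0.
  move=> A hA; have [->|A0] := eqVneq A 0.
    by rewrite (linear_0P (J_linear H s (phiU Ux))).
  have [_ e0 e1 e2] := qc_invariant hA A0.
  have := ord3P s.
  by case=> ->.
have sq s A : J s (phi x) (J s (phi x) A) = - A.
  have q := hyp_quat (hh Ux).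
  have := ord3P s.
  by case=> ->; [exact: (quat11 q _)|exact: (quat22 q _)|exact: (quat33 q _)].
have F s X Y : horx x X -> horx x Y -> Fx x s X Y = 0.
  move=> hX hY; rewrite /commdef (Lh _ _ hX (horJ s hY)) (Lh _ _ (horJ s hX) hY).
  by rewrite -(inv s X) // ?sq ?(bsymNr hB) ?addNr //; exact: horJ.
split; first by move=> X Y hX hY; split; exact: F.
move=> X hX X0; rewrite (bsym_sym (b Ux)) Lh //.
by have [] := qc_invariant hX X0.
Qed.
End AtPoint.
End QCHypersurface.

(** * Changes of chart *)

Section Charts.
Variables (R : realType) (d : nat) (T : topologicalType) (A : manifold R d T).
Local Notation vec := 'rV[R]_d.
Implicit Types (p q r : T) (x y v w : vec).

Definition chart_image p : set vec := chart A p @` dom A p.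
Definition trans p q : vec -> vec := chart A q \o param A p.

Lemma image_chart p q : dom A p q -> chart_image p (chart A p q).
Proof. by exists q. Qed.

Lemma param_dom p x : chart_image p x -> dom A p (param A p x).
Proof. by case=> q dq <-; rewrite chartK. Qed.

Lemma paramK p x : chart_image p x -> chart A p (param A p x) = x.
Proof. by case=> q dq <-; rewrite chartK. Qed.

Definition overlap p q : set vec := chart A p @` (dom A p `&` dom A q).

Lemma overlapP p q x : overlap p q x <-> chart_image p x /\ dom A q (param A p x).
Proof.
split=> [[r [dp dq] <-]|[Ix dq]]; first by rewrite chartK //; split=> //; exists r.
by exists (param A p x); [split=> //; exact: param_dom|exact: paramK].
Qed.

Lemma overlap_sub p q : overlap p q `<=` chart_image p.
Proof. by move=> x /overlapP[]. Qed.

Lemma open_pullback p (Q : set T) : open Q -> open [set x | chart_image p x /\ Q (param A p x)].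
Proof.
move=> oQ; rewrite openE => x [Ix Qx].
have nI : \forall y \near x, chart_image p y := open_nbhs_nbhs (conj (@image_open _ _ _ A p) Ix).
have nQ : \forall y \near x, Q (param A p y).
  have c := @param_continuous _ _ _ A p x Ix.
  exact: (c Q (open_nbhs_nbhs (conj oQ Qx))).
by near=> y; split; near: y.
Unshelve. all: by end_near. Qed.

Lemma open_overlap p q : open (overlap p q).
Proof.
have -> : overlap p q = [set x | chart_image p x /\ dom A q (param A p x)].
  by apply/seteqP; split=> x /overlapP.
exact: open_pullback (dom_open A q).
Qed.

Lemma trans_smooth p q : smooth_on (overlap p q) (trans p q).
Proof. exact: transition_smooth. Qed.

Lemma param_trans p q x : overlap p q x -> param A q (trans p q x) = param A p x.
Proof. by move=> /overlapP[Ix dq]; rewrite /trans /= chartK. Qed.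

Lemma overlap_at p q r : dom A p r -> dom A q r -> overlap p q (chart A p r).
Proof. by move=> dp dq; apply/overlapP; rewrite chartK //; split=> //; exact: image_chart. Qed.

Lemma trans_at p q r : dom A p r -> trans p q (chart A p r) = chart A q r.
Proof. by move=> dp; rewrite /trans /= chartK. Qed.

Lemma trans_diff p q x : overlap p q x -> differentiable (trans p q) x.
Proof. exact: smooth_diff (@trans_smooth p q). Qed.

Lemma tchangeE p q r v : dom A p r -> dom A q r ->
  tchange A p q r v = 'D_v (trans p q) (chart A p r).
Proof. by move=> dp dq; rewrite /tchange deriveE //; exact/trans_diff/overlap_at. Qed.

Lemma tchange_linear p q r : linear (tchange A p q r).
Proof. by move=> a v w; rewrite /tchange linearP. Qed.

Lemma tchange_id p r v : dom A p r -> tchange A p p r v = v.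
Proof.
move=> dp; rewrite tchangeE //.
have -> : 'D_v (trans p p) (chart A p r) = 'D_v (id : vec -> vec) (chart A p r).
  apply: near_eq_derive.
  have := open_nbhs_nbhs (conj (@image_open _ _ _ A p) (image_chart dp)).
  by apply: filterS => y Iy; exact: paramK.
exact: derive_id.
Qed.

Lemma tchange_comp p q s r v : dom A p r -> dom A q r -> dom A s r ->
  tchange A q s r (tchange A p q r v) = tchange A p s r v.
Proof.
move=> dp dq ds.
have E : 'D_v (trans p s) (chart A p r) = 'D_v (trans q s \o trans p q) (chart A p r).
  apply: near_eq_derive.
  have := open_nbhs_nbhs (conj (@open_overlap p q) (overlap_at dp dq)).
  apply: filterS => y oy; rewrite /trans /=.
  by move: (param_trans oy); rewrite /trans /= => ->.
have d1 := trans_diff (overlap_at dp dq).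
have d2 : differentiable (trans q s) (trans p q (chart A p r)).
  by rewrite trans_at //; exact/trans_diff/overlap_at.
rewrite (tchangeE v dp ds) E (derive_comp v d1 d2) -(deriveE _ d2) (trans_at q dp).
by rewrite (tchangeE _ dq ds) (tchangeE _ dp dq).
Qed.

Lemma tchangeK p q r : dom A p r -> dom A q r -> cancel (tchange A p q r) (tchange A q p r).
Proof. by move=> dp dq v; rewrite tchange_comp // tchange_id. Qed.

Lemma field_rep_extend p v x : chart_image p x -> field_rep A p (extend A p v) x = v.
Proof.
move=> Ix; rewrite /field_rep /extend; have dp := param_dom Ix.
have ds := dom_self A (param A p x).
by rewrite tchange_comp // tchange_id.
Qed.

Lemma extend_rep p X x : chart_image p x -> X (param A p x) = extend A p (field_rep A p X x) (param A p x).
Proof.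
move=> Ix; rewrite /extend /field_rep tchangeK //; [exact: dom_self|exact: param_dom].
Qed.

Lemma smooth_near_ext (W : normedModType R) x (f h : vec -> W) :
  (\forall y \near x, f y = h y) -> smooth_near x f -> smooth_near x h.
Proof.
move=> fh [S [oS Sx sf]].
have : nbhs x [set y | f y = h y] by exact: fh.
rewrite nbhsE => -[Q [oQ Qx] sQ].
exists (Q `&` S); split; [exact: openI|by []|].
apply: (smooth_ext (openI oQ oS) (f := f)); first by move=> y [/sQ].
by apply: smooth_sub sf => y [].
Qed.

Lemma smooth_near_comp m (W : normedModType R) (f : vec -> W) (h : 'rV[R]_m -> vec) (x : 'rV[R]_m) :
  smooth_near (h x) f -> smooth_near x h -> smooth_near x (f \o h).
Proof.
move=> [S [oS Sx sf]] [Q [oQ Qx sh]].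
have oQS : open (Q `&` h @^-1` S).
  rewrite openE => y [Qy Sy].
  have ch : {for y, continuous h} by exact: differentiable_continuous (smooth_diff sh Qy).
  have n1 : \forall z \near y, Q z := open_nbhs_nbhs (conj oQ Qy).
  have n2 : \forall z \near y, S (h z) := ch S (open_nbhs_nbhs (conj oS Sy)).
  by near=> z; split; near: z.
exists (Q `&` h @^-1` S); split=> //.
apply: (smooth_comp (O := S) oQS) => //; first by move=> y [].
by apply: smooth_sub sh => y [].
Unshelve. all: by end_near. Qed.

(** Smoothness near [q] may be checked in the chart at any [p] that contains [q]. *)
Lemma smooth_field_move p q X : dom A p q -> smooth_near (chart A p q) (field_rep A p X) ->
  smooth_field_at A q X.
Proof.
move=> dq [S [oS Sq sX]]; have dqq := dom_self A q.
have ot := overlap_at dq dqq; have ot' := overlap_at dqq dq.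
have oo := @open_overlap p q; have oSo := openI oS oo.
(* in the chart at p, the components of X in the chart at q *)
pose F y := 'D_(field_rep A p X y) (trans p q) y.
have sF : smooth_on (S `&` overlap p q) F.
  have st : smooth_on (S `&` overlap p q) (trans p q).
    by apply: smooth_sub (@trans_smooth p q) => y [].
  apply: (@smooth_apply R d _ _ (S `&` overlap p q) (fun y v => 'D_v (trans p q) y) oSo).
  - move=> y [_ oy] a v w; have dt := trans_diff oy.
    by rewrite !deriveE // linearP.
  - by move=> w; exact: smooth_derive.
  - by apply: smooth_sub sX => y [].
have : smooth_near (chart A q q) (F \o trans q p).
  apply: smooth_near_comp; first by exists (S `&` overlap p q); rewrite trans_at.
  by exists (overlap q p); split; [exact: (@open_overlap q p)|exact: ot'|exact: trans_smooth].
apply: smooth_near_ext; have := open_nbhs_nbhs (conj (@open_overlap q p) ot').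
apply: filterS => y oy; rewrite /F /=; have dy := overlapP.
have [Iy dp] := (overlapP q p y).1 oy; have dqy := param_dom Iy.
rewrite /field_rep (param_trans oy).
set r := param A q y; have dr := dom_self A r.
have -> : trans q p y = chart A p r by rewrite /trans.
by rewrite -tchangeE // tchange_comp.
Qed.

Lemma smooth_fun_move p q (f : T -> R) : dom A p q ->
  smooth_near (chart A p q) (f \o param A p) -> smooth_fun_at A q f.
Proof.
move=> dq sf; have dqq := dom_self A q.
have ot' := overlap_at dqq dq.
have : smooth_near (chart A q q) ((f \o param A p) \o trans q p).
  apply: smooth_near_comp; first by rewrite trans_at.
  by exists (overlap q p); split; [exact: (@open_overlap q p)|exact: ot'|exact: trans_smooth].
apply: smooth_near_ext; have := open_nbhs_nbhs (conj (@open_overlap q p) ot').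
by apply: filterS => y oy; rewrite /= (param_trans oy).
Qed.

Lemma vderiv_move p q v (f : T -> R) : dom A p q ->
  smooth_near (chart A p q) (f \o param A p) ->
  vderiv A q v f = 'D_(tchange A q p q v) (f \o param A p) (chart A p q).
Proof.
move=> dq sf; have dqq := dom_self A q; have ot' := overlap_at dqq dq.
have df : differentiable (f \o param A p) (chart A p q).
  by have [S [_ Sq s]] := sf; exact: smooth_diff s Sq.
have dt := trans_diff ot'.
rewrite /vderiv.
have -> : 'D_v (f \o param A q) (chart A q q) = 'D_v ((f \o param A p) \o trans q p) (chart A q q).
  apply: near_eq_derive; have := open_nbhs_nbhs (conj (@open_overlap q p) ot').
  by apply: filterS => y oy; rewrite /= (param_trans oy).
have df' : differentiable (f \o param A p) (trans q p (chart A q q)) by rewrite trans_at.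
rewrite (derive_comp v dt df') -(deriveE _ df') (trans_at p dqq).
by rewrite (tchangeE v dqq dq).
Qed.

Lemma smooth_extend p q v : dom A p q -> smooth_field_at A q (extend A p v).
Proof.
move=> dq; apply: (smooth_field_move dq).
exists (chart_image p); split; [exact: image_open|exact: image_chart|].
by apply: (smooth_ext (@image_open _ _ _ A p) _ (@smooth_cst R _ vec _ v)) => y Iy; rewrite field_rep_extend.
Qed.

(** Coordinate fields of one chart commute, by the symmetry of the second
    derivatives of the transition map. *)
Lemma bracket_extend p q v w : dom A p q ->
  bracket A (extend A p v) (extend A p w) q = 0.
Proof.
move=> dq; have dqq := dom_self A q; have ot := overlap_at dq dqq; have ot' := overlap_at dqq dq.
have rep u : \forall y \near chart A q q,
    field_rep A q (extend A p u) y = ('D_u (trans p q) \o trans q p) y.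
  have := open_nbhs_nbhs (conj (@open_overlap q p) ot').
  apply: filterS => y oy; have [Iy dp] := (overlapP q p y).1 oy; have dqy := param_dom Iy.
  rewrite /field_rep /extend tchange_comp //; last exact: dom_self.
  by rewrite tchangeE // /trans.
have dtr := trans_diff ot'.
have d2 u : differentiable ('D_u (trans p q)) (chart A p q).
  exact: smooth_diff (smooth_derive u (@trans_smooth p q)) ot.
have main u1 u2 : 'D_(extend A p u1 q) (field_rep A q (extend A p u2)) (chart A q q)
    = 'D_u1 ('D_u2 (trans p q)) (chart A p q).
  rewrite (near_eq_derive _ (rep u2)).
  have d2' : differentiable ('D_u2 (trans p q)) (trans q p (chart A q q)) by rewrite trans_at.
  rewrite (derive_comp (extend A p u1 q) dtr d2') -(deriveE _ d2') (trans_at p dqq).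
  by rewrite -(tchangeE (extend A p u1 q) dqq dq) /extend tchangeK.
rewrite /bracket (main v w) (main w v).
have := smooth_derive_sym w v (@open_overlap p q) (@trans_smooth p q) ot.
by gen_derive => ->; rewrite subrr.
Qed.

End Charts.

(** * The Levi-Civita connection in a chart *)

Section Connection.
Variables (R : realType) (d : nat) (T : topologicalType) (A : manifold R d T).
Local Notation vec := 'rV[R]_d.
Variables (G : T -> vec -> vec -> R) (D : T -> vec -> (T -> vec) -> vec).
Hypothesis LC : levi_civita A G D.
Implicit Types (p q : T) (v w u : vec) (Y Z : T -> vec).

Lemma smooth_near_add (W : normedModType R) (x : vec) (f h : vec -> W) :
  smooth_near x f -> smooth_near x h -> smooth_near x (fun y => f y + h y).
Proof.
move=> [S [oS Sx sf]] [Q [oQ Qx sh]]; have o := openI oS oQ.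
exists (S `&` Q); split=> //; apply: smooth_add => //.
  by apply: smooth_sub sf => y [].
by apply: smooth_sub sh => y [].
Qed.

Lemma smooth_near_scale (W : normedModType R) (x : vec) (f : vec -> R) (h : vec -> W) :
  smooth_near x f -> smooth_near x h -> smooth_near x (fun y => f y *: h y).
Proof.
move=> [S [oS Sx sf]] [Q [oQ Qx sh]]; have o := openI oS oQ.
exists (S `&` Q); split=> //; apply: smooth_scale => //.
  by apply: smooth_sub sf => y [].
by apply: smooth_sub sh => y [].
Qed.

Lemma field_rep_add p Y Z x :
  field_rep A p (fun q => Y q + Z q) x = field_rep A p Y x + field_rep A p Z x.
Proof. exact: (linear_DP (tchange_linear A _ _ _)). Qed.

Lemma field_rep_scale p (f : T -> R) Y x :
  field_rep A p (fun q => f q *: Y q) x = f (param A p x) *: field_rep A p Y x.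
Proof. exact: (linear_ZP (tchange_linear A _ _ _)). Qed.

Lemma smooth_field_add p Y Z : smooth_field_at A p Y -> smooth_field_at A p Z ->
  smooth_field_at A p (fun q => Y q + Z q).
Proof.
move=> sY sZ; apply: smooth_near_ext (smooth_near_add sY sZ).
by near=> x; rewrite field_rep_add.
Unshelve. all: by end_near. Qed.

Lemma smooth_field_scale p (f : T -> R) Y : smooth_fun_at A p f -> smooth_field_at A p Y ->
  smooth_field_at A p (fun q => f q *: Y q).
Proof.
move=> sf sY; apply: smooth_near_ext (smooth_near_scale sf sY).
by near=> x; rewrite field_rep_scale.
Unshelve. all: by end_near. Qed.

Lemma smooth_field0 p : smooth_field_at A p (fun _ => 0).
Proof.
exists setT; split=> //; first exact: openT.
apply: (smooth_ext openT _ (@smooth_cst R _ vec setT 0)) => y _.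
exact/esym/(linear_0P (tchange_linear A _ _ _)).
Qed.

Lemma smooth_field_sum p (I : Type) (r : seq I) (Y : I -> T -> vec) :
  (forall i, smooth_field_at A p (Y i)) ->
  smooth_field_at A p (fun q => \sum_(i <- r) Y i q).
Proof.
move=> sY; elim: r => [|i r IH].
  have -> : (fun q => \sum_(i <- [::]) Y i q) = fun _ => 0 by apply/funext => q; rewrite big_nil.
  exact: smooth_field0.
have -> : (fun q => \sum_(j <- i :: r) Y j q) = fun q => Y i q + \sum_(j <- r) Y j q.
  by apply/funext => q; rewrite big_cons.
exact: smooth_field_add.
Qed.

Lemma near_param p q (P : T -> Prop) : dom A p q -> (\forall r \near q, P r) ->
  \forall x \near chart A p q, P (param A p x).
Proof.
move=> dq nP; have := @param_continuous _ _ _ A p _ (image_chart dq).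
by move=> /(_ P); apply; rewrite chartK.
Qed.

Lemma near_dom p q : dom A p q -> \forall r \near q, dom A p r.
Proof. by move=> dq; exact: open_nbhs_nbhs (conj (dom_open A p) dq). Qed.

Lemma smooth_field_near p Y Z : (\forall q \near p, Y q = Z q) ->
  smooth_field_at A p Y -> smooth_field_at A p Z.
Proof.
move=> YZ; apply: smooth_near_ext; apply: filterS (near_param (dom_self A p) YZ) => x E.
by rewrite /field_rep E.
Qed.

Lemma vderiv_near_cst p v (f : T -> R) c : (\forall q \near p, f q = c) -> vderiv A p v f = 0.
Proof.
move=> fc; have n := near_param (dom_self A p) fc.
have E := @near_eq_derive _ _ _ (f \o param A p) (cst c) _ v n.
exact: (etrans E (derive_cst _ _ _)).
Qed.

Lemma smooth_fun_near_cst p (f : T -> R) c : (\forall q \near p, f q = c) -> smooth_fun_at A p f.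
Proof.
move=> fc; have n := near_param (dom_self A p) fc.
apply: (@smooth_near_ext _ _ _ (chart A p p) (cst c)).
  by apply: filterS n => x /= ->.
by exists setT; split=> //; [exact: openT|exact: smooth_cst].
Qed.

(** Leibniz' rule for the indicator function of the set where the two fields differ,
    which vanishes near [p]. *)
Lemma conn_local p v Y Z : smooth_field_at A p Y -> (\forall q \near p, Y q = Z q) ->
  D p v Y = D p v Z.
Proof.
move=> sY YZ; have sZ := smooth_field_near YZ sY.
pose f q : R := (Y q != Z q)%:R.
have f0 : \forall q \near p, f q = 0 by apply: filterS YZ => q /= E; rewrite /f E eqxx.
have sf := smooth_fun_near_cst f0.
have sN : smooth_field_at A p (fun q => (-1 : R) *: Z q).
  apply: (@smooth_field_scale p (fun=> -1 : R)) => //.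
  by apply: (smooth_fun_near_cst (c := -1)); near=> q.
have sYZ := smooth_field_add sY sN.
have -> : Y = fun q => Z q + f q *: (Y q + (-1 : R) *: Z q).
  apply/funext => q; rewrite /f scaleN1r.
  by case: eqP => [->|_]; rewrite ?scale0r ?addr0 // scale1r addrC subrK.
rewrite (conn_add LC) //; last exact: smooth_field_scale.
rewrite (conn_leibniz LC) // (vderiv_near_cst v f0) (nbhs_singleton f0).
by rewrite !scale0r !addr0.
Unshelve. all: by end_near. Qed.

Lemma conn_scale p v (c : R) Y : smooth_field_at A p Y -> D p v (fun q => c *: Y q) = c *: D p v Y.
Proof.
move=> sY; have fc : \forall q \near p, (fun=> c : R) q = c by near=> q.
rewrite (@conn_leibniz _ _ _ _ _ _ LC p v (fun=> c)) //; last exact: smooth_fun_near_cst fc.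
by rewrite (vderiv_near_cst v fc) scale0r add0r.
Unshelve. all: by end_near. Qed.

Lemma conn_sum p v (I : Type) (r : seq I) (Y : I -> T -> vec) :
  (forall i, smooth_field_at A p (Y i)) ->
  D p v (fun q => \sum_(i <- r) Y i q) = \sum_(i <- r) D p v (Y i).
Proof.
move=> sY; elim: r => [|i r IH].
  have -> : (fun q => \sum_(i <- [::]) Y i q) = fun _ => 0 *: 0.
    by apply/funext => q; rewrite big_nil scale0r.
  by rewrite (conn_scale _ _ (smooth_field0 p)) scale0r big_nil.
have -> : (fun q => \sum_(j <- i :: r) Y j q) = fun q => Y i q + \sum_(j <- r) Y j q.
  by apply/funext => q; rewrite big_cons.
by rewrite (conn_add LC) // ?IH ?big_cons //; exact: smooth_field_sum.
Qed.

Lemma extend_linear p q : linear (extend A p ^~ q).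
Proof. exact: tchange_linear. Qed.

Lemma conn_extend_linear p q w : dom A p q -> linear (fun u => D q w (extend A p u)).
Proof.
move=> dq a u v.
have -> : extend A p (a *: u + v) = fun r => a *: extend A p u r + extend A p v r.
  by apply/funext => r; rewrite extend_linear.
have su := smooth_extend u dq; have sv := smooth_extend v dq.
rewrite (conn_add LC) ?conn_scale //; apply: smooth_field_scale => //.
by apply: (smooth_fun_near_cst (c := a)); near=> r.
Unshelve. all: by end_near. Qed.

(** Expand [Y] in the coordinate fields of the chart at [p] and use Leibniz' rule. *)
Lemma conn_chart p q w Y : dom A p q -> smooth_near (chart A p q) (field_rep A p Y) ->
  tchange A q p q (D q w Y) = 'D_(tchange A q p q w) (field_rep A p Y) (chart A p q)
    + tchange A q p q (D q w (extend A p (field_rep A p Y (chart A p q)))).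
Proof.
move=> dq sy; set y := field_rep A p Y; have dqq := dom_self A q.
pose e i : vec := delta_mx 0 i.
pose f i r : R := y (chart A p r) 0 i.
have se i : smooth_field_at A q (extend A p (e i)) by exact: smooth_extend.
have nf i : \forall x \near chart A p q, y x 0 i = (f i \o param A p) x.
  have := open_nbhs_nbhs (conj (@image_open _ _ _ A p) (image_chart dq)).
  by apply: filterS => x Ix; rewrite /f /= paramK.
have syi i : smooth_near (chart A p q) (fun x => y x 0 i).
  by have [S [oS Sx sS]] := sy; exists S; split=> //; exact: smooth_coord.
have dy : differentiable y (chart A p q) by have [S [oS Sx sS]] := sy; exact: smooth_diff sS Sx.
have sfp i : smooth_near (chart A p q) (f i \o param A p) := smooth_near_ext (nf i) (syi i).
have sf i : smooth_fun_at A q (f i) := smooth_fun_move dq (sfp i).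
have sfe i := smooth_field_scale (sf i) (se i).
have sYq := smooth_field_move dq sy.
have E : \forall r \near q, Y r = \sum_i f i r *: extend A p (e i) r.
  apply: filterS (near_dom dq) => r dr.
  rewrite -[in LHS](chartK dr) (extend_rep Y (image_chart dr)) chartK // -/y.
  by rewrite (linear_rowE _ (extend_linear p r)).
rewrite (conn_local w sYq E) (conn_sum _ _ sfe).
have term i : D q w (fun r => f i r *: extend A p (e i) r)
   = ('D_(tchange A q p q w) y (chart A p q)) 0 i *: extend A p (e i) q
     + y (chart A p q) 0 i *: D q w (extend A p (e i)).
  rewrite (conn_leibniz LC) // (vderiv_move w dq (sfp i)); congr (_ *: _ + _).
  rewrite -(derive_coord _ _ dy); apply/esym.
  exact: near_eq_derive (nf i).
rewrite (eq_bigr _ (fun i _ => term i)) big_split /=.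
rewrite -(linear_rowE _ (extend_linear p q)).
rewrite -(linear_rowE (y (chart A p q)) (conn_extend_linear w dq)).
by rewrite (linear_DP (tchange_linear A q p q)) /extend tchangeK.
Qed.

End Connection.

(** * A hyper-Kaehler manifold in a chart *)

(** The remaining products follow by associativity. *)
Lemma quaternionic_mk (R : realFieldType) (V : lmodType R) (J1 J2 J3 : V -> V) :
  linear J1 -> linear J2 -> (forall X, J1 (J1 X) = - X) -> (forall X, J2 (J2 X) = - X) ->
  (forall X, J3 (J3 X) = - X) -> (forall X, J1 (J2 X) = J3 X) -> (forall X, J2 (J1 X) = - J3 X) ->
  quaternionic J1 J2 J3.
Proof.
move=> l1 l2 e11 e22 e33 e12 e21.
have e13 X : J1 (J3 X) = - J2 X by rewrite -e12 e11.
have e32 X : J3 (J2 X) = - J1 X by rewrite -e12 e22 (linear_NP l1).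
split=> // X.
- have := e21 (J2 X); rewrite e12 e32 opprK; exact.
- by rewrite -e12 e21 (linear_NP l1) e13 opprK.
Qed.

Section KahlerChart.
Variables (R : realType) (d : nat) (T : topologicalType) (B : manifold R d T).
Local Notation vec := 'rV[R]_d.
Variables (G : T -> vec -> vec -> R) (D : T -> vec -> (T -> vec) -> vec).
Variable (J : 'I_3 -> T -> {linear vec -> vec}).
Hypothesis hk : hyperkahler B G D J.
Variable k0 : T.
Implicit Types (q : T) (x v w u : vec).

Let LC := hk_levi_civita hk.
Local Notation pt := (param B k0).
Local Notation down q := (tchange B q k0 q).
Local Notation up q := (tchange B k0 q q).

Definition chart_metric x v w : R := G (pt x) (extend B k0 v (pt x)) (extend B k0 w (pt x)).
Definition christoffel x v w : vec := field_rep B k0 (fun q => D q (extend B k0 v q) (extend B k0 w)) x.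
Definition chart_J s x w : vec := field_rep B k0 (fun q => J s q (extend B k0 w q)) x.

Lemma smooth_near_fin (W : normedModType R) (I : finType) x (f : I -> vec -> W) :
  (forall i, smooth_near x (f i)) ->
  \forall y \near x, exists S, [/\ open S, S y & forall i, smooth_on S (f i)].
Proof.
move=> sf; have [S HS] := choice sf.
have : nbhs x [set y | forall i, S i y].
  apply: (@filter_forall _ I (fun i y => S i y) (nbhs x)) => i.
  by have [oS Sx _] := HS i; exact: open_nbhs_nbhs.
rewrite nbhsE => -[Q [oQ Qx] sQ].
have := open_nbhs_nbhs (conj oQ Qx); apply: filterS => y Qy.
exists Q; split=> // i; have [_ _] := HS i.
by apply: smooth_sub => z /sQ.
Qed.

Lemma christoffel_linear1 x w : chart_image B k0 x -> linear (christoffel x ^~ w).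
Proof.
move=> Ix a u v; have dq := param_dom Ix; have se := smooth_extend w dq.
rewrite /christoffel /field_rep extend_linear (conn_linear LC se).
exact: tchange_linear.
Qed.

Lemma christoffel_linear2 x w : chart_image B k0 x -> linear (christoffel x w).
Proof.
move=> Ix a u v; have dq := param_dom Ix.
rewrite /christoffel /field_rep (conn_extend_linear LC _ dq).
exact: tchange_linear.
Qed.

Lemma chart_metric_linear1 x w : linear (chart_metric x ^~ w : vec -> R^o).
Proof.
by move=> a u v; rewrite /chart_metric extend_linear (metric_linear (hk_metric hk)).
Qed.

Lemma chart_metric_sym x v w : chart_metric x v w = chart_metric x w v.
Proof. exact: metric_sym (hk_metric hk) _ _ _. Qed.

Lemma chart_metric_linear2 x w : linear (chart_metric x w : vec -> R^o).
Proof. by move=> a u v; rewrite !(chart_metric_sym x w); exact: chart_metric_linear1. Qed.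

Lemma chart_J_linear s x : linear (chart_J s x).
Proof.
by move=> a u v; rewrite /chart_J /field_rep extend_linear linearP; exact: tchange_linear.
Qed.

Lemma smooth_chart_metric0 v w : smooth_near (chart B k0 k0) (fun x => chart_metric x v w).
Proof.
by apply: (metric_smooth (hk_metric hk)); apply: smooth_extend; exact: dom_self.
Qed.

Lemma smooth_christoffel0 v w : smooth_near (chart B k0 k0) (fun x => christoffel x v w).
Proof.
by apply: (conn_smooth LC); apply: smooth_extend; exact: dom_self.
Qed.

Lemma smooth_chart_J0 s w : smooth_near (chart B k0 k0) (fun x => chart_J s x w).
Proof. by apply: (hk_smooth hk); apply: smooth_extend; exact: dom_self. Qed.

Lemma smooth_linear1 (W : normedModType R) (S : set vec) (F : vec -> vec -> W) : open S ->
  (forall x, S x -> linear (F x)) -> (forall i, smooth_on S (F ^~ (delta_mx 0 i))) ->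
  forall v, smooth_on S (F ^~ v).
Proof.
move=> oS lF sF v.
have h : smooth_on S (fun x => \sum_i v 0 i *: F x (delta_mx 0 i)).
  by apply: smooth_sum => // i; apply: smooth_scale => //; exact: smooth_cst.
by apply: smooth_ext h => // x Sx; rewrite -linear_rowE //; exact: lF.
Qed.

Lemma smooth_chart_data : exists S : set vec, [/\ open S, S (chart B k0 k0),
  S `<=` chart_image B k0 & [/\ forall v w, smooth_on S (fun x => chart_metric x v w),
    forall v w, smooth_on S (fun x => christoffel x v w)
  & forall s w, smooth_on S (fun x => chart_J s x w)]].
Proof.
have x0 : chart_image B k0 (chart B k0 k0) by exact/image_chart/dom_self.
pose e (i : 'I_d) : vec := delta_mx 0 i.
have [Q1 [oQ1 Qx1 s1]] := nbhs_singleton (smooth_near_fin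
  (fun ij : 'I_d * 'I_d => smooth_chart_metric0 (e ij.1) (e ij.2))).
have [Q2 [oQ2 Qx2 s2]] := nbhs_singleton (smooth_near_fin
  (fun ij : 'I_d * 'I_d => smooth_christoffel0 (e ij.1) (e ij.2))).
have [Q3 [oQ3 Qx3 s3]] := nbhs_singleton (smooth_near_fin
  (fun si : 'I_3 * 'I_d => smooth_chart_J0 si.1 (e si.2))).
pose S := chart_image B k0 `&` (Q1 `&` (Q2 `&` Q3)).
have oS : open S.
  by apply: openI; [exact: image_open|apply: openI => //; exact: openI].
exists S; split=> //; first by move=> y [].
split.
- move=> v w; apply: (smooth_linear1 (W := R^o) (F := fun x => chart_metric x ^~ w) oS).
    by move=> x _; exact: chart_metric_linear1.
  move=> i; apply: (smooth_linear1 (W := R^o) (F := fun x => chart_metric x (delta_mx 0 i)) oS).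
    by move=> x _; exact: chart_metric_linear2.
  by move=> j; apply: smooth_sub (s1 (i, j)) => y [_ [? []]].
- move=> v w; apply: (smooth_linear1 (F := fun x => christoffel x ^~ w) oS).
    by move=> x [Ix _]; exact: christoffel_linear1.
  move=> i; apply: (smooth_linear1 (F := fun x => christoffel x (delta_mx 0 i)) oS).
    by move=> x [Ix _]; exact: christoffel_linear2.
  by move=> j; apply: smooth_sub (s2 (i, j)) => y [_ [? []]].
- move=> s w; apply: (smooth_linear1 (F := fun x => chart_J s x) oS).
    by move=> x _; exact: chart_J_linear.
  by move=> i; apply: smooth_sub (s3 (s, i)) => y [_ [? []]].
Qed.

Lemma chart_up x : chart_image B k0 x -> cancel (down (pt x)) (up (pt x)).
Proof. by move=> Ix; apply: tchangeK; [exact: dom_self|exact: param_dom]. Qed.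

Lemma chart_down x : chart_image B k0 x -> cancel (up (pt x)) (down (pt x)).
Proof. by move=> Ix; apply: tchangeK; [exact: param_dom|exact: dom_self]. Qed.

Lemma conn_christoffel x v Y : chart_image B k0 x -> smooth_near x (field_rep B k0 Y) ->
  down (pt x) (D (pt x) (up (pt x) v) Y)
  = 'D_v (field_rep B k0 Y) x + christoffel x v (field_rep B k0 Y x).
Proof.
move=> Ix sY; have dq := param_dom Ix.
have := @conn_chart _ _ _ _ _ _ LC k0 (pt x) (up (pt x) v) Y dq.
rewrite paramK // => /(_ sY); rewrite (chart_down Ix).
exact.
Qed.

Lemma chart_J_down s x Z : chart_image B k0 x -> down (pt x) (J s (pt x) Z) = chart_J s x (down (pt x) Z).
Proof. by move=> Ix; rewrite /chart_J /field_rep /extend (chart_up Ix). Qed.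

Lemma chart_metric_down x Y Z : chart_image B k0 x ->
  chart_metric x (down (pt x) Y) (down (pt x) Z) = G (pt x) Y Z.
Proof. by move=> Ix; rewrite /chart_metric /extend !(chart_up Ix). Qed.

Lemma chart_hyperhermitian x : chart_image B k0 x ->
  hyperhermitian (chart_J 0 x) (chart_J 1 x) (chart_J 2 x) (chart_metric x).
Proof.
move=> Ix; have q X := hk_quaternion hk (pt x) (memvf X).
have up_inj : injective (up (pt x)) := can_inj (chart_down Ix).
have upJ s w : up (pt x) (chart_J s x w) = J s (pt x) (up (pt x) w) by exact: chart_up.
have upN w : up (pt x) (- w) = - up (pt x) w by exact: (linear_NP (tchange_linear B _ _ _)).
have sq s w : chart_J s x (chart_J s x w) = - w.
  by apply: up_inj; rewrite !upJ upN; have [-> _ _ _] := q (up (pt x) w).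
have e12 w : chart_J 0 x (chart_J 1 x w) = chart_J 2 x w.
  by apply: up_inj; rewrite !upJ; have [_ -> _ _] := q (up (pt x) w).
have e21 w : chart_J 1 x (chart_J 0 x w) = - chart_J 2 x w.
  by apply: up_inj; rewrite upN !upJ; have [_ _ -> _] := q (up (pt x) w).
have hh s v w : chart_metric x (chart_J s x v) (chart_J s x w) = chart_metric x v w.
  by rewrite /chart_metric /extend !upJ (hk_hermitian hk).
split; try exact: chart_J_linear; try exact: hh.
- by apply: quaternionic_mk => //; exact: chart_J_linear.
- by split; [move=> Z; exact: chart_metric_linear1|exact: chart_metric_sym].
- move=> X X0; apply: (metric_pos (hk_metric hk)); apply: contra_neq X0 => E.
  by rewrite -(chart_down Ix X) -/(extend B k0 X (pt x)) E (linear_0P (tchange_linear B _ _ _)).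
Qed.

(** Finitely many components are smooth near the centre of the chart, so all of them
    are smooth on a common neighbourhood. There the identities for [christoffel]
    are those of the connection on the coordinate fields. *)
Lemma chart_hyperkahler : exists S : set vec, [/\ S (chart B k0 k0), S `<=` chart_image B k0
  & local_hyperkahler S chart_metric christoffel chart_J].
Proof.
have [S [oS S0 SI [sg sG sJ]]] := smooth_chart_data.
exists S; split=> //; split=> //.
- by move=> x Sx; exact: chart_hyperhermitian (SI _ Sx).
- by move=> x w Sx; exact: christoffel_linear1 (SI _ Sx).
- move=> x v w Sx; have Ix := SI _ Sx; have dq := param_dom Ix.
  have sv := smooth_extend v dq; have sw := smooth_extend w dq.
  have := conn_torsion_free LC sv sw; rewrite (bracket_extend v w dq) => /subr0_eq E.
  by rewrite /christoffel /field_rep E.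
- move=> x u v w Sx; have Ix := SI _ Sx; have dq := param_dom Ix.
  have sv := smooth_extend v dq; have sw := smooth_extend w dq.
  have sm : smooth_near (chart B k0 (pt x)) ((fun r => G r (extend B k0 v r) (extend B k0 w r)) \o pt).
    by rewrite paramK //; exists S; split=> //; exact: sg.
  have E1 := conn_metric LC (up (pt x) u) sv sw.
  have := vderiv_move (up (pt x) u) dq sm; rewrite E1 (chart_down Ix) (paramK Ix) => E2.
  apply: (etrans (esym E2)); congr (_ + _).
    by rewrite /chart_metric /extend (chart_up Ix).
  by rewrite /chart_metric /extend (chart_up Ix).
- move=> s x u w Sx; have Ix := SI _ Sx; have dq := param_dom Ix.
  have sw := smooth_extend w dq.
  have sn : smooth_near x (field_rep B k0 (fun q => J s q (extend B k0 w q))).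
    by exists S; split=> //; exact: sJ.
  have := conn_christoffel u Ix sn.
  rewrite (hk_parallel hk) // (chart_J_down _ _ Ix) => /esym/(canRL (addrK _)).
  exact.
Qed.

(** Coordinate fields commute, so the bracket term of the curvature vanishes. *)
Lemma curvature_christoffel v w u :
  curvature B D k0 v w u = curv christoffel (chart B k0 k0) v w u.
Proof.
have d0 := dom_self B k0; have I0 := image_chart d0.
have p0 : pt (chart B k0 k0) = k0 by rewrite chartK.
have key a b : D k0 (extend B k0 a k0) (fun q => D q (extend B k0 b q) (extend B k0 u))
  = 'D_a (fun x => christoffel x b u) (chart B k0 k0)
    + christoffel (chart B k0 k0) a (christoffel (chart B k0 k0) b u).
  have := @conn_christoffel (chart B k0 k0) a (fun q => D q (extend B k0 b q) (extend B k0 u)) I0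
    (smooth_christoffel0 b u).
  rewrite p0 (tchange_id _ d0) => E; apply: (etrans _ E).
  by rewrite /extend.
have D0 Z : smooth_field_at B k0 Z -> D k0 0 Z = 0.
  by move=> sZ; exact: (linear_0P (conn_linear LC sZ)).
rewrite /curvature /curvature_field (bracket_extend v w d0) D0; last exact: smooth_extend.
rewrite (key v w) (key w v) /curv subr0 opprD.
exact: (etrans (addrACA _ _ _ _) (addrA _ _ _)).
Qed.

End KahlerChart.

(** * Exterior derivatives and tangent maps in other charts *)

Section ExteriorDerivative.
Variables (R : realType) (d : nat) (T : topologicalType) (A : manifold R d T).
Local Notation vec := 'rV[R]_d.
Variable (eta : T -> vec -> R) (q : T).
Hypothesis eta_lin : forall r, linear (eta r : vec -> R^o).
Hypothesis eta_smooth : forall X, smooth_field_at A q X -> smooth_fun_at A q (fun r => eta r (X r)).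

(** In the chart at [q] the components of these fields are not constant, but the
    derivatives of the components only contribute the value of [eta] at the bracket
    of two coordinate fields of the chart at [p], which is zero. *)
Lemma dform_extend p v w : dom A p q ->
  dform A eta q (tchange A p q q v) (tchange A p q q w) =
  vderiv A q (tchange A p q q v) (fun r => eta r (extend A p w r))
  - vderiv A q (tchange A p q q w) (fun r => eta r (extend A p v r)).
Proof.
move=> dq; have dqq := dom_self A q.
pose e y a : R := eta (param A q y) (extend A q a (param A q y)).
have el y : chart_image A q y -> linear (e y : vec -> R^o).
  by move=> _ a u z; rewrite /e extend_linear eta_lin.
have de a : differentiable (e ^~ a) (chart A q q).
  have [S [_ Sx sS]] := eta_smooth (smooth_extend a dqq).
  exact: smooth_diff sS Sx.
have dY a : differentiable (field_rep A q (extend A p a)) (chart A q q).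
  have [S [_ Sx sS]] := smooth_extend a dq.
  exact: smooth_diff sS Sx.
have Iq := image_chart dqq.
have rq a : field_rep A q (extend A p a) (chart A q q) = extend A p a q.
  by rewrite /field_rep chartK // tchange_id.
have key a b : vderiv A q a (fun r => eta r (extend A p b r))
   = vderiv A q a (fun r => eta r (extend A q (extend A p b q) r))
     + eta q ('D_a (field_rep A q (extend A p b)) (chart A q q)).
  have := @derive_apply R d _ R^o (chart_image A q) e (@image_open _ _ _ A q) el
    (field_rep A q (extend A p b)) (chart A q q) a Iq de (dY b).
  rewrite rq {3}/e chartK // /extend tchange_id // => E.
  have N : \forall y \near chart A q q, eta (param A q y) (extend A p b (param A q y))
      = e y (field_rep A q (extend A p b) y).
    have := open_nbhs_nbhs (conj (@image_open _ _ _ A q) Iq).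
    by apply: filterS => y Iy; rewrite /e -extend_rep.
  exact: (etrans (near_eq_derive _ N) E).
have := bracket_extend v w dq; rewrite /bracket /dform => b0.
have h0 := etrans (congr1 (eta q) b0) (linear_0P (@eta_lin q)).
have h := etrans (esym (linear_BP (@eta_lin q) _ _)) h0.
rewrite (bracket_extend _ _ dqq) (linear_0P (@eta_lin q)) subr0.
have alg (a b x y : R) : x - y = 0 -> a - b = a + x - (b + y).
  by move=> /subr0_eq ->; rewrite opprD addrACA subrr addr0.
apply: (etrans (alg _ _ _ _ h)).
exact/esym/(congr2 (fun x y => x - y) (key _ w) (key _ v)).
Qed.

End ExteriorDerivative.

Section TangentMap.
Variables (R : realType) (m d : nat) (M K : topologicalType).
Variables (A : manifold R m M) (B : manifold R d K) (iota : M -> K).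
Hypothesis emb : smooth_embedding A B iota.

(** Chain rule through the charts at [q] and at its image. *)
Lemma push_tangent p x v : chart_image A p x -> dom B (iota p) (iota (param A p x)) ->
  let q := param A p x in
  push (map_rep A B iota p) x v
  = tchange B (iota q) (iota p) (iota q) (tangent_map A B iota q (tchange A p q q v)).
Proof.
move=> Ix dk q; have dq := param_dom Ix; have dqq := dom_self A q.
have dkk := dom_self B (iota q).
have ox : overlap A p q x by apply/overlapP.
have tx : trans A p q x = chart A q q by [].
have dt := trans_diff ox.
have dm : differentiable (map_rep A B iota q) (trans A p q x).
  by have [S [_ Sx sS]] := emb_smooth emb q; exact: smooth_diff sS Sx.
have mx : map_rep A B iota q (chart A q q) = chart B (iota q) (iota q).
  by rewrite /map_rep /= chartK.
have du : differentiable (trans B (iota q) (iota p)) (map_rep A B iota q (trans A p q x)).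
  by rewrite tx mx; exact/trans_diff/overlap_at.
have N : \forall y \near x, map_rep A B iota p y
    = (trans B (iota q) (iota p) \o (map_rep A B iota q \o trans A p q)) y.
  have n1 := open_nbhs_nbhs (conj (@open_overlap _ _ _ A p q) ox).
  have ci : \forall r \near q, dom B (iota q) (iota r).
    by apply: (emb_continuous emb); exact: near_dom.
  have n2 : \forall y \near x, dom B (iota q) (iota (param A p y)).
    by have := near_param dq ci; rewrite paramK.
  near=> y.
  have oy : overlap A p q y by near: y.
  have dy : dom B (iota q) (iota (param A p y)) by near: y.
  by rewrite /map_rep /trans /= -/(trans A p q y) (param_trans oy) chartK.
have dmt : differentiable (map_rep A B iota q \o trans A p q) x by exact: differentiable_comp.
have E1 : 'D_v (map_rep A B iota q \o trans A p q) x
    = tangent_map A B iota q (tchange A p q q v).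
  by apply: (etrans (derive_comp v dt dm)); rewrite (tchangeE v dq dqq) tx (paramK Ix).
apply: (etrans (near_eq_derive _ N)); apply: (etrans (derive_comp v dmt du)).
have mx' : (map_rep A B iota q \o trans A p q) x = chart B (iota q) (iota q) by [].
by rewrite E1 mx'.
Unshelve. all: by end_near. Qed.

End TangentMap.

(** * A qc hypersurface in charts *)

Lemma linear_SP (R : pzRingType) (U W : lmodType R) (T : U -> W) (I : Type) (r : seq I)
  (F : I -> U) : linear T -> T (\sum_(i <- r) F i) = \sum_(i <- r) T (F i).
Proof.
move=> lT; elim: r => [|i r IH]; first by rewrite !big_nil (linear_0P lT).
by rewrite !big_cons (linear_DP lT) IH.
Qed.

Section HypersurfaceCharts.
Variables (R : realType) (n : nat) (M K : topologicalType).
Local Notation m := (4 * n + 3)%N.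
Local Notation tan := 'rV[R]_m.
Local Notation vec := 'rV[R]_(m + 1).
Variables (A : manifold R m M) (B : manifold R (m + 1) K).
Variables (G : K -> vec -> vec -> R) (D : K -> vec -> (K -> vec) -> vec).
Variables (J : 'I_3 -> K -> {linear vec -> vec}) (iota : M -> K).
Hypotheses (n_ge1 : (1 <= n)%N) (hk : hyperkahler B G D J) (emb : smooth_embedding A B iota).
Variables (H : M -> {vspace tan}) (g : M -> tan -> tan -> R) (Q : M -> set (tan -> tan)).
Hypothesis qc : qc_structure A H g Q.
Hypothesis HJ : forall s p X, X \in H p -> exists2 Y, Y \in H p &
  tangent_map A B iota p Y = J s (iota p) (tangent_map A B iota p X).
Hypothesis QJ : forall s p, exists2 Phi, Q p Phi & forall X, X \in H p ->
  tangent_map A B iota p (Phi X) = J s (iota p) (tangent_map A B iota p X).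
Variable p0 : M.

Local Notation k0 := (iota p0).
Local Notation pt := (param A p0).
Local Notation phi := (map_rep A B iota p0).
Local Notation up x := (tchange A p0 (pt x) (pt x)).
Local Notation down x := (tchange A (pt x) p0 (pt x)).
Local Notation downK x := (tchange B (iota (pt x)) k0 (iota (pt x))).
Local Notation upK x := (tchange B k0 (iota (pt x)) (iota (pt x))).
Local Notation tmap x := (tangent_map A B iota (pt x)).
Local Notation x0 := (chart A p0 p0).
Local Notation gK := (chart_metric B G k0).
Local Notation JK := (chart_J B J k0).
Local Notation Ga := (christoffel B D k0).

Lemma tangent_map_linear p : linear (tangent_map A B iota p).
Proof. by move=> a u v; rewrite /tangent_map linearP. Qed.

Lemma tchange_up x : chart_image A p0 x -> cancel (down x) (up x).
Proof. by move=> Ix; apply: tchangeK; [exact: dom_self|exact: param_dom]. Qed.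

Lemma tchange_down x : chart_image A p0 x -> cancel (up x) (down x).
Proof. by move=> Ix; apply: tchangeK; [exact: param_dom|exact: dom_self]. Qed.

Definition chartable x := chart_image A p0 x /\ dom B k0 (iota (pt x)).

Lemma base_image x : chartable x -> chart_image B k0 (phi x).
Proof. by move=> [_ dk]; exact: image_chart. Qed.

Lemma base_pt x : chartable x -> param B k0 (phi x) = iota (pt x).
Proof. by move=> [_ dk]; rewrite /map_rep /= chartK. Qed.

Lemma base_push x v : chartable x -> push phi x v = downK x (tmap x (up x v)).
Proof. by move=> [Ix dk]; exact: push_tangent. Qed.

Lemma base_push_inj x v : chartable x -> push phi x v = 0 -> v = 0.
Proof.
move=> bx; rewrite base_push //; have [Ix dk] := bx => E.
have E1 : tmap x (up x v) = 0.
  have c : cancel (downK x) (upK x) by apply: tchangeK => //; exact: dom_self.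
  by rewrite -(c (tmap x _)) E (linear_0P (tchange_linear B _ _ _)).
have E2 : up x v = 0.
  by apply: (emb_immersion emb (p := pt x)); rewrite E1 (linear_0P (tangent_map_linear _)).
by rewrite -(tchange_down Ix v) E2 (linear_0P (tchange_linear A _ _ _)).
Qed.

Lemma base_J s x Z : chartable x -> JK s (phi x) (downK x Z) = downK x (J s (iota (pt x)) Z).
Proof.
move=> bx; have := chart_J_down J s Z (base_image bx).
by rewrite (base_pt bx) => ->.
Qed.

Lemma base_metric x Y Z : chartable x -> gK (phi x) (downK x Y) (downK x Z) = G (iota (pt x)) Y Z.
Proof.
move=> bx; have := chart_metric_down G Y Z (base_image bx).
by rewrite (base_pt bx).
Qed.

Variable S : set vec.
Hypothesis lhk : local_hyperkahler S gK Ga JK.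
Variables (U : set tan) (nu : tan -> vec) (W : set M).
Variables (eta : 'I_3 -> M -> {scalar tan}) (I : 'I_3 -> M -> {linear tan -> tan}).
Hypotheses (frame : qc_frame A H g Q W eta I).
Hypotheses (oU : open U) (U_ok : forall x, U x -> chartable x)
  (U_S : forall x, U x -> S (phi x)) (U_W : forall x, U x -> W (pt x)) (U_x0 : U x0).
Hypotheses (sphi : smooth_on U phi) (snu : smooth_on U nu).
Hypothesis nu1 : forall x, U x -> gK (phi x) (nu x) (nu x) = 1.
Hypothesis nuT : forall x v, U x -> gK (phi x) (nu x) (push phi x v) = 0.

Definition contact s x v : R := eta s (pt x) (extend A p0 v (pt x)).
Hypothesis seta : forall s v, smooth_on U (fun x => contact s x v).

Let pinj x v (Ux : U x) := @base_push_inj x v (U_ok Ux).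
Local Notation tan_hor := (tan_hor gK JK phi nu).
Local Notation horx x := (horizontal (JK 0 (phi x)) (JK 1 (phi x)) (JK 2 (phi x)) (gK (phi x)) (nu x)).
Local Notation Fx x s := (commdef (Lop gK Ga JK phi nu x) (gK (phi x)) (JK s (phi x))).

Lemma contact_linear s x : U x -> linear (contact s x : tan -> R^o).
Proof. by move=> _ a u v; rewrite /contact extend_linear linearP. Qed.

Lemma push_J s x v : U x -> up x v \in H (pt x) ->
  exists2 w, up x w \in H (pt x) & JK s (phi x) (push phi x v) = push phi x w.
Proof.
move=> Ux Hv; have bx := U_ok Ux; have [Y HY E] := HJ s Hv.
exists (down x Y); first by rewrite (tchange_up bx.1).
by rewrite !base_push // base_J // -E (tchange_up bx.1).
Qed.

(** The image of the horizontal space is tangent and invariant under the complex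
    structures, hence orthogonal to the J_s nu. *)
Lemma horizontal_tan_hor x v : U x -> up x v \in H (pt x) -> tan_hor x v.
Proof.
move=> Ux Hv s; have [w _ E] := push_J s Ux Hv.
have b := g_bilin lhk (U_S Ux).
by rewrite /eta0 (bsym_sym b) (J_skew lhk s _ _ (U_S Ux)) E (bsym_sym b) nuT // oppr0.
Qed.

(** Both sides are subspaces of dimension 4n, since the three forms on the left are
    independent on the tangent space by [eta0_reeb]. *)
Lemma tan_horE x v : U x -> tan_hor x v <-> up x v \in H (pt x).
Proof.
move=> Ux; split; last exact: horizontal_tan_hor.
move=> hv; have bx := U_ok Ux.
pose th (w : tan) : 'rV[R]_3 := \row_s eta0 gK JK phi nu s x (down x w).
have e0l s := eta0_linear lhk nu U_S sphi s Ux.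
have thl : linear th.
  by move=> a u w; apply/rowP => s; have cl := tchange_linear A (pt x) p0 (pt x) a u w; rewrite !mxE cl; exact: e0l.
pose thM := GRing.isLinear.Build _ _ _ _ th thl.
pose thL : {linear tan -> 'rV[R]_3} := HB.pack th thM.
have thE w : linfun thL w = th w by rewrite lfunE.
have sub : (H (pt x) <= lker (linfun thL))%VS.
  apply/subvP => w Hw; rewrite memv_ker thE; apply/eqP/rowP => s; rewrite !mxE.
  by apply: horizontal_tan_hor => //; rewrite (tchange_up bx.1).
have im : limg (linfun thL) = fullv.
  apply/vspaceP => z; rewrite memvf.
  pose w := up x (\sum_t z 0 t *: tproj phi nu x (JK t (phi x) (nu x))).
  have -> : z = linfun thL w; last exact: memv_img (memvf w).
  apply/rowP => s; rewrite thE mxE /w (tchange_down bx.1).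
  have reeb := eta0_reeb lhk U_S sphi nu1 nuT pinj s.
  have e0Z a u : eta0 gK JK phi nu s x (a *: u) = a * eta0 gK JK phi nu s x u.
    exact: (linear_ZP (e0l s)).
  rewrite (linear_SP _ _ (e0l s)) (bigD1 s) //= big1 ?addr0.
    by rewrite e0Z reeb // eqxx mulr1.
  by move=> t ts; rewrite e0Z reeb // eq_sym (negPf ts) mulr0.
have dims : \dim (lker (linfun thL)) = \dim (H (pt x)).
  have := limg_ker_dim (linfun thL) fullv.
  rewrite im !dimvf /dim /= !mul1n capfv (qc_codim qc) => /addIn.
  exact.
have /eqP E : H (pt x) == lker (linfun thL) by rewrite eqEdim sub dims leqnn.
rewrite E memv_ker thE; apply/eqP/rowP => s.
by rewrite !mxE (tchange_down bx.1) hv.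
Qed.

Lemma deta_contact s x v w : U x ->
  dform A (eta s) (pt x) (up x v) (up x w)
  = 'D_v (contact s ^~ w) x - 'D_w (contact s ^~ v) x.
Proof.
move=> Ux; have bx := U_ok Ux; have dq := param_dom bx.1.
have se := frame_eta_smooth frame s.
have elin r : linear (eta s r : tan -> R^o) by move=> a u z; rewrite linearP.
have E := @dform_extend _ _ _ A (eta s) (pt x) elin (fun X => se _ X (U_W Ux)) p0 v w dq.
apply: (etrans E).
have key a b : vderiv A (pt x) (up x a) (fun r => eta s r (extend A p0 b r)) = 'D_a (contact s ^~ b) x.
  have sm : smooth_near (chart A p0 (pt x)) ((fun r => eta s r (extend A p0 b r)) \o pt).
    by rewrite (paramK bx.1); exists U; split=> //; exact: seta.
  by have := vderiv_move (up x a) dq sm; rewrite (tchange_down bx.1) (paramK bx.1).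
exact: (congr2 (fun x y => x - y) (key v w) (key w v)).
Qed.

Lemma frame_qc_at x : U x ->
  qc_at (tan_hor x) (fun v w => g (pt x) (up x v) (up x w)) (fun s v => down x (I s (pt x) (up x v)))
    (fun s v w => 'D_v (contact s ^~ w) x - 'D_w (contact s ^~ v) x).
Proof.
move=> Ux; have bx := U_ok Ux; have upK := tchange_up bx.1.
have E v := tan_horE v Ux; have Wq := U_W Ux.
have upl : linear (up x) := tchange_linear A _ _ _.
split.
- by move=> a u v w /E hu /E hv /E hw; rewrite upl (qc_linear qc).
- by move=> v w /E hv /E hw; exact: (qc_sym qc).
- move=> v /E hv v0; apply: (qc_pos qc) => //; apply: contra_neq v0 => v0.
  by rewrite -(tchange_down bx.1 v) v0 (linear_0P (tchange_linear A _ _ _)).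
- by move=> s v /E hv; apply/E; rewrite upK (frame_I_stable frame).
- move=> s v /E hv; rewrite upK; have [sq _ _ _] := frame_quaternion frame Wq hv.
  by rewrite sq (linear_NP (tchange_linear A _ _ _)) (tchange_down bx.1).
- by move=> s v w /E hv /E hw; rewrite !upK (frame_hermitian frame).
- by move=> s v w /E hv /E hw; rewrite upK (frame_deta frame) // deta_contact.
Qed.

Lemma qc_shape_chart x : U x ->
  (forall X Y, horx x X ->
     horx x Y ->
     [/\ Fx x 0 X Y = 0,
         Fx x 1 X Y = 0
       & Fx x 2 X Y = 0]) /\
  (forall X, horx x X ->
     X != 0 -> gK (phi x) X (Lop gK Ga JK phi nu x X) != 0).
Proof.
move=> Ux; have bx := U_ok Ux; have Wq := U_W Ux.
have : forall t, exists b : 'I_3 -> R, forall v, tan_hor x v ->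
    push phi x (\sum_u b u *: down x (I u (pt x) (up x v))) = JK t (phi x) (push phi x v).
  move=> t; have [Phi QPhi EPhi] := QJ t (pt x).
  have [a Ea] := (frame_generate frame Phi Wq).1 QPhi.
  exists a => v /(tan_horE _ Ux) hv; rewrite !base_push // base_J // -EPhi // Ea //.
  congr (downK x (tmap x _)); rewrite (linear_SP _ _ (tchange_linear A _ _ _)).
  by apply: eq_bigr => u _; rewrite (linear_ZP (tchange_linear A _ _ _)) (tchange_up bx.1).
move=> /choice[b Hb].
have ker s y v : U y -> tan_hor y v -> contact s y v = 0.
  by move=> Uy /(tan_horE _ Uy) /(frame_ker frame _ (U_W Uy)); exact.
exact: (qc_shape lhk oU U_S sphi snu nu1 nuT pinj contact_linear seta ker Ux (frame_qc_at Ux) Hb).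
Qed.

Lemma horizontal_nonzero x : U x ->
  exists2 X, horx x X & X != 0.
Proof.
move=> Ux; have bx := U_ok Ux; have b := g_bilin lhk (U_S Ux).
pose z := vpick (H (pt x)).
have z0 : z != 0.
  rewrite vpick0 -dimv_eq0 (qc_codim qc) muln_eq0 /=.
  by case: n n_ge1.
have zH : up x (down x z) \in H (pt x) by rewrite (tchange_up bx.1) memv_pick.
exists (push phi x (down x z)).
  have e0 s := horizontal_tan_hor Ux zH s.
  by split; rewrite (bsym_sym b); [exact: nuT|exact: (e0 0)|exact: (e0 1)|exact: (e0 2)].
apply: contra_neq z0 => /(pinj Ux) E.
by rewrite -(tchange_up bx.1 z) E (linear_0P (tchange_linear A _ _ _)).
Qed.

Lemma curvature_local_normal v w : curvature B D k0 v w (nu x0) = 0.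
Proof.
have phi0 : phi x0 = chart B k0 k0 by rewrite /map_rep /= chartK //; exact: dom_self.
rewrite (curvature_christoffel hk) -phi0.
apply: (hypersurface_curvature lhk oU U_S sphi snu nu1 nuT pinj) => //.
- by move=> x X Y Ux; have [h _] := qc_shape_chart Ux; exact: h.
- by move=> x X Ux; have [_ h] := qc_shape_chart Ux; exact: h.
- exact: horizontal_nonzero.
Qed.

End HypersurfaceCharts.

(** * Unit normals near a point *)

Section UnitNormal.
Variables (R : realType) (m : nat).
Local Notation vec := 'rV[R]_(m + 1).
Local Notation tan := 'rV[R]_m.
Variables (O : set vec) (g : vec -> vec -> vec -> R)
  (Ga : vec -> vec -> vec -> vec) (J : 'I_3 -> vec -> vec -> vec).
Hypothesis H : local_hyperkahler O g Ga J.
Variables (U : set tan) (phi : tan -> vec).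
Hypotheses (oU : open U) (phiU : forall x, U x -> O (phi x)) (sphi : smooth_on U phi)
  (pinj : forall x v, U x -> push phi x v = 0 -> v = 0).
Let b x (Ux : U x) := g_bilin H (phiU Ux).
Let e (i : 'I_m) : tan := delta_mx 0 i.

Definition gram x : 'M[R]_m := \matrix_(i, j) g (phi x) (push phi x (e i)) (push phi x (e j)).

Lemma gram_mul x u j : U x -> (u *m gram x) 0 j = g (phi x) (push phi x u) (push phi x (e j)).
Proof.
move=> Ux; have l : linear (fun u => g (phi x) (push phi x u) (push phi x (e j)) : R^o).
  by move=> a v w; rewrite (push_linear sphi Ux) (bsymDl (b Ux)) (bsymZl (b Ux)).
rewrite (linear_rowE u l) mxE; by apply: eq_bigr => i _; rewrite mxE.
Qed.

Lemma g_push_row x X v : U x ->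
  g (phi x) X (push phi x v) = \sum_j v 0 j * g (phi x) X (push phi x (e j)).
Proof.
move=> Ux; have l : linear (fun u => g (phi x) X (push phi x u) : R^o).
  by move=> a u w; rewrite (push_linear sphi Ux) (bsymDr (b Ux)) (bsymZr (b Ux)).
exact: (linear_rowE v l).
Qed.

Lemma gram_unit x : U x -> gram x \in unitmx.
Proof.
move=> Ux; rewrite -row_free_unit; apply/inj_row_free => u u0.
apply: (pinj Ux); apply/eqP; apply: contraT => p0.
have := hyp_pos (lhk_herm H (phiU Ux)) p0; rewrite g_push_row // big1 ?ltxx //.
by move=> j _; rewrite -gram_mul // u0 mxE mulr0.
Qed.

Variable n0 : vec.

(** The orthogonal projection onto the tangent space has coefficients given by the
    inverse of the Gram matrix. *)
Definition normal_part x : vec :=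
  n0 - push phi x ((\row_j g (phi x) n0 (push phi x (e j))) *m invmx (gram x)).

Lemma normal_part_orth x v : U x -> g (phi x) (normal_part x) (push phi x v) = 0.
Proof.
move=> Ux; rewrite g_push_row // big1 // => j _.
by rewrite /normal_part (bsymBl (b Ux)) -gram_mul // mulmxKV ?gram_unit // mxE subrr mulr0.
Qed.

Lemma smooth_normal_part : smooth_on U normal_part.
Proof.
have sg i j : smooth_on U (fun x => gram x i j).
  apply: (smooth_ext oU _ (smooth_g H oU phiU sphi (smooth_push sphi (e i)) (smooth_push sphi (e j)))).
  by move=> x _; rewrite mxE.
have si i j := smooth_invmx i j oU gram_unit sg.
apply: smooth_sub2 => //; first exact: smooth_cst.
apply: (smooth_apply oU (push_linear sphi)); first exact: smooth_push.
apply: smooth_row => // j.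
apply: (smooth_ext oU (f := fun x => \sum_i g (phi x) n0 (push phi x (e i)) * invmx (gram x) i j)).
  by move=> x _; rewrite mxE; apply: eq_bigr => i _; rewrite mxE.
apply: smooth_sum => // i; apply: smooth_mul => //.
by apply: (smooth_g H oU phiU sphi) => //; [exact: smooth_cst|exact: smooth_push].
Qed.

Lemma unit_normal_germ x : U x -> normal_part x != 0 ->
  exists nu, [/\ smooth_near x nu, \forall y \near x, g (phi y) (nu y) (nu y) = 1
    & \forall y \near x, forall v, g (phi y) (nu y) (push phi y v) = 0].
Proof.
move=> Ux n_neq0; pose f y := g (phi y) (normal_part y) (normal_part y).
have sf : smooth_on U f by apply: (smooth_g H oU phiU sphi); exact: smooth_normal_part.
have fx : 0 < f x := hyp_pos (lhk_herm H (phiU Ux)) n_neq0.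
have cf : {for x, continuous f} := differentiable_continuous (smooth_diff sf Ux).
have nf : \forall y \near x, 0 < f y by exact: (cf _ (lt_nbhsr fx)).
have nU : \forall y \near x, U y := open_nbhs_nbhs (conj oU Ux).
have : nbhs x [set y | U y /\ 0 < f y] by rewrite /=; near=> y; split; near: y.
rewrite nbhsE => -[V [oV Vx] sV].
have nV : \forall y \near x, V y := open_nbhs_nbhs (conj oV Vx).
exists (fun y => (Num.sqrt (f y))^-1 *: normal_part y).
have sq y : V y -> Num.sqrt (f y) != 0 by move=> /sV[_ h]; rewrite gt_eqF // sqrtr_gt0.
split.
- exists V; split=> //; have sfV : smooth_on V f by apply: smooth_sub sf => y /sV[].
  have sr := smooth_sqrt oV (fun y Vy => (sV y Vy).2) sfV.
  apply: (smooth_scale oV (smooth_inv oV sq sr)).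
  by apply: smooth_sub smooth_normal_part => y /sV[].
- apply: filterS nV => y Vy; have [Uy fy] := sV _ Vy.
  rewrite (bsymZl (b Uy)) (bsymZr (b Uy)) -/(f y) mulrA -invfM -expr2 sqr_sqrtr ?ltW //.
  by rewrite mulVf // gt_eqF.
- apply: filterS nV => y Vy v; have [Uy fy] := sV _ Vy.
  by rewrite (bsymZl (b Uy)) normal_part_orth // mulr0.
Unshelve. all: by end_near. Qed.

End UnitNormal.

(** The image of [T] has dimension at most [m]. *)
Lemma vector_outside (R : fieldType) m (T : 'rV[R]_m -> 'rV[R]_(m + 1)) :
  linear T -> exists n0, forall v, n0 != T v.
Proof.
move=> lT; pose E : 'M[R]_(m, m + 1) := \matrix_(i, j) T (delta_mx 0 i) 0 j.
have TE v : T v = v *m E.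
  have lTM := GRing.isLinear.Build _ _ _ _ T lT.
  pose TL : {linear 'rV[R]_m -> 'rV[R]_(m + 1)} := HB.pack T lTM.
  rewrite -[T]/(TL : _ -> _) {1}(row_sum_delta v) linear_sum mulmx_sum_row.
  apply: eq_bigr => i _; rewrite linearZ; congr (_ *: _).
  by apply/rowP => j; rewrite !mxE.
have [/row_subP sub|/row_subPn[i ni]] := boolP ((1%:M : 'M[R]_(m + 1)) <= E)%MS.
  have : (\rank (1%:M : 'M[R]_(m + 1)) <= m)%N.
    by apply: leq_trans (mxrankS _) (rank_leq_row E); exact/row_subP.
  by rewrite mxrank1 -{2}(addn0 m) leq_add2l.
exists (row i 1%:M) => v; apply: contraNneq ni => ->.
by rewrite TE submxMl.
Qed.

(** * Curvature along a qc hypersurface *)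

Section HypersurfaceCurvature.
Variables (R : realType) (n : nat) (M K : topologicalType).
Local Notation m := (4 * n + 3)%N.
Local Notation tan := 'rV[R]_m.
Local Notation vec := 'rV[R]_(m + 1).
Variables (A : manifold R m M) (B : manifold R (m + 1) K).
Variables (G : K -> vec -> vec -> R) (D : K -> vec -> (K -> vec) -> vec).
Variables (J : 'I_3 -> K -> {linear vec -> vec}) (iota : M -> K).
Hypotheses (n_ge1 : (1 <= n)%N) (hk : hyperkahler B G D J) (emb : smooth_embedding A B iota).
Variables (H : M -> {vspace tan}) (g : M -> tan -> tan -> R) (Q : M -> set (tan -> tan)).
Hypothesis qc : qc_structure A H g Q.
Hypothesis HJ : forall s p X, X \in H p -> exists2 Y, Y \in H p &
  tangent_map A B iota p Y = J s (iota p) (tangent_map A B iota p X).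
Hypothesis QJ : forall s p, exists2 Phi, Q p Phi & forall X, X \in H p ->
  tangent_map A B iota p (Phi X) = J s (iota p) (tangent_map A B iota p X).
Variable p0 : M.

Local Notation k0 := (iota p0).
Local Notation pt := (param A p0).
Local Notation phi := (map_rep A B iota p0).
Local Notation x0 := (chart A p0 p0).
Local Notation gK := (chart_metric B G k0).

Lemma map_rep_at : phi x0 = chart B k0 k0.
Proof. by rewrite /map_rep /= chartK //; exact: dom_self. Qed.

Lemma map_rep_continuous : {for x0, continuous phi}.
Proof.
have [S [_ Sx sS]] := emb_smooth emb p0.
exact: differentiable_continuous (smooth_diff sS Sx).
Qed.

Lemma near_chartable : \forall x \near x0, chartable A B iota p0 x.
Proof.
have d0 := dom_self A p0.
have n1 : \forall x \near x0, chart_image A p0 x.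
  exact: open_nbhs_nbhs (conj (@image_open _ _ _ A p0) (image_chart d0)).
have n2 : \forall x \near x0, dom B k0 (iota (pt x)).
  apply: (@near_param _ _ _ A p0 p0 (fun r => dom B k0 (iota r)) d0).
  by apply: (emb_continuous emb); exact/near_dom/dom_self.
by near=> x; split; near: x.
Unshelve. all: by end_near. Qed.

Lemma smooth_near_contact (W : set M) eta I : qc_frame A H g Q W eta I -> W p0 ->
  \forall x \near x0, exists S : set tan,
    [/\ open S, S x & forall s v, smooth_on S (fun y => contact A p0 eta s y v)].
Proof.
move=> frame Wp; have d0 := dom_self A p0.
have sc (si : 'I_3 * 'I_m) : smooth_near x0 (fun y => contact A p0 eta si.1 y (delta_mx 0 si.2)).
  by apply: (frame_eta_smooth frame) => //; exact: smooth_extend.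
apply: filterS (smooth_near_fin sc) => x [S [oS Sx sS]].
exists S; split=> // s v.
apply: (smooth_linear1 (W := R^o) (F := contact A p0 eta s) oS).
  by move=> y _ a u w; rewrite /contact extend_linear linearP.
by move=> i; exact: (sS (s, i)).
Qed.

(** Only the germ of the normal enters, so a normal constructed near the point is
    enough. *)
Lemma curvature_normal_germ (nu : tan -> vec) : smooth_near x0 nu ->
  (\forall x \near x0, gK (phi x) (nu x) (nu x) = 1) ->
  (\forall x \near x0, forall v, gK (phi x) (nu x) (push phi x v) = 0) ->
  forall v w, curvature B D k0 v w (nu x0) = 0.
Proof.
move=> [S1 [oS1 S1x sS1]] n1 nT v w; have d0 := dom_self A p0.
have [S2 [oS2 S2x sS2]] := emb_smooth emb p0.
have [S [Sk SI lhk]] := chart_hyperkahler hk k0.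
have [W [eta [I [oW Wp frame _]]]] := qc_local qc p0.
have [S3 [oS3 S3x sS3]] := nbhs_singleton (smooth_near_contact frame Wp).
have nS : \forall x \near x0, S (phi x).
  have NS : nbhs (phi x0) S by rewrite map_rep_at; exact: open_nbhs_nbhs (conj (lhk_open lhk) Sk).
  exact: (map_rep_continuous NS).
have nW : \forall x \near x0, W (pt x).
  by apply: (near_param d0); exact: open_nbhs_nbhs.
have nb := near_chartable.
have m1 : \forall x \near x0, S1 x := open_nbhs_nbhs (conj oS1 S1x).
have m2 : \forall x \near x0, S2 x := open_nbhs_nbhs (conj oS2 S2x).
have m3 : \forall x \near x0, S3 x := open_nbhs_nbhs (conj oS3 S3x).
have : nbhs x0 [set x | [/\ chartable A B iota p0 x, S (phi x), W (pt x) &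
    [/\ S1 x, S2 x, S3 x, gK (phi x) (nu x) (nu x) = 1
      & forall v, gK (phi x) (nu x) (push phi x v) = 0]]].
  rewrite /=; near=> x.
  by split; [near: x|near: x|near: x|split; near: x].
rewrite nbhsE => -[U [oU Ux0] sU].
apply: (curvature_local_normal n_ge1 hk emb qc HJ QJ lhk frame oU (nu := nu)) => //.
- by move=> x /sU[].
- by move=> x /sU[].
- by move=> x /sU[].
- by apply: smooth_sub sS2 => x /sU[_ _ _ []].
- by apply: smooth_sub sS1 => x /sU[_ _ _ []].
- by move=> x /sU[_ _ _ []].
- by move=> x u /sU[_ _ _ []].
- by move=> s u; apply: smooth_sub (sS3 s u) => x /sU[_ _ _ []].
Unshelve. all: by end_near. Qed.

Lemma curvature_unit_normal (N : M -> vec) v w : unit_normal_field A B iota G N ->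
  curvature B D k0 v w (N p0) = 0.
Proof.
move=> hN; pose nu x := tchange B (iota (pt x)) k0 (iota (pt x)) (N (pt x)).
have d0 := dom_self A p0.
have -> : N p0 = nu x0 by rewrite /nu chartK // tchange_id //; exact: dom_self.
apply: curvature_normal_germ.
- exact: normal_smooth hN p0.
- apply: filterS near_chartable => x bx.
  by rewrite /nu base_metric //; exact: (normal_unit hN).
- apply: filterS near_chartable => x bx u.
  by rewrite /nu base_push // base_metric //; exact: (normal_orthogonal hN).
Qed.

(** A unit normal near the point exists, and it is a nonzero vector in the kernel of
    all curvature endomorphisms. *)
Lemma degenerate_hypersurface : degenerate_at B D k0.
Proof.
have d0 := dom_self A p0.
have [S2 [oS2 S2x sS2]] := emb_smooth emb p0.
have [S [Sk SI lhk]] := chart_hyperkahler hk k0.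
have nS : \forall x \near x0, S (phi x).
  have NS : nbhs (phi x0) S by rewrite map_rep_at; exact: open_nbhs_nbhs (conj (lhk_open lhk) Sk).
  exact: (map_rep_continuous NS).
have nb := near_chartable.
have m2 : \forall x \near x0, S2 x := open_nbhs_nbhs (conj oS2 S2x).
have : nbhs x0 [set x | [/\ chartable A B iota p0 x, S (phi x) & S2 x]].
  by rewrite /=; near=> x; split; near: x.
rewrite nbhsE => -[U [oU Ux0] sU].
have phiU x : U x -> S (phi x) by move=> /sU[].
have sphi : smooth_on U phi by apply: smooth_sub sS2 => x /sU[].
have pinj x v : U x -> push phi x v = 0 -> v = 0.
  by move=> /sU[bx _ _]; exact: (base_push_inj emb bx).
have [n0 Hn0] := vector_outside (push_linear sphi Ux0).
have np0 : normal_part gK phi n0 x0 != 0 by rewrite subr_eq0.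
have [nu [snu nu1 nuT]] := unit_normal_germ lhk oU phiU sphi pinj Ux0 np0.
exists (nu x0); last exact: curvature_normal_germ.
apply: contraTneq (ltr01 : 0 < 1 :> R) => nu0.
rewrite -(nbhs_singleton nu1) nu0 (bsym0l (g_bilin lhk (phiU _ Ux0))).
by rewrite ltxx.
Unshelve. all: by end_near. Qed.

End HypersurfaceCurvature.

(** The dimension of [K] is a variable because 4n + 3 + 1 and 4n + 4 are equal but
    not convertible. *)
Lemma qc_hypersurface_curvature (R : realType) (n d : nat) (M K : topologicalType)
    (A : manifold R (4 * n + 3) M) (B : manifold R d K)
    (G : K -> 'rV[R]_d -> 'rV[R]_d -> R)
    (D : K -> 'rV[R]_d -> (K -> 'rV[R]_d) -> 'rV[R]_d)
    (J : 'I_3 -> K -> {linear 'rV[R]_d -> 'rV[R]_d}) (iota : M -> K)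
    (H : M -> {vspace 'rV[R]_(4 * n + 3)})
    (g : M -> 'rV[R]_(4 * n + 3) -> 'rV[R]_(4 * n + 3) -> R)
    (Q : M -> set ('rV[R]_(4 * n + 3) -> 'rV[R]_(4 * n + 3))) :
  (4 * n + 3 + 1)%N = d -> (1 <= n)%N -> hyperkahler B G D J ->
  smooth_embedding A B iota -> qc_structure A H g Q ->
  (forall s p X, X \in H p -> exists2 Y, Y \in H p &
    tangent_map A B iota p Y = J s (iota p) (tangent_map A B iota p X)) ->
  (forall s p, exists2 Phi, Q p Phi & forall X, X \in H p ->
    tangent_map A B iota p (Phi X) = J s (iota p) (tangent_map A B iota p X)) ->
  (forall N : M -> 'rV[R]_d, unit_normal_field A B iota G N ->
    forall p v w, curvature B D (iota p) v w (N p) = 0) /\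
  (forall p, degenerate_at B D (iota p)).
Proof.
move=> Ed; case: _ / Ed in B G D J *; move=> n1 hk emb qc HJ QJ.
split=> [N hN p v w|p].
  exact: (curvature_unit_normal n1 hk emb qc HJ QJ).
exact: (degenerate_hypersurface n1 hk emb qc HJ QJ).
Qed.

Local Open Scope ring_scope.

Theorem theorem3p10 (R : realType) (n : nat) (M K : topologicalType)
    (A : manifold R (4 * n + 3) M) (B : manifold R (4 * n + 4) K)
    (G : K -> 'rV[R]_(4 * n + 4) -> 'rV[R]_(4 * n + 4) -> R)
    (D : K -> 'rV[R]_(4 * n + 4) -> (K -> 'rV[R]_(4 * n + 4)) ->
         'rV[R]_(4 * n + 4))
    (J : 'I_3 -> K -> {linear 'rV[R]_(4 * n + 4) -> 'rV[R]_(4 * n + 4)})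
    (iota : M -> K)
    (n_ge1 : (1 <= n)%N)
    (K_hyperkahler : hyperkahler B G D J)
    (M_qc : qc_hypersurface A B J iota) :
  (forall N : M -> 'rV[R]_(4 * n + 4), unit_normal_field A B iota G N ->
    forall p v w, curvature B D (iota p) v w (N p) = 0) /\
  (forall p, degenerate_at B D (iota p)).
Proof.
have [emb [H [g [Q [qc HJ QJ]]]]] := M_qc.
have Ed : (4 * n + 3 + 1 = 4 * n + 4)%N by rewrite -addnA.
exact: (qc_hypersurface_curvature Ed n_ge1 K_hyperkahler emb qc HJ QJ).
Qed.
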